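(* Let $k\ge 1$ be an integer and let $\gamma\in P_+^k$. Consider the discrete Dirichlet problem which consists in finding eigenvalues $\lambda$ and (not identically zero, complex-valued) eigenfunctions $f$ defined on $\{x\in P:\ x+\rho\in A_k\}$ satisfying $$\Delta_\gamma f(x)+\lambda f(x)=0\ \text{ if } x\in P_+^k,\qquad f(x)=0\ \text{ if } x\notin P_+^k,$$ where $\Delta_\gamma f=p_\gamma f-f$. If $\gamma$ is minuscule, then: (1) for every $\sigma\in P_+^k$, $1-\frac{1}{\dim(\gamma)}\chi_\gamma(\sigma)$ is an eigenvalue, with a corresponding eigenfunction $f_\sigma$ defined by $f_\sigma(\beta)=\chi_\beta(\sigma)$ for $\beta\in P_+^k$ (and $f_\sigma(x)=0$ for $x\notin P_+^k$); (2) the eigenfunction $f_0$ (i.e. $\sigma=0$) is a Perron-Frobenius eigenfunction. In particular, the Markov kernel $q_\gamma$ of the random walk in the level $k$ alcove with increment $\gamma$ is a Doob transform of $p_\gamma$: for all $x,y\in P_+^k$, $$q_\gamma(x,y)=\frac{f_0(y)}{\frac{\chi_\gamma(0)}{\dim(\gamma)}\,f_0(x)}\;p_\gamma(x,y).$$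
   Context: Setting. $K$ is a simple, connected, compact Lie group with Lie algebra $\mathfrak k$, complexified Lie algebra $\mathfrak g$, and maximal torus $T$ with Lie algebra $\mathfrak t$. Roots are real: $R=\{\alpha\in\mathfrak t^*\ (\alpha\neq 0):\exists X\in\mathfrak g\setminus\{0\},\ [H,X]=i\alpha(H)X\ \forall H\in\mathfrak t\}$. $\Sigma$ is a set of simple roots, $R_+$ the positive roots, $\rho$ their half sum, $\theta$ the highest root, $\alpha^\vee\in\mathfrak t$ the coroot of $\alpha$ (so $\alpha(\alpha^\vee)=2$), $h^\vee=1+\rho(\theta^\vee)$ the dual Coxeter number, $W$ the Weyl group acting on $\mathfrak t^*$. $\mathfrak k$ carries the $K$-invariant inner product $(\cdot|\cdot)$ with $(\theta^\vee|\theta^\vee)=2$, and $\nu:h\mapsto(h|\cdot)$ identifies $\mathfrak k$ with $\mathfrak k^*$ (and $\mathfrak t$ with $\mathfrak t^*$). $P=\{\lambda\in\mathfrak t^*:\lambda(\alpha^\vee)\in\mathbb Z\ \forall\alpha\in R\}$, $\mathcal C=\{\lambda\in\mathfrak t^*:\lambda(\alpha^\vee)\ge0\ \forall\alpha\in\Sigma\}$, $P_+=P\cap\mathcal C$. For $\lambda\in P_+$, $V_\lambda$ is the irreducible representation of $\mathfrak g$ with highest weight $\lambda$, $K_\lambda^\beta$ is the dimension of its $\beta$-weight space, $\dim(\lambda)=\dim V_\lambda$, and $\mathrm{ch}_\lambda(x)=\sum_{\beta\in P}K_\lambda^\beta e^{2i\pi\beta(x)}$, $x\in\mathfrak t$.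 Alcoves and fusion. $A_k=\{\lambda\in\mathfrak t^*:\lambda(\alpha^\vee)\ge0\ \forall\alpha\in\Sigma,\ \lambda(\theta^\vee)\le k+h^\vee\}$ and $P_+^k=\{\lambda\in P_+:\lambda(\theta^\vee)\le k\}$ (the level $k$ alcove). The level $k$ discretized character is $\chi_\lambda(\sigma)=\mathrm{ch}_\lambda\big(-\nu^{-1}(\frac{\sigma+\rho}{k+h^\vee})\big)$, $\sigma\in P_+^k$. The level $k$ fusion coefficients $N_{\lambda,\gamma}^\beta$ ($\lambda,\gamma,\beta\in P_+^k$) are the unique non-negative integers with $\chi_\lambda(\sigma)\chi_\gamma(\sigma)=\sum_{\beta\in P_+^k}N_{\lambda,\gamma}^\beta\chi_\beta(\sigma)$ for all $\sigma\in P_+^k$. One has $\chi_\lambda(0)>0$ for $\lambda\in P_+^k$. The random walk in the level $k$ alcove with increment $\gamma\in P_+^k$ is the Markov process on $P_+^k$ with kernel $q_\gamma(\lambda,\beta)=N_{\lambda,\gamma}^\beta\frac{\chi_\beta(0)}{\chi_\lambda(0)\chi_\gamma(0)}$. $p_\gamma$ is the transition kernel on $P$ given by $p_\gamma(\lambda,\beta)=K_\gamma^{\beta-\lambda}/\dim(\gamma)$, and $p_\gamma f(x)=\sum_y p_\gamma(x,y)f(y)$, with $f$ taken to be $0$ outside $P_+^k$. A weight $\gamma\in P_+$ is minuscule if the set of weights of $V_\gamma$ is $\{w(\gamma):w\in W\}$. A Perron-Frobenius eigenfunction is an eigenfunction which is positive on $P_+^k$ and is associated with the smallest eigenvalue $\lambda$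 of the Dirichlet problem, i.e. the eigenvalue $\lambda$ such that $1-\lambda$ is the spectral radius of the restriction of $p_\gamma$ to $P_+^k\times P_+^k$. *)

(* Defs.v *)
From HB Require Import structures.
From mathcomp Require Import all_boot all_order all_algebra.
From mathcomp Require Import complex.
From mathcomp Require Import all_classical all_reals all_analysis.

Set Implicit Arguments.
Unset Strict Implicit.
Unset Printing Implicit Defensive.

Import Order.TTheory GRing.Theory Num.Theory.
Local Open Scope classical_set_scope.
Local Open Scope ring_scope.
Local Open Scope complex_scope.

(* The Lie algebra of a simple compact connected Lie group, together with its
   invariant inner product.  Compactness of the group is the existence of an
   invariant positive definite form; invariance under the connected group is
   invariance under ad. *)
Record simpleCompactLie (R : realType) := SimpleCompactLie {
  lie_sort :> vectType R;
  bracket : lie_sort -> lie_sort -> lie_sort;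
  inner : lie_sort -> lie_sort -> R;
  bracket_linearl : forall (a : R) (x y z : lie_sort),
    bracket (a *: x + y) z = a *: bracket x z + bracket y z;
  bracket_linearr : forall (a : R) (x y z : lie_sort),
    bracket z (a *: x + y) = a *: bracket z x + bracket z y;
  bracket_alt : forall x : lie_sort, bracket x x = 0;
  bracket_jacobi : forall x y z : lie_sort,
    bracket x (bracket y z) + bracket y (bracket z x)
      + bracket z (bracket x y) = 0;
  bracket_nonabelian : exists x y : lie_sort, bracket x y != 0;
  bracket_simple : forall I : {vspace lie_sort},
    (forall x y : lie_sort, y \in I -> bracket x y \in I) ->
    I = 0%VS \/ I = fullv;
  inner_linearl : forall (a : R) (x y z : lie_sort),
    inner (a *: x + y) z = a * inner x z + inner y z;
  inner_sym : forall x y : lie_sort, inner x y = inner y x;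
  inner_posdef : forall x : lie_sort, x != 0 -> 0 < inner x x;
  inner_invariant : forall x y z : lie_sort,
    inner (bracket x y) z = - inner y (bracket x z)
}.

(* The complexification V (x) C of a real vector space V: the pair (x, y)
   stands for x + i y. *)
Definition cplxification (R : realType) (V : vectType R) : Type := (V * V)%type.

Section Complexification.
Variables (R : realType) (V : vectType R).
Local Notation VC := (cplxification V).

HB.instance Definition _ := GRing.Zmodule.on VC.

Definition cplx_scale (c : R[i]) (u : VC) : VC :=
  (complex.Re c *: u.1 - complex.Im c *: u.2,
   complex.Re c *: u.2 + complex.Im c *: u.1).

Lemma cplx_scaleA a b (u : VC) :
  cplx_scale a (cplx_scale b u) = cplx_scale (a * b) u.
Proof.
case: a b u => [a a'] [b b'] [x y]; rewrite /cplx_scale /=.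
have acomm p q (z : V) : p *: (q *: z) = (p * q) *: z by rewrite scalerA.
congr pair; rewrite !(scalerBr, scalerDr, scalerBl, scalerDl) !acomm.
  by rewrite !opprD [X in _ + X = _]addrC addrACA.
by rewrite [X in _ + X = _]addrC addrACA.
Qed.

Lemma cplx_scale1 : left_id 1 cplx_scale.
Proof. by case=> x y; rewrite /cplx_scale /= !scale1r !scale0r subr0 addr0. Qed.

Lemma cplx_scaleDr : right_distributive cplx_scale +%R.
Proof.
move=> [a a'] [x y] [x' y']; rewrite /cplx_scale /=.
by congr pair => /=; rewrite !scalerDr ?opprD addrACA.
Qed.

Lemma cplx_scaleDl (u : VC) : {morph cplx_scale^~ u : a b / a + b}.
Proof.
move=> [a a'] [b b']; case: u => x y; rewrite /cplx_scale /=.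
by congr pair => /=; rewrite !scalerDl ?opprD addrACA.
Qed.

HB.instance Definition _ := GRing.Zmodule_isLmodule.Build R[i] VC
  cplx_scaleA cplx_scale1 cplx_scaleDr cplx_scaleDl.

Definition cplx_inj (x : V) : VC := (x, 0).

End Complexification.

Section LieAlgebra.
Variables (R : realType) (K : simpleCompactLie R).
Local Notation g := (cplxification K).

Definition cplx_bracket (u v : g) : g :=
  (bracket u.1 v.1 - bracket u.2 v.2, bracket u.1 v.2 + bracket u.2 v.1).

(* A finite dimensional complex representation of the complexification g. *)
Record lieRep := LieRep {
  rep_space : vectType R[i];
  rep_act :> {linear g -> 'End(rep_space)};
  rep_bracket : forall u v : g, rep_act (cplx_bracket u v) =
    (rep_act u \o rep_act v)%VF - (rep_act v \o rep_act u)%VF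
}.

Definition rep_dim (V : lieRep) : nat := \dim (fullv : {vspace rep_space V}).

Definition rep_irreducible (V : lieRep) : Prop :=
  (0 < rep_dim V)%N /\
  forall U : {vspace rep_space V},
    (forall u : g, (rep_act V u @: U <= U)%VS) -> U = 0%VS \/ U = fullv.

(* Lie algebras of maximal tori are the maximal abelian subalgebras. *)
Definition abelian_subspace (A : {vspace K}) : Prop :=
  forall x y : K, x \in A -> y \in A -> bracket x y = 0.

Definition max_torus (t : {vspace K}) : Prop :=
  abelian_subspace t /\
  forall A : {vspace K}, abelian_subspace A -> (t <= A)%VS -> A = t.

Section Torus.
Variable t : {vspace K}.

Definition tdual : vectType R := 'Hom(subvs_of t, R^o).

Definition inner_form (h x : subvs_of t) : R^o := inner (vsval h) (vsval x).

Fact inner_form_linear (h : subvs_of t) : linear (inner_form h).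
Proof.
move=> a x y; rewrite /inner_form inner_sym linearP inner_linearl.
by congr (_ + _); [congr (_ * _)|]; rewrite inner_sym.
Qed.
HB.instance Definition _ (h : subvs_of t) :=
  GRing.isLinear.Build R (subvs_of t) R^o *:%R (inner_form h)
    (inner_form_linear h).

Definition nu_fun (h : subvs_of t) : tdual := linfun (inner_form h).

Fact nu_fun_linear : linear nu_fun.
Proof.
move=> a x y; apply/lfunP => z.
by rewrite add_lfunE scale_lfunE !lfunE /= /inner_form linearP inner_linearl.
Qed.
HB.instance Definition _ :=
  GRing.isLinear.Build R (subvs_of t) tdual *:%R nu_fun nu_fun_linear.

Definition nu : 'Hom(subvs_of t, tdual) := linfun nu_fun.
Definition nu_inv (l : tdual) : subvs_of t := (nu^-1)%VF l.

Lemma nuE (h x : subvs_of t) : nu h x = inner (vsval h) (vsval x).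
Proof. by rewrite !lfunE. Qed.

Lemma nu_invK : cancel nu_inv nu.
Proof.
have inj : lker nu = 0%VS.
  apply/eqP; rewrite -subv0; apply/subvP => x; rewrite memv_ker memv0.
  move=> /eqP x0; apply/negPn/negP => nz.
  suff: 0 < inner (vsval x) (vsval x) by rewrite -nuE x0 zero_lfunE ltxx.
  by apply: inner_posdef; apply: contra nz => /eqP z; apply/eqP/val_inj.
have full : limg nu = fullv.
  apply/eqP; rewrite eqEdim subvf limg_dim_eq ?inj ?capv0 //.
  by rewrite !dimvf /dim /= muln1.
by move=> l; apply: limg_lfunVK; rewrite full memvf.
Qed.

Definition root_vector (a : tdual) (X : g) : Prop :=
  forall H : subvs_of t,
    cplx_bracket (cplx_inj (vsval H)) X = ('i * (a H)%:C) *: X.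

Definition roots : set tdual :=
  [set a | a != 0 /\ exists2 X : g, X != 0 & root_vector a X].

(* 2 nu^-1(a) / (a|a); it does not depend on the scaling of the form. *)
Definition coroot (a : tdual) : subvs_of t :=
  let h := nu_inv a in (2 / inner (vsval h) (vsval h)) *: h.

Definition reflection (a l : tdual) : tdual := l - l (coroot a) *: a.

Inductive weyl : (tdual -> tdual) -> Prop :=
| weyl_id : weyl id
| weyl_refl (a : tdual) (w : tdual -> tdual) :
    roots a -> weyl w -> weyl (reflection a \o w).

Definition nat_cone (S : seq tdual) : set tdual :=
  [set l | exists c : tdual -> nat, l = \sum_(s <- S) s *+ c s].

Definition simple_system (S : seq tdual) : Prop :=
  [/\ basis_of fullv S,
      forall s, s \in S -> roots s
    & forall a, roots a -> nat_cone S a \/ nat_cone S (- a)].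

Definition highest_root (S : seq tdual) (th : tdual) : Prop :=
  roots th /\ forall a, roots a -> nat_cone S (th - a).

(* Vectors v with H v = i b(H) v for all H in t; since both sides are linear in
   H it is enough to let H run over a basis of t (see [memv_weight_space]). *)
Definition weight_space (V : lieRep) (b : tdual) : {vspace rep_space V} :=
  (\bigcap_(j < \dim {: subvs_of t})
     lker (rep_act V (cplx_inj (vsval (vbasis {: subvs_of t})`_j))
           - ('i * (b (vbasis {: subvs_of t})`_j)%:C) *: \1)%VF)%VS.

Lemma memv_weight_space (V : lieRep) (b : tdual) (v : rep_space V) :
  v \in weight_space V b <->
  forall H : subvs_of t,
    rep_act V (cplx_inj (vsval H)) v = ('i * (b H)%:C) *: v.
Proof.
pose e := vbasis {: subvs_of t}.
have inD a (x y : subvs_of t) : cplx_inj (vsval (a *: x + y)) =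
    a%:C *: cplx_inj (vsval x) + cplx_inj (vsval y) :> g.
  by congr pair => /=; rewrite ?linearP ?scale0r ?scaler0 ?subr0 ?addr0.
pose good H := rep_act V (cplx_inj (vsval H)) v = ('i * (b H)%:C) *: v.
have goodP a x y : good x -> good y -> good (a *: x + y).
  rewrite /good inD linearP add_lfunE scale_lfunE => -> ->.
  rewrite linearP /= rmorphD rmorphM mulrDr scalerDl scalerA.
  by congr (_ *: _ + _); rewrite mulrCA.
have good0 : good 0.
  have z : cplx_inj (vsval (0 : subvs_of t)) = 0 :> g by rewrite /cplx_inj linear0.
  by rewrite /good z !linear0 zero_lfunE mulr0 scale0r.
rewrite /weight_space; split; last first.
  move=> h; rewrite memvE; apply/subv_bigcapP => j _; rewrite -memvE memv_ker.
  by rewrite add_lfunE opp_lfunE scale_lfunE id_lfunE h subrr.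
rewrite memvE => /subv_bigcapP h H.
have := memvf H => /coord_vbasis ->.
apply: (big_ind (fun H => good H)) => //.
  by move=> x y gx gy; rewrite -[x]scale1r; apply: goodP.
move=> j _; rewrite -[X in good X]addr0; apply: goodP => //.
have := h j isT; rewrite -memvE memv_ker.
by rewrite add_lfunE opp_lfunE scale_lfunE id_lfunE subr_eq0 => /eqP.
Qed.

End Torus.

(* A maximal torus, simple roots and the highest root, the inner product
   being normalized by (th^v | th^v) = 2. *)
Record rootSetting := RootSetting {
  torus : {vspace K};
  torusP : max_torus torus;
  simple_roots : seq (tdual torus);
  simple_rootsP : simple_system simple_roots;
  theta : tdual torus;
  thetaP : highest_root simple_roots theta;
  inner_normalized :
    inner (vsval (coroot theta)) (vsval (coroot theta)) = 2
}.

Section Weights.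
Variable D : rootSetting.
Local Notation dual := (tdual (torus D)).

Definition pos_roots : set dual :=
  [set a | roots a /\ nat_cone (simple_roots D) a].

Definition rho : dual := 2^-1 *: \sum_(a \in pos_roots) a.

Definition dual_coxeter : R := 1 + rho (coroot (theta D)).

Definition weight_lattice : set dual :=
  [set l | forall a, roots a -> l (coroot a) \is a Num.int].

Definition chamber : set dual :=
  [set l | forall a, a \in simple_roots D -> 0 <= l (coroot a)].

Definition dom_weights : set dual := weight_lattice `&` chamber.

Definition alcove (k : nat) : set dual :=
  [set l | chamber l /\ l (coroot (theta D)) <= k%:R + dual_coxeter].

Definition level_weights (k : nat) : set dual :=
  [set l | dom_weights l /\ l (coroot (theta D)) <= k%:R].

Definition irr_highest_weight (V : lieRep) (l : dual) : Prop :=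
  rep_irreducible V /\
  exists v : rep_space V,
    [/\ v != 0, v \in weight_space V l
      & forall (a : dual) (X : g),
          pos_roots a -> root_vector a X -> rep_act V X v = 0].

Definition is_irr_family (V : dual -> lieRep) : Prop :=
  forall l, dom_weights l -> irr_highest_weight (V l) l.

Section Characters.
Variable V : dual -> lieRep.

Definition weight_mult (l b : dual) : nat := \dim (weight_space (V l) b).

Definition expi (x : R) : R[i] := cos x +i* sin x.

Definition ch (l : dual) (x : subvs_of (torus D)) : R[i] :=
  \sum_(b \in weight_lattice) (weight_mult l b)%:R * expi (2 * pi * b x).

Definition minuscule (c : dual) : Prop :=
  dom_weights c /\
  [set b | weight_mult c b != 0%N] = [set b | exists2 w, weyl w & b = w c].

Definition p_kernel (c x y : dual) : R :=
  (weight_mult c (y - x))%:R / (rep_dim (V c))%:R.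

Section Level.
Variable k : nat.

Definition chi (l s : dual) : R[i] :=
  ch l (- nu_inv ((k%:R + dual_coxeter)^-1 *: (s + rho))).

Definition is_fusion (N : dual -> dual -> dual -> nat) : Prop :=
  forall l c s, level_weights k l -> level_weights k c -> level_weights k s ->
    chi l s * chi c s = \sum_(b \in level_weights k) (N l c b)%:R * chi b s.

Definition fusion_kernel (N : dual -> dual -> dual -> nat) (c l b : dual)
    : R[i] :=
  (N l c b)%:R * (chi b 0 / (chi l 0 * chi c 0)).

(* Functions on {x in P : x + rho in A_k} are represented by total functions
   whose values elsewhere are ignored: [patch (fun=> 0) A f] is f extended by 0 outside A. *)
Definition p_apply (c : dual) (f : dual -> R[i]) (x : dual) : R[i] :=
  \sum_(y \in weight_lattice)
     (p_kernel c x y)%:C * patch (fun=> 0) (level_weights k) f y.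

Definition laplacian (c : dual) (f : dual -> R[i]) (x : dual) : R[i] :=
  p_apply c f x - f x.

Definition dirichlet_domain : set dual :=
  [set x | weight_lattice x /\ alcove k (x + rho)].

Definition dirichlet_eigen (c : dual) (lam : R[i]) (f : dual -> R[i]) : Prop :=
  [/\ exists2 x, dirichlet_domain x & f x != 0,
      forall x, level_weights k x -> laplacian c f x + lam * f x = 0
    & forall x, dirichlet_domain x -> ~ level_weights k x -> f x = 0].

(* Eigenvalues of the matrix (p_c(x, y)) for x, y in P_+^k. *)
Definition restr_eigenvalue (c : dual) (mu : R[i]) : Prop :=
  exists2 f : dual -> R[i],
    exists2 x, level_weights k x & f x != 0
  & forall x, level_weights k x ->
      \sum_(y \in level_weights k) (p_kernel c x y)%:C * f y = mu * f x.

Definition restr_spectral_radius (c : dual) (r : R[i]) : Prop :=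
  (exists2 mu, restr_eigenvalue c mu & `|mu| = r) /\
  forall mu, restr_eigenvalue c mu -> `|mu| <= r.

(* On R[i], 0 < z means that z is real and positive. *)
Definition perron_frobenius (c : dual) (f : dual -> R[i]) : Prop :=
  exists lam : R[i],
    [/\ dirichlet_eigen c lam f,
        forall x, level_weights k x -> 0 < f x
      & restr_spectral_radius c (1 - lam)].

Definition eigenfun (s : dual) : dual -> R[i] :=
  patch (fun=> 0) (level_weights k) (fun b => chi b s).

End Level.
End Characters.
End Weights.
End LieAlgebra.

(* Main.v *)
(* By Freudenthal's formula, that is, by the trace of the Casimir operator on weight
   spaces, the product j of ch_l with the Weyl denominator satisfies
   (x|x) j(x) = |l + rho|^2 j(x).  Being antisymmetric and supported below l + rho, it is
   the alternating sum over the orbit of l + rho (Weyl's character formula).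
   The weights of a minuscule gamma pair with coroots to -1, 0 or 1, so adding one to
   l + rho does not leave the alcove: ch_gamma ch_l is the sum of K_gamma^(b - l) ch_b,
   and the terms with b + rho on a wall vanish at the points defining chi.  Hence
   chi_gamma chi_l = sum K_gamma^(b - l) chi_b, which says that f_sigma is an
   eigenfunction; since the chi_b are linearly independent, it also identifies the
   fusion coefficients with multiplicities.  Finally chi_b(0) is a product of quotients
   of positive sines, and a positive eigenfunction has the largest eigenvalue. *)

Require Import Defs.
From HB Require Import structures.
From mathcomp Require Import all_boot all_order all_algebra.
From mathcomp Require Import complex.
From mathcomp Require Import all_classical all_reals all_analysis.
From mathcomp Require Import zify ring lra.

Set Implicit Arguments.
Unset Strict Implicit.
Unset Printing Implicit Defensive.

Import Order.TTheory GRing.Theory Num.Theory.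
Local Open Scope classical_set_scope.
Local Open Scope ring_scope.
Local Open Scope complex_scope.

(** * Root systems and the Weyl denominator *)

(** The combinatorics is done for an abstract root system and multiplicity functions subject to
    [irr_mult]; the Lie algebra comes back only to supply both. Multiplying the coefficients of a
    formal character by (x|x) is a Laplacian, of which the Weyl denominator is an eigenvector with
    eigenvalue (rho|rho); the sum over positive roots in Freudenthal's formula is then exactly the
    cross term of the Leibniz rule. The torus acts diagonalizably on g by compactness, through a
    Hermitian form; on a module V this has to be derived, from the spanning of V by lowering
    operators applied to the highest weight vector. For the independence of the chi_b, sigma + rho
    is replaced by an arbitrary weight: the alternating sum obtained is antisymmetric under the
    affine Weyl group of level k + h^vee, so its vanishing at the points of P_+^k + rho spreads to
    all of P, where independence of group characters applies. That distinct points of the alcove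
    stay distinct rests on one fact: a coroot lattice vector on which every root is at most 1 is
    zero. *)

Record rootBase (R : realType) (E : vectType R) := RootBase {
  ip : E -> E -> R;
  ip_linearl : forall (a : R) (x y z : E), ip (a *: x + y) z = a * ip x z + ip y z;
  ipC : forall x y : E, ip x y = ip y x;
  ip_gt0 : forall x : E, x != 0 -> 0 < ip x x;
  Phi : seq E;
  Phi_uniq : uniq Phi;
  Phi_neq0 : 0 \notin Phi;
  Phi_int : forall a b : E, a \in Phi -> b \in Phi ->
    2 * ip b a / ip a a \is a Num.int;
  Phi_refl : forall a b : E, a \in Phi -> b \in Phi ->
    b - (2 * ip b a / ip a a) *: a \in Phi;
  Phi_red : forall a : E, a \in Phi -> a *+ 2 \notin Phi;
  base : seq E;
  base_basis : basis_of fullv base;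
  base_Phi : forall a : E, a \in base -> a \in Phi;
  base_sign : forall a : E, a \in Phi ->
    (exists c : E -> nat, a = \sum_(s <- base) s *+ c s) \/
    (exists c : E -> nat, - a = \sum_(s <- base) s *+ c s)
}.

Section RootBaseTheory.
Variables (R : realType) (E : vectType R) (B : rootBase E).

Local Notation "''[' x , y ]" := (ip B x y).
Local Notation Phi := (Phi B).
Local Notation base := (base B).

Lemma ipDl x y z : '[x + y, z] = '[x, z] + '[y, z].
Proof. by rewrite -[x in LHS]scale1r ip_linearl mul1r. Qed.

Lemma ip0l z : '[0, z] = 0.
Proof. by apply: (addIr '[0, z]); rewrite -ipDl !add0r. Qed.

Lemma ipZl c x z : '[c *: x, z] = c * '[x, z].
Proof. by rewrite -[_ *: _]addr0 ip_linearl ip0l addr0. Qed.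

Lemma ipNl x z : '[- x, z] = - '[x, z].
Proof. by rewrite -scaleN1r ipZl mulN1r. Qed.

Lemma ipBl x y z : '[x - y, z] = '[x, z] - '[y, z].
Proof. by rewrite ipDl ipNl. Qed.

Lemma ip_suml (I : Type) (r : seq I) (P : pred I) (F : I -> E) z :
  '[\sum_(i <- r | P i) F i, z] = \sum_(i <- r | P i) '[F i, z].
Proof. by apply: (big_morph (fun x => '[x, z])) => [x y|]; rewrite ?ipDl ?ip0l. Qed.

Lemma ipDr x y z : '[z, x + y] = '[z, x] + '[z, y].
Proof. by rewrite !(ipC _ z) ipDl. Qed.

Lemma ip0r z : '[z, 0] = 0. Proof. by rewrite ipC ip0l. Qed.

Lemma ipZr c x z : '[z, c *: x] = c * '[z, x].
Proof. by rewrite !(ipC _ z) ipZl. Qed.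

Lemma ipNr x z : '[z, - x] = - '[z, x].
Proof. by rewrite !(ipC _ z) ipNl. Qed.

Lemma ipBr x y z : '[z, x - y] = '[z, x] - '[z, y].
Proof. by rewrite !(ipC _ z) ipBl. Qed.

Lemma ip_sumr (I : Type) (r : seq I) (P : pred I) (F : I -> E) z :
  '[z, \sum_(i <- r | P i) F i] = \sum_(i <- r | P i) '[z, F i].
Proof. by rewrite ipC ip_suml; apply: eq_bigr => i _; rewrite ipC. Qed.

Definition ipE := (ipDl, ipDr, ipNl, ipNr, ipZl, ipZr, ip0l, ip0r).

Lemma ip_ge0 x : 0 <= '[x, x].
Proof. by have [->|/(ip_gt0 B)/ltW//] := eqVneq x 0; rewrite ip0l. Qed.

Lemma ip_le0_eq0 x : '[x, x] <= 0 -> x = 0.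
Proof.
by move=> h; apply/eqP/negPn/negP => /(ip_gt0 B); rewrite ltNge h.
Qed.

Lemma ip_eq_inj x y : (forall z, '[x, z] = '[y, z]) -> x = y.
Proof.
move=> h; apply/eqP; rewrite -subr_eq0; apply/eqP/ip_le0_eq0.
by rewrite ipBl h subrr.
Qed.

Lemma root_neq0 a : a \in Phi -> a != 0.
Proof. by apply: contraTneq => ->; apply: Phi_neq0. Qed.

Lemma root_ip_gt0 a : a \in Phi -> 0 < '[a, a].
Proof. by move/root_neq0; apply: ip_gt0. Qed.

(* [pairing x a] is the value of the weight x on the coroot of a. *)
Definition pairing (x a : E) : R := 2 * '[x, a] / '[a, a].

Definition srefl (a x : E) : E := x - pairing x a *: a.

Lemma sreflE a x : srefl a x = x - pairing x a *: a. Proof. by []. Qed.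

Lemma pairingDl x y a : pairing (x + y) a = pairing x a + pairing y a.
Proof. by rewrite /pairing ipDl mulrDr mulrDl. Qed.

Lemma pairingZl c x a : pairing (c *: x) a = c * pairing x a.
Proof. by rewrite /pairing ipZl; ring. Qed.

Lemma pairingNl x a : pairing (- x) a = - pairing x a.
Proof. by rewrite -scaleN1r pairingZl mulN1r. Qed.

Lemma pairingBl x y a : pairing (x - y) a = pairing x a - pairing y a.
Proof. by rewrite pairingDl pairingNl. Qed.

Lemma pairing0l a : pairing 0 a = 0.
Proof. by rewrite -(scale0r a) pairingZl mul0r. Qed.

Lemma pairing_suml (I : Type) (r : seq I) (F : I -> E) a :
  pairing (\sum_(i <- r) F i) a = \sum_(i <- r) pairing (F i) a.
Proof.
by apply: (big_morph (pairing^~ a)) => [x y|]; rewrite ?pairingDl ?pairing0l.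
Qed.

Lemma pairingNr x a : pairing x (- a) = - pairing x a.
Proof. by rewrite /pairing !ipE opprK mulrN mulNr. Qed.

Lemma pairing_id a : a != 0 -> pairing a a = 2.
Proof. by move=> a0; rewrite /pairing mulfK // gt_eqF // ip_gt0. Qed.

Lemma pairing_half a x : a != 0 -> '[x, a] = pairing x a * '[a, a] / 2.
Proof. by move=> a0; rewrite /pairing; field; rewrite gt_eqF // ip_gt0. Qed.

Lemma pairing_gt0 x a : a != 0 -> (0 < pairing x a) = (0 < '[x, a]).
Proof.
by move=> a0; rewrite /pairing pmulr_lgt0 ?invr_gt0 ?ip_gt0 // pmulr_rgt0.
Qed.

Lemma pairing_ge0 x a : a != 0 -> (0 <= pairing x a) = (0 <= '[x, a]).
Proof.
by move=> a0; rewrite /pairing pmulr_lge0 ?invr_gt0 ?ip_gt0 // pmulr_rge0.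
Qed.

Lemma pairing_lt0 x a : a != 0 -> (pairing x a < 0) = ('[x, a] < 0).
Proof. by move=> a0; rewrite !ltNge pairing_ge0. Qed.

Lemma sreflZ a c x : srefl a (c *: x) = c *: srefl a x.
Proof. by rewrite /srefl pairingZl scalerBr scalerA. Qed.

Lemma sreflD a x y : srefl a (x + y) = srefl a x + srefl a y.
Proof. by rewrite /srefl pairingDl scalerDl opprD addrACA. Qed.

Lemma sreflN a x : srefl a (- x) = - srefl a x.
Proof. by rewrite -scaleN1r sreflZ scaleN1r. Qed.

Lemma sreflB a x y : srefl a (x - y) = srefl a x - srefl a y.
Proof. by rewrite sreflD sreflN. Qed.

Lemma srefl0 a : srefl a 0 = 0.
Proof. by rewrite -(scale0r a) sreflZ !scale0r. Qed.

Lemma srefl_sum a (I : Type) (r : seq I) (F : I -> E) :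
  srefl a (\sum_(i <- r) F i) = \sum_(i <- r) srefl a (F i).
Proof.
by apply: (big_morph (srefl a)) => [x y|]; rewrite ?sreflD ?srefl0.
Qed.

Lemma srefl_id a : a != 0 -> srefl a a = - a.
Proof.
by move=> a0; rewrite /srefl pairing_id // scaler_nat mulr2n opprD addrA subrr add0r.
Qed.

Lemma sreflK a : a != 0 -> involutive (srefl a).
Proof.
move=> a0 x; rewrite {1}/srefl /srefl pairingBl pairingZl pairing_id //.
by rewrite mulr_natr mulr2n opprD addrA subrr sub0r scaleNr opprK subrK.
Qed.

Lemma srefl_ip a x y : a != 0 -> '[srefl a x, srefl a y] = '[x, y].
Proof.
move=> a0; rewrite /srefl /pairing !ipE (ipC B a y).
by field; rewrite gt_eqF // ip_gt0.
Qed.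

Lemma srefl_pairing a x b : a != 0 -> pairing (srefl a x) (srefl a b) = pairing x b.
Proof. by move=> a0; rewrite /pairing !srefl_ip. Qed.

Lemma sreflNr a x : srefl (- a) x = srefl a x.
Proof. by rewrite /srefl pairingNr scaleNr scalerN opprK. Qed.

Lemma srefl_conj a b x : b != 0 ->
  srefl (srefl b a) x = srefl b (srefl a (srefl b x)).
Proof.
move=> b0; rewrite [srefl a _]/srefl sreflB sreflZ sreflK //.
by rewrite {1}/srefl -[in LHS](sreflK b0 x) srefl_pairing // sreflK.
Qed.

Lemma srefl_root a b : a \in Phi -> b \in Phi -> srefl a b \in Phi.
Proof. exact: Phi_refl. Qed.

Lemma root_opp a : a \in Phi -> - a \in Phi.
Proof. by move=> ra; rewrite -srefl_id ?root_neq0 // srefl_root. Qed.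

Lemma pairing_root_int a b : a \in Phi -> b \in Phi -> pairing b a \is a Num.int.
Proof. exact: Phi_int. Qed.

Lemma base_neq0 a : a \in base -> a != 0.
Proof. by move/base_Phi/root_neq0. Qed.

(** * Coordinates on the base, positive roots, integral and dominant weights *)

Definition lincomb (c : E -> R) : E := \sum_(s <- base) c s *: s.

Lemma lincomb_surj x : {c : E -> R | x = lincomb c}.
Proof.
apply: cid; have bB := base_basis B.
exists (fun s => if insub (index s base) is Some i
  then coord (in_tuple base) i x else 0).
rewrite {1}[x](coord_basis (X := in_tuple base) bB (memvf x)) /lincomb.
rewrite [RHS](big_nth 0) big_mkord; apply: eq_bigr => i _ /=.
by rewrite index_uniq ?(basis_free bB) ?free_uniq ?(basis_free bB) // valK.
Qed.

Definition scoef (x : E) : E -> R := sval (lincomb_surj x).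

Lemma scoefE x : x = lincomb (scoef x).
Proof. exact: (svalP (lincomb_surj x)). Qed.

Lemma base_uniq : uniq base.
Proof. exact: free_uniq (basis_free (base_basis B)). Qed.

Lemma lincombB c d : lincomb (fun s => c s - d s) = lincomb c - lincomb d.
Proof.
by rewrite /lincomb -sumrB; apply: eq_bigr => i _; rewrite scalerBl.
Qed.

Lemma lincomb_inj c d : lincomb c = lincomb d -> {in base, c =1 d}.
Proof.
move=> /eqP; rewrite -subr_eq0 -lincombB /lincomb (big_nth 0) big_mkord.
move=> /eqP h s sB; apply/eqP; rewrite -subr_eq0; apply/eqP.
have /freeP := basis_free (base_basis B : basis_of fullv (in_tuple base)).
move=> /(_ (fun i => c base`_i - d base`_i) h).
have si : (index s base < size base)%N by rewrite index_mem.
by move=> /(_ (Ordinal si)) /=; rewrite nth_index.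
Qed.

Lemma scoef_lincomb c : {in base, scoef (lincomb c) =1 c}.
Proof. by apply: lincomb_inj; rewrite -scoefE. Qed.

Lemma scoefD x y s : s \in base -> scoef (x + y) s = scoef x s + scoef y s.
Proof.
move: s; apply: lincomb_inj; rewrite -scoefE [in LHS](scoefE x) [in LHS](scoefE y).
by rewrite /lincomb -big_split; apply: eq_bigr => i _; rewrite scalerDl.
Qed.

Lemma scoefZ k x s : s \in base -> scoef (k *: x) s = k * scoef x s.
Proof.
move: s; apply: lincomb_inj; rewrite -scoefE [in LHS](scoefE x).
by rewrite /lincomb scaler_sumr; apply: eq_bigr => i _; rewrite scalerA.
Qed.

Lemma scoefN x s : s \in base -> scoef (- x) s = - scoef x s.
Proof. by move=> sB; rewrite -scaleN1r scoefZ // mulN1r. Qed.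

Lemma scoefB x y s : s \in base -> scoef (x - y) s = scoef x s - scoef y s.
Proof. by move=> sB; rewrite scoefD // scoefN. Qed.

Lemma scoef_base a s : a \in base -> s \in base -> scoef a s = (s == a)%:R.
Proof.
move=> aB; have -> : scoef a = scoef (lincomb (fun s => (s == a)%:R)).
  congr scoef; rewrite /lincomb (bigD1_seq a) ?base_uniq //= eqxx scale1r.
  by rewrite big1 ?addr0 // => i /negPf->; rewrite scale0r.
exact: scoef_lincomb.
Qed.

Definition height (x : E) : R := \sum_(s <- base) scoef x s.

Lemma heightD x y : height (x + y) = height x + height y.
Proof.
by rewrite -big_split; apply: eq_big_seq => s sB; rewrite scoefD.
Qed.

Lemma heightZ k x : height (k *: x) = k * height x.
Proof.
by rewrite /height mulr_sumr; apply: eq_big_seq => s sB; rewrite scoefZ.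
Qed.

Lemma heightB x y : height (x - y) = height x - height y.
Proof. by rewrite heightD -scaleN1r heightZ mulN1r. Qed.

Lemma height_base a : a \in base -> height a = 1.
Proof.
move=> aB; rewrite /height (bigD1_seq a) ?base_uniq //= scoef_base // eqxx.
by rewrite big1_seq ?addr0 // => s /andP[/negPf sa sB]; rewrite scoef_base // sa.
Qed.

Definition cone (x : E) : Prop :=
  exists c : E -> nat, x = \sum_(s <- base) s *+ c s.

Lemma coneP x : cone x <-> forall s, s \in base -> scoef x s \is a Num.nat.
Proof.
split=> [[c xE] s sB|h].
  have -> : x = lincomb (fun s => (c s)%:R).
    by rewrite xE; apply: eq_bigr => i _; rewrite scaler_nat.
  by rewrite scoef_lincomb // natr_nat.
exists (fun s => Num.truncn (scoef x s)); rewrite [LHS]scoefE.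
by apply: eq_big_seq => s sB; rewrite -scaler_nat truncnK ?h.
Qed.

Lemma cone0 : cone 0.
Proof. by exists (fun=> 0%N); rewrite big1. Qed.

Lemma coneD x y : cone x -> cone y -> cone (x + y).
Proof.
move=> /coneP hx /coneP hy; apply/coneP => s sB.
by rewrite scoefD // rpredD ?hx ?hy.
Qed.

Lemma cone_scoef_ge0 x s : cone x -> s \in base -> 0 <= scoef x s.
Proof. by move=> /coneP h sB; apply/natr_ge0/h. Qed.

Lemma cone_height_nat x : cone x -> height x \is a Num.nat.
Proof.
by move=> /coneP h; rewrite /height big_seq; apply: rpred_sum => s /h.
Qed.

Lemma cone_base a : a \in base -> cone a.
Proof. by move=> aB; apply/coneP => s sB; rewrite scoef_base // natr_nat. Qed.

Lemma cone_opp x : cone x -> cone (- x) -> x = 0.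
Proof.
move=> hx hNx; rewrite [x]scoefE /lincomb big_seq big1 // => s sB.
suff -> : scoef x s = 0 by rewrite scale0r.
apply/eqP; rewrite eq_le cone_scoef_ge0 // andbT.
by rewrite -oppr_ge0 -scoefN // cone_scoef_ge0.
Qed.

Lemma cone_ip_ge0 y x : cone x -> (forall a, a \in base -> 0 <= '[y, a]) -> 0 <= '[y, x].
Proof.
move=> hx hy; rewrite [x]scoefE ip_sumr big_seq; apply: sumr_ge0 => s sB.
by rewrite ipZr mulr_ge0 ?hy // cone_scoef_ge0.
Qed.

Lemma cone_ip_gt0 y x : cone x -> x != 0 ->
  (forall a, a \in base -> 0 < '[y, a]) -> 0 < '[y, x].
Proof.
move=> hx x0 hy; rewrite lt_neqAle cone_ip_ge0 // ?andbT; last first.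
  by move=> a /hy/ltW.
apply: contraNneq x0; rewrite [x in '[y, x]]scoefE ip_sumr big_seq => /esym/eqP.
rewrite psumr_eq0 => [/allP h|s sB]; last first.
  by rewrite ipZr mulr_ge0 ?(ltW (hy _ sB)) // cone_scoef_ge0.
apply/eqP; rewrite [x]scoefE /lincomb big_seq big1 // => s sB.
have := h s sB; rewrite sB ipZr mulf_eq0 (gt_eqF (hy _ sB)) orbF.
by move=> /eqP->; rewrite scale0r.
Qed.

Definition posroots : seq E := [seq a <- Phi | `[< cone a >]].

Lemma posrootsP a : reflect (a \in Phi /\ cone a) (a \in posroots).
Proof.
rewrite mem_filter; apply: (iffP andP) => [[/asboolP ? ?]|[? ?]] //.
by split=> //; apply/asboolP.
Qed.

Lemma posroots_uniq : uniq posroots.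
Proof. by rewrite filter_uniq // Phi_uniq. Qed.

Lemma base_posroots a : a \in base -> a \in posroots.
Proof. by move=> aB; apply/posrootsP; split; [apply: base_Phi|apply: cone_base]. Qed.

Lemma posroots_neq0 a : a \in posroots -> a != 0.
Proof. by case/posrootsP => /root_neq0. Qed.

Lemma root_sign a : a \in Phi -> a \in posroots \/ - a \in posroots.
Proof.
move=> ra; have [h|h] := base_sign ra; [left|right]; apply/posrootsP => //.
by split=> //; apply: root_opp.
Qed.

Lemma posroots_opp a : a \in posroots -> - a \notin posroots.
Proof.
move=> ha; apply/negP => /posrootsP[_ h]; case/posrootsP: (ha) => _ h'.
by have := posroots_neq0 ha; rewrite (cone_opp h' h) eqxx.
Qed.

(** The two pairings 2c and 2/c are positive integers with product 4. Reducedness at [a] excludes c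
    = 2, and at [c *: a] it excludes c = 1/2, so both are 2. *)
Lemma root_multiple a c : a \in Phi -> c *: a \in Phi -> 0 < c -> c = 1.
Proof.
move=> ra rca c0; have a0 := root_neq0 ra; have aa := root_ip_gt0 ra.
have c'0 : c != 0 by rewrite gt_eqF.
have : pairing a (c *: a) \is a Num.int by apply: pairing_root_int.
have -> : pairing a (c *: a) = 2 / c.
  by rewrite /pairing !ipE; field; rewrite c'0 (gt_eqF aa).
have : pairing (c *: a) a \is a Num.int by apply: pairing_root_int.
rewrite pairingZl pairing_id // => /intrP[m mE] /intrP[n nE].
have m0 : (0 < m)%R by rewrite -(ltr0z R) -mE mulr_gt0.
have n0 : (0 < n)%R by rewrite -(ltr0z R) -nE divr_gt0.
have mn : (m * n = 4)%R.
  by apply: (@intr_inj R); rewrite intrM -mE -nE; field.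
have not2 : c != 2.
  apply: contraTneq rca => ->.
  by rewrite scaler_nat; apply: Phi_red.
have : m != 4.
  by apply: contra_neq not2 => mE4; move: mE; rewrite mE4 => ?; lra.
have : n != 4.
  apply/eqP => nE4; have := Phi_red rca; rewrite -scaler_nat scalerA.
  have -> : 2 * c = 1 :> R by rewrite mulrC mE; have -> : m = 1 by rewrite nE4 in mn; lia.
  by rewrite scale1r ra.
have [m1 m4] : (1 <= m)%R /\ (m <= 4)%R by split; nia.
move=> n4 m4'.
have m2 : m = 2.
  have : [|| m == 1, m == 2, m == 3 | m == 4] by lia.
  by case/or4P => /eqP mE'; rewrite mE' in mn m4' *; lia.
by move: mE; rewrite m2 => ?; lra.
Qed.

Lemma seq_argmax (T : eqType) (f : T -> R) (s : seq T) x0 : x0 \in s ->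
  exists2 x, x \in s & forall y, y \in s -> f y <= f x.
Proof.
elim: s x0 => // z s IH x0 _; case: s IH => [_|z' s /(_ z' (mem_head _ _))[x xs xm]].
  by exists z; rewrite ?mem_head // => y; rewrite inE => /eqP->.
have [zx|xz] := lerP (f z) (f x).
  exists x; first by rewrite in_cons xs orbT.
  by move=> y; rewrite in_cons => /predU1P[->|/xm].
exists z; first exact: mem_head.
move=> y; rewrite in_cons => /predU1P[->//|/xm yx].
exact: le_trans yx (ltW xz).
Qed.

(** By [root_multiple], [b] has a positive coefficient on some simple root other than [a]. The
    reflection leaves that coefficient unchanged, so the image cannot be a negative root. *)
Lemma srefl_posroots a b : a \in base -> b \in posroots -> b != a ->
  srefl a b \in posroots.
Proof.
move=> aB bP ba; case/posrootsP: (bP) => rb cb.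
have [s [sB sa bs]] : exists s, [/\ s \in base, s != a & scoef b s != 0].
  apply: contrapT => h.
  have bE : b = scoef b a *: a.
    rewrite [LHS]scoefE /lincomb (bigD1_seq a) ?base_uniq //= big1_seq ?addr0 //.
    move=> s /andP[sa sB]; apply/eqP; rewrite scaler_eq0; apply/orP; left.
    by apply/negPn/negP => bs; apply: h; exists s.
  have b0 : scoef b a != 0.
    by apply: contraNneq (posroots_neq0 bP) => b0; rewrite bE b0 scale0r.
  have := @root_multiple a (scoef b a) (base_Phi aB).
  rewrite -bE rb lt_def b0 cone_scoef_ge0 // => /(_ isT isT) b1.
  by move: ba; rewrite bE b1 scale1r eqxx.
have [//|/posrootsP[_ cN]] := root_sign (srefl_root (base_Phi aB) rb).
have := cone_scoef_ge0 cN sB.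
rewrite /srefl scoefN // scoefB // scoefZ // (scoef_base aB) // (negPf sa) mulr0 subr0 oppr_ge0.
by rewrite leNgt lt_def bs cone_scoef_ge0.
Qed.

Lemma perm_srefl_posroots a : a \in base ->
  perm_eq [seq srefl a b | b <- rem a posroots] (rem a posroots).
Proof.
move=> aB; have a0 := base_neq0 aB; have aP := base_posroots aB.
have uP := rem_uniq a posroots_uniq.
apply: uniq_perm => // [|b].
  by rewrite map_inj_uniq //; apply: can_inj (sreflK a0).
have mem b' : b' \in rem a posroots -> srefl a b' \in rem a posroots.
  rewrite !mem_rem_uniq ?posroots_uniq // !inE => /andP[ba bP].
  rewrite srefl_posroots // andbT; apply: contraNneq (posroots_opp bP) => h.
  by rewrite -[b'](sreflK a0) h srefl_id // opprK.
apply/mapP/idP => [[b' b'P ->]|bP]; first exact: mem.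
by exists (srefl a b); [apply: mem|rewrite sreflK].
Qed.

Definition weyl_vector : E := 2^-1 *: \sum_(a <- posroots) a.
Local Notation rho := weyl_vector.

Lemma srefl_rho a : a \in base -> srefl a rho = rho - a.
Proof.
move=> aB; have a0 := base_neq0 aB.
have pE := perm_to_rem (base_posroots aB).
rewrite /rho sreflZ srefl_sum !(perm_big _ pE) /= !big_cons srefl_id //.
rewrite -(big_map (srefl a) predT id) (perm_big _ (perm_srefl_posroots aB)) /=.
rewrite !scalerDr scalerN addrAC; congr (_ + _).
by rewrite -[X in _ - X]scale1r -scalerBl -scaleNr; congr (_ *: _); field.
Qed.

Lemma pairing_rho a : a \in base -> pairing rho a = 1.
Proof.
move=> aB; have := srefl_rho aB; rewrite /srefl => /addrI/oppr_inj/eqP.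
rewrite -subr_eq0 -[X in _ - X]scale1r -scalerBl scaler_eq0.
by rewrite (negPf (base_neq0 aB)) orbF subr_eq0 => /eqP.
Qed.

(** Induction on the height: since (b|b) > 0, some simple root [a] has (b|a) > 0, and reflecting in
    it lowers the height of [b], which stays positive unless b = a. *)
Lemma posroots_ind (Q : E -> Prop) :
  (forall a, a \in base -> Q a) ->
  (forall a b, a \in base -> b \in posroots -> Q b -> Q (srefl a b)) ->
  forall b, b \in posroots -> Q b.
Proof.
move=> Qb Qs b bP; have /natrP[n nE] : height b \is a Num.nat.
  by case/posrootsP: bP => _ /cone_height_nat.
elim/ltn_ind: n b bP nE => n IH b bP nE.
have [bB|bB] := boolP (b \in base); first exact: Qb.
have b0 := posroots_neq0 bP; case/posrootsP: (bP) => rb cb.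
have [a [aB ba]] : exists a, a \in base /\ 0 < '[b, a].
  apply: contrapT => h; suff : 0 <= '[- b, b].
    by rewrite ipNl oppr_ge0 leNgt ip_gt0.
  apply: cone_ip_ge0 => // a aB; rewrite ipNl oppr_ge0 leNgt.
  by apply/negP => ba; apply: h; exists a.
have a0 := base_neq0 aB.
have sP : srefl a b \in posroots.
  by apply: srefl_posroots => //; apply: contraNneq bB => ->.
have /natrP[m mE] : height (srefl a b) \is a Num.nat.
  by case/posrootsP: sP => _ /cone_height_nat.
rewrite -[b](sreflK a0); apply: Qs => //; apply: (IH m) => //.
rewrite -(ltr_nat R) -mE -nE /srefl heightB heightZ (height_base aB) mulr1.
by rewrite ltrBlDr ltrDl pairing_gt0.
Qed.

Definition intweight (x : E) : Prop := forall a, a \in Phi -> pairing x a \is a Num.int.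

Lemma intweightD x y : intweight x -> intweight y -> intweight (x + y).
Proof. by move=> hx hy a ra; rewrite pairingDl rpredD ?hx ?hy. Qed.

Lemma intweightN x : intweight x -> intweight (- x).
Proof. by move=> hx a ra; rewrite pairingNl rpredN hx. Qed.

Lemma intweightB x y : intweight x -> intweight y -> intweight (x - y).
Proof. by move=> hx /intweightN; apply: intweightD. Qed.

Lemma intweight_root a : a \in Phi -> intweight a.
Proof. by move=> ra b rb; apply: pairing_root_int. Qed.

Lemma intweight0 : intweight 0.
Proof. by move=> a ra; rewrite pairing0l. Qed.

Lemma intweight_cone x : cone x -> intweight x.
Proof.
move=> [c ->] a ra; rewrite pairing_suml big_seq.
apply: rpred_sum => s sB; rewrite -scaler_nat pairingZl rpredM ?rpred_nat //.
exact: pairing_root_int (base_Phi sB).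
Qed.

Lemma intweightZ x (n : R) : n \is a Num.int -> intweight x -> intweight (n *: x).
Proof. by move=> hn hx a ra; rewrite pairingZl rpredM ?hx. Qed.

Lemma intweight_srefl a x : a \in Phi -> intweight x -> intweight (srefl a x).
Proof.
move=> ra hx; apply: intweightB => //; apply: intweightZ; first exact: hx.
exact: intweight_root.
Qed.

(** Pairing with a reflected root is pairing the reflected weight with the root, so the induction on
    positive roots has to quantify over the weight. *)
Lemma intweight_base x : (forall a, a \in base -> pairing x a \is a Num.int) ->
  intweight x.
Proof.
move=> hx a ra; wlog : a ra / a \in posroots.
  move=> h; have [/h->//|/h] := root_sign ra.
  by rewrite pairingNr rpredN; apply; apply: root_opp.
move=> aP; move: x hx; apply: (posroots_ind (Q := fun b =>
  forall x, (forall a, a \in base -> pairing x a \is a Num.int) ->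
  pairing x b \is a Num.int)) aP => [b bB x|b c bB cP IH x hx]; first exact.
have b0 := base_neq0 bB; rewrite -[x](sreflK b0) srefl_pairing //.
apply: IH => d dB; rewrite pairingBl pairingZl; apply: rpredB; first exact: hx.
by apply: rpredM; [apply: hx|apply: pairing_root_int; apply: base_Phi].
Qed.

Lemma intweight_rho : intweight rho.
Proof. by apply: intweight_base => a aB; rewrite pairing_rho // rpred1. Qed.

Definition dominant (x : E) : Prop := forall a, a \in base -> 0 <= pairing x a.
Definition sdominant (x : E) : Prop := forall a, a \in base -> 0 < pairing x a.

Lemma sdominant_dominant x : sdominant x -> dominant x.
Proof. by move=> h a /h/ltW. Qed.

Lemma dominant_cone x y : dominant x -> cone y -> 0 <= '[x, y].
Proof.
by move=> dx cy; apply: cone_ip_ge0 => // a aB; rewrite -pairing_ge0 ?base_neq0 ?dx.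
Qed.

Lemma sdominant_cone x y : sdominant x -> cone y -> y != 0 -> 0 < '[x, y].
Proof.
move=> dx cy y0; apply: cone_ip_gt0 => // a aB.
by rewrite -pairing_gt0 ?base_neq0 ?dx.
Qed.

Lemma sdominant_rho : sdominant rho.
Proof. by move=> a aB; rewrite pairing_rho. Qed.

Lemma sdominantD_rho x : dominant x -> sdominant (x + rho).
Proof. by move=> dx a aB; rewrite pairingDl pairing_rho // ltr_wpDl ?dx. Qed.

Lemma sdominantB_rho x : intweight x -> sdominant x -> dominant (x - rho).
Proof.
move=> ix sx a aB; rewrite pairingBl pairing_rho // subr_ge0.
have /intrP[n nE] := ix a (base_Phi aB); have := sx a aB.
by rewrite nE ltr0z ler1z.
Qed.

(** * Antisymmetric functions, formal characters and the Weyl denominator *)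

Definition antisymmetric_fun (phi : E -> R) : Prop :=
  forall a x, a \in base -> phi (srefl a x) = - phi x.

Definition fin_supp (phi : E -> R) : Prop :=
  exists s : seq E, forall x, phi x != 0 -> x \in s.

(* In the support of an antisymmetric function the point maximizing (x|rho) is
   strictly dominant. *)
Lemma antisymmetric_eq0 (phi : E -> R) : antisymmetric_fun phi -> fin_supp phi ->
  (forall x, sdominant x -> phi x = 0) -> forall x, phi x = 0.
Proof.
move=> anti [s sP] h x; apply/eqP/negPn/negP => x0.
have xs : x \in [seq y <- s | phi y != 0] by rewrite mem_filter x0 sP.
have [y] := seq_argmax (fun y => '[y, rho]) xs.
rewrite mem_filter => /andP[y0 ys] ym; move: (y0); rewrite h ?eqxx // => a aB.
have a0 := base_neq0 aB; rewrite ltNge; apply/negP; rewrite le_eqVlt.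
move=> /predU1P[ya|ya].
  move: y0; have := anti a y aB; rewrite /srefl ya scale0r subr0 => h'.
  by rewrite (_ : phi y = 0) ?eqxx //; lra.
have y'0 : phi (srefl a y) != 0 by rewrite anti // oppr_eq0.
have := ym (srefl a y); rewrite mem_filter y'0 sP // => /(_ isT).
rewrite ipBl ipZl gerBl leNgt nmulr_rlt0 // ipC -pairing_gt0 //.
by rewrite pairing_rho ?ltr01.
Qed.

(* Formal characters are functions phi : E -> R with finite support, the
   coefficient of e^x being phi x; [dlt a] is the multiplication by
   e^(a/2) - e^(-a/2), [sgm a] by e^(a/2) + e^(-a/2), and [DD] by the Weyl
   denominator. *)
Definition dlt (a : E) (phi : E -> R) (x : E) : R :=
  phi (x - 2^-1 *: a) - phi (x + 2^-1 *: a).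

Definition sgm (a : E) (phi : E -> R) (x : E) : R :=
  phi (x - 2^-1 *: a) + phi (x + 2^-1 *: a).

Definition DD (s : seq E) (phi : E -> R) : E -> R := foldr dlt phi s.

(** The derivative of a product: the sum over the entries b of [s] of the product [DD s] with its
    factor [dlt b] replaced by [sgm b], applied to [F b]. *)
Fixpoint SD (s : seq E) (F : E -> E -> R) : E -> R :=
  if s is b :: s' then fun x => DD s' (sgm b (F b)) x + dlt b (SD s' F) x
  else fun=> 0.

Lemma dltC a b phi : dlt a (dlt b phi) = dlt b (dlt a phi).
Proof.
apply/funext => x; rewrite /dlt !(addrAC _ (- (2^-1 *: a))) !(addrAC _ (2^-1 *: a)).
by ring.
Qed.

Lemma dlt_sgmC a b phi : dlt a (sgm b phi) = sgm b (dlt a phi).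
Proof.
apply/funext => x; rewrite /dlt /sgm !(addrAC _ (- (2^-1 *: a))) !(addrAC _ (2^-1 *: a)).
by ring.
Qed.

Lemma dltN a phi : dlt (- a) phi = fun x => - dlt a phi x.
Proof. by apply/funext => x; rewrite /dlt scalerN opprK opprB. Qed.

Lemma DD_dltC s a phi : DD s (dlt a phi) = dlt a (DD s phi).
Proof. by elim: s => //= b s ->; rewrite dltC. Qed.

Lemma DD_sgmC s a phi : DD s (sgm a phi) = sgm a (DD s phi).
Proof. by elim: s => //= b s ->; rewrite dlt_sgmC. Qed.

Lemma DD_cat s t phi : DD (s ++ t) phi = DD s (DD t phi).
Proof. exact: foldr_cat. Qed.

Lemma DD_comm s t phi : DD s (DD t phi) = DD t (DD s phi).
Proof. by elim: s => //= a s ->; rewrite DD_dltC. Qed.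

Lemma DD_perm s t phi : perm_eq s t -> DD s phi = DD t phi.
Proof.
move: s t; apply: (@catCA_perm_subst _ _ (fun t => DD t phi)) => s1 s2 s3.
by rewrite !DD_cat DD_comm.
Qed.

Lemma DD0 s : DD s (fun=> 0) = fun=> 0.
Proof. by elim: s => //= a s ->; apply/funext => x; rewrite /dlt subrr. Qed.

Lemma DDZ s k (phi : E -> R) : DD s (fun x => k * phi x) = fun x => k * DD s phi x.
Proof.
by elim: s => //= a s ->; apply/funext => x; rewrite /dlt; ring.
Qed.

Lemma DDD s (phi psi : E -> R) :
  DD s (fun x => phi x + psi x) = fun x => DD s phi x + DD s psi x.
Proof.
by elim: s => //= a s ->; apply/funext => x; rewrite /dlt; ring.
Qed.

Lemma DD_sum s (I : Type) (r : seq I) (F : I -> E -> R) :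
  DD s (fun x => \sum_(i <- r) F i x) = fun x => \sum_(i <- r) DD s (F i) x.
Proof.
elim: r => [|i r IH].
  rewrite (_ : (fun x => _) = fun=> 0) ?DD0; last first.
    by apply/funext => x; rewrite big_nil.
  by apply/funext => x; rewrite big_nil.
rewrite (_ : (fun x => _) = (fun x => F i x + \sum_(i <- r) F i x)); last first.
  by apply/funext => x; rewrite big_cons.
by rewrite DDD IH; apply/funext => x; rewrite big_cons.
Qed.

Lemma dlt_shift a phi k : dlt a (fun x => phi (x - k)) = fun x => dlt a phi (x - k).
Proof. by apply/funext => x; rewrite /dlt !(addrAC x _ (- k)). Qed.

Lemma DD_shift s phi k : DD s (fun x => phi (x - k)) = fun x => DD s phi (x - k).
Proof. by elim: s => //= a s ->; rewrite dlt_shift. Qed.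

Lemma DD_srefl s a phi x : a != 0 ->
  DD s phi (srefl a x) = DD [seq srefl a b | b <- s] (fun y => phi (srefl a y)) x.
Proof.
move=> a0; elim: s x => //= b s IH x.
by rewrite /dlt -!IH sreflB sreflD !sreflZ !(sreflK a0).
Qed.

Lemma SDZ s k F : SD s (fun b x => k * F b x) = fun x => k * SD s F x.
Proof.
elim: s => [|b s IH]; first by apply/funext => x; rewrite mulr0.
apply/funext => x /=; rewrite {}IH mulrDr; congr (_ + _); last by rewrite /dlt mulrBr.
by rewrite -[RHS]/((fun x => k * _ x) x) -DDZ; congr (DD s _ x);
  apply/funext => y; rewrite /sgm mulrDr.
Qed.

Lemma eq_SD s F G : {in s, F =1 G} -> SD s F = SD s G.
Proof.
elim: s => //= b s IH h; rewrite h ?mem_head // IH // => c cs.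
by rewrite h // in_cons cs orbT.
Qed.

(** Multiplying the coefficients by (k|x) is a derivation; it sends e^(a/2) - e^(-a/2) to (k|a)/2
    times e^(a/2) + e^(-a/2). Iterating over a product gives [DDX]. *)
Lemma dltX k a phi : dlt a (fun x => '[k, x] * phi x) =
  fun x => '[k, x] * dlt a phi x - '[k, a] / 2 * sgm a phi x.
Proof. by apply/funext => x; rewrite /dlt /sgm !ipE; field. Qed.

Lemma DDX k s phi : (fun x => '[k, x] * DD s phi x) =
  fun x => DD s (fun x => '[k, x] * phi x) x
           + SD s (fun b x => '[k, b] / 2 * phi x) x.
Proof.
elim: s => [|b s IH] /=; first by apply/funext => x; rewrite addr0.
apply/funext => x.
have -> : '[k, x] * dlt b (DD s phi) x =
    dlt b (fun x => '[k, x] * DD s phi x) x + '[k, b] / 2 * sgm b (DD s phi) x.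
  by rewrite dltX; ring.
have -> : DD s (sgm b (fun x => '[k, b] / 2 * phi x)) x =
    '[k, b] / 2 * sgm b (DD s phi) x.
  rewrite -DD_sgmC (_ : sgm b (fun x => _) = fun y => '[k, b] / 2 * sgm b phi y) ?DDZ //.
  by apply/funext => y; rewrite /sgm mulrDr.
by rewrite IH /dlt; ring.
Qed.

(** The term of index a in [SD] lacks the factor [dlt a]; applying [dlt a] to [v a] restores it and
    completes the product to [DD s]. *)
Lemma DD_SD (s : seq E) (v : E -> E -> R) :
  (fun x => \sum_(a <- s) DD s (sgm a (v a)) x) = SD s (fun a => dlt a (v a)).
Proof.
elim: s => [|b s IH]; first by apply/funext => x; rewrite big_nil.
apply/funext => x; rewrite big_cons /=; congr (_ + _).
  by rewrite -DD_dltC dlt_sgmC.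
by rewrite -IH /dlt -sumrB.
Qed.

Definition below (k : E) (phi : E -> R) : Prop :=
  forall x, phi x != 0 -> cone (k - x).

Lemma fin_supp_dlt a phi : fin_supp phi -> fin_supp (dlt a phi).
Proof.
move=> [s sP]; exists ([seq x + 2^-1 *: a | x <- s] ++ [seq x - 2^-1 *: a | x <- s]).
move=> x; rewrite mem_cat; have [h|h] := eqVneq (phi (x - 2^-1 *: a)) 0.
  rewrite /dlt h sub0r oppr_eq0 => /sP xs; apply/orP; right.
  by apply/mapP; exists (x + 2^-1 *: a); rewrite ?addrK.
move=> _; apply/orP; left; apply/mapP.
by exists (x - 2^-1 *: a); rewrite ?subrK // sP.
Qed.

Lemma fin_supp_DD s phi : fin_supp phi -> fin_supp (DD s phi).
Proof. by move=> h; elim: s => //= a s; apply: fin_supp_dlt. Qed.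

Lemma half_half (a : E) : 2^-1 *: a + 2^-1 *: a = a.
Proof. by rewrite -scalerDl -[RHS]scale1r; congr (_ *: _); field. Qed.

Lemma below_dlt k a phi : cone a -> below k phi -> below (k + 2^-1 *: a) (dlt a phi).
Proof.
move=> ca h x; have [h0|/h h1 _] := eqVneq (phi (x - 2^-1 *: a)) 0.
  rewrite /dlt h0 sub0r oppr_eq0 => /h h1.
  rewrite (_ : _ - x = (k - (x + 2^-1 *: a)) + a); first exact: coneD.
  have := half_half a; move: (2^-1 *: a) => u <-.
  by rewrite opprD !addrA subrK addrAC.
by move: h1; rewrite opprB addrA addrAC.
Qed.

Lemma dlt_top k a phi : cone a -> a != 0 -> below k phi ->
  dlt a phi (k + 2^-1 *: a) = phi k.
Proof.
move=> ca a0 h; rewrite /dlt addrK -addrA half_half.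
suff -> : phi (k + a) = 0 by rewrite subr0.
apply/eqP/negPn/negP => /h; rewrite opprD addrA subrr sub0r => cN.
by move: a0; rewrite (cone_opp ca cN) eqxx.
Qed.

Lemma below_DD k s phi : {subset s <= posroots} -> below k phi ->
  below (k + 2^-1 *: \sum_(a <- s) a) (DD s phi).
Proof.
elim: s => [|a s IH] h hk; first by rewrite big_nil scaler0 addr0.
rewrite big_cons scalerDr addrCA addrC; apply: below_dlt.
  by have /posrootsP[] := h a (mem_head _ _).
by apply: IH => // b bs; apply: h; rewrite in_cons bs orbT.
Qed.

Lemma DD_top k s phi : {subset s <= posroots} -> below k phi ->
  DD s phi (k + 2^-1 *: \sum_(a <- s) a) = phi k.
Proof.
elim: s => [|a s IH] h hk; first by rewrite big_nil scaler0 addr0.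
have hs : {subset s <= posroots} by move=> b bs; apply: h; rewrite in_cons bs orbT.
rewrite big_cons scalerDr addrCA addrC /= dlt_top ?IH //.
- by have /posrootsP[] := h a (mem_head _ _).
- by apply/posroots_neq0/h/mem_head.
- exact: below_DD.
Qed.

Local Notation DDp := (DD posroots).

(** A simple reflection permutes the positive roots other than its own and negates that one, so
    exactly one factor of the product changes sign. *)
Lemma antisymmetric_DD phi :
  (forall a x, a \in base -> phi (srefl a x) = phi x) -> antisymmetric_fun (DDp phi).
Proof.
move=> inv a x aB; have a0 := base_neq0 aB; rewrite DD_srefl //.
rewrite (_ : (fun y => _) = phi); last by apply/funext => y; apply: inv.
have pE := perm_to_rem (base_posroots aB).
rewrite (DD_perm phi (perm_map (srefl a) pE)) (DD_perm phi pE) /= srefl_id //.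
by rewrite dltN (DD_perm phi (perm_srefl_posroots aB)).
Qed.

Definition unitc (k x : E) : R := (x == k)%:R.

Definition weyl_denom : E -> R := DDp (unitc 0).
Local Notation wd := weyl_denom.

Lemma below_unitc k : below k (unitc k).
Proof.
by move=> x; rewrite /unitc; case: (x =P k) => [->|]; rewrite ?eqxx // subrr => _; apply: cone0.
Qed.

Lemma fin_supp_unitc k : fin_supp (unitc k).
Proof.
by exists [:: k] => x; rewrite /unitc inE; case: (x == k); rewrite // eqxx.
Qed.

Lemma unitc_shift k : unitc k = fun x => unitc 0 (x - k).
Proof. by apply/funext => x; rewrite /unitc subr_eq0. Qed.

Lemma DD_unitc k x : DDp (unitc k) x = wd (x - k).
Proof. by rewrite unitc_shift DD_shift. Qed.

Lemma antisymmetric_denom : antisymmetric_fun wd.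
Proof.
apply: antisymmetric_DD => a x aB; rewrite /unitc.
by rewrite -(inj_eq (can_inj (sreflK (base_neq0 aB)))) sreflK ?base_neq0 // srefl0.
Qed.

Lemma fin_supp_denom : fin_supp wd.
Proof. exact/fin_supp_DD/fin_supp_unitc. Qed.

Lemma below_denom : below rho wd.
Proof.
by rewrite -[rho]add0r; apply: below_DD => //; apply: below_unitc.
Qed.

Lemma denom_rho : wd rho = 1.
Proof.
rewrite -[rho]add0r [LHS]DD_top //; first by rewrite /unitc eqxx.
exact: below_unitc.
Qed.

Lemma antisymmetric_mul (phi psi : E -> R) : antisymmetric_fun phi ->
  (forall a x, a \in base -> psi (srefl a x) = psi x) ->
  antisymmetric_fun (fun x => psi x * phi x).
Proof. by move=> h1 h2 a x aB; rewrite h1 // h2 // mulrN. Qed.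

Lemma fin_supp_mul (phi psi : E -> R) : fin_supp phi -> fin_supp (fun x => psi x * phi x).
Proof.
move=> [s sP]; exists s => x; have [->|/sP//] := eqVneq (phi x) 0.
by rewrite mulr0 eqxx.
Qed.

Lemma intweight_below k phi x : intweight k -> below k phi -> phi x != 0 -> intweight x.
Proof.
move=> ik h /h/intweight_cone ic; rewrite -[x](subKr k).
exact: intweightB.
Qed.

(** By integrality x - rho is dominant, while rho - x is in the cone; so their inner product, which
    is -|x - rho|^2, is nonnegative. *)
Lemma denom_sdominant x : sdominant x -> wd x != 0 -> x = rho.
Proof.
move=> sx h; have ix := intweight_below intweight_rho below_denom h.
have dx := sdominantB_rho ix sx; have cx := below_denom h.
apply/eqP; rewrite -subr_eq0; apply/eqP/ip_le0_eq0.
by rewrite -oppr_ge0 -ipNr opprB; apply: dominant_cone.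
Qed.

(** The product of (x|x) - (rho|rho) with the denominator is antisymmetric and vanishes at every
    strictly dominant point, where the support is reduced to rho. *)
Lemma denom_norm x : wd x != 0 -> '[x, x] = '[rho, rho].
Proof.
pose psi x := '[x, x] - '[rho, rho] => h.
have anti : antisymmetric_fun (fun x => psi x * wd x).
  apply: antisymmetric_mul; first exact: antisymmetric_denom.
  by move=> a y aB; rewrite /psi srefl_ip // base_neq0.
have := antisymmetric_eq0 anti (fin_supp_mul psi fin_supp_denom).
move=> /(_ _ x)/eqP; rewrite mulf_eq0 (negPf h) orbF subr_eq0 => h'.
apply/eqP/h' => y sy; have [->|/(denom_sdominant sy) ->] := eqVneq (wd y) 0.
  by rewrite mulr0.
by rewrite /psi subrr mul0r.
Qed.

Local Notation SDp := (SD posroots).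

(** On the support [denom_norm] gives |x - k|^2 = |rho|^2, that is |x|^2 = 2(k|x) - |k|^2 + |rho|^2;
    the linear term is expanded by [DDX]. *)
Lemma DD_norm_unitc k x : '[x, x] * DDp (unitc k) x =
  DDp (fun y => '[y, y] * unitc k y) x
  + SDp (fun b y => '[b, y] * unitc k y) x + '[rho, rho] * DDp (unitc k) x.
Proof.
have unitcE (f : E -> R) : (fun y => f y * unitc k y) = (fun y => f k * unitc k y).
  by apply/funext => y; rewrite /unitc; case: eqP => [->|_]; rewrite // !mulr0.
rewrite (unitcE (fun y => '[y, y])) DDZ.
have -> : SDp (fun b y => '[b, y] * unitc k y) x =
    2 * ('[k, x] * DDp (unitc k) x - '[k, k] * DDp (unitc k) x).
  have := DDX k posroots (unitc k) => /(congr1 (fun f => f x)) /= ->.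
  rewrite (unitcE (fun y => '[k, y])) DDZ addrAC subrr add0r.
  rewrite -[RHS]/((fun x => 2 * _ x) x) -SDZ; congr (SDp _ x).
  apply/funext => b; apply/funext => y; rewrite (ipC B k b) /unitc.
  by case: (y =P k) => [->|_] /=; rewrite ?mulr0 // !mulr1; field.
rewrite DD_unitc; have [->|/denom_norm] := eqVneq (wd (x - k)) 0; first by ring.
rewrite !ipE (ipC B x k) => h.
by rewrite -h; ring.
Qed.

Lemma fin_supp_ind (Z : (E -> R) -> Prop) :
  Z (fun=> 0) ->
  (forall c k phi, Z phi -> Z (fun x => c * unitc k x + phi x)) ->
  forall phi, fin_supp phi -> Z phi.
Proof.
move=> Z0 ZD phi [s sP]; elim: s phi sP => [|k s IH] phi sP.
  rewrite (_ : phi = fun=> 0) //; apply/funext => x; apply/eqP/negPn/negP.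
  by move/sP.
rewrite (_ : phi = fun x => phi k * unitc k x + (phi x - phi k * unitc k x)).
  apply/ZD/IH => x; rewrite /unitc; case: (x =P k) => [->|/eqP xk].
    by rewrite mulr1 subrr eqxx.
  by rewrite mulr0 subr0 => /sP; rewrite in_cons (negPf xk).
by apply/funext => x; rewrite addrC subrK.
Qed.

Lemma SDD s (F G : E -> E -> R) :
  SD s (fun b x => F b x + G b x) = fun x => SD s F x + SD s G x.
Proof.
elim: s => [|b s IH] /=; first by apply/funext => x; rewrite addr0.
apply/funext => x; rewrite IH.
rewrite (_ : sgm b _ = fun y => sgm b (F b) y + sgm b (G b) y); last first.
  by apply/funext => y; rewrite /sgm; ring.
by rewrite DDD /dlt; ring.
Qed.

(** Leibniz rule for the Laplacian on the product of [phi] with the denominator: the [SD] term is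
    twice the product of gradients, the last one the Laplacian of the denominator. It follows by
    linearity from the case of one exponential. *)
Lemma DD_norm phi x : fin_supp phi -> '[x, x] * DDp phi x =
  DDp (fun y => '[y, y] * phi y) x
  + SDp (fun b y => '[b, y] * phi y) x + '[rho, rho] * DDp phi x.
Proof.
move: phi; apply: fin_supp_ind => [|c k phi IH].
  rewrite (_ : (fun y => _) = fun=> 0); last by apply/funext => y; rewrite mulr0.
  have -> : (fun b y : E => '[b, y] * 0) = fun b y => 0 * 0 :> R.
    by apply/funext => b; apply/funext => y; rewrite !mulr0.
  by rewrite SDZ !DD0; ring.
rewrite (_ : (fun y => '[y, y] * _) =
    fun y => c * ('[y, y] * unitc k y) + '[y, y] * phi y); last first.
  by apply/funext => y; ring.
rewrite (_ : (fun b y => '[b, y] * _) =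
    fun b y => c * ('[b, y] * unitc k y) + '[b, y] * phi y); last first.
  by apply/funext => b; apply/funext => y; ring.
rewrite SDD SDZ !DDD !DDZ mulrDr IH.
by have := DD_norm_unitc k x => /(congr1 (fun z => c * z)) h; rewrite mulrCA h; ring.
Qed.

(* The weight multiplicities of an irreducible representation of highest weight
   l.  The last clause is Freudenthal's formula: [v a x] stands for
   (a|a)/2 tr(e_a f_a) on the weight space x + a/2. *)
Definition irr_mult (l : E) (m : E -> R) : Prop :=
  [/\ fin_supp m, forall a x, a \in base -> m (srefl a x) = m x,
      below l m, m l = 1
    & exists v : E -> E -> R,
        (forall a x, a \in posroots -> dlt a (v a) x = '[a, x] * m x) /\
        forall x, ('[l + rho, l + rho] - '[rho, rho]) * m x =
          '[x, x] * m x + \sum_(a <- posroots) sgm a (v a) x].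

(** * The numerator of Weyl's character formula *)

Section WeylCharacter.
Variables (l : E) (m : E -> R).
Hypothesis lm : irr_mult l m.

Definition weyl_num : E -> R := DDp m.
Local Notation J := weyl_num.

Lemma antisymmetric_num : antisymmetric_fun J.
Proof. by case: lm => _ inv _ _ _; apply: antisymmetric_DD. Qed.

Lemma fin_supp_num : fin_supp J.
Proof. by case: lm => fs _ _ _ _; apply: fin_supp_DD. Qed.

Lemma below_num : below (l + rho) J.
Proof. by case: lm => _ _ bl _ _; apply: below_DD. Qed.

Lemma num_top : J (l + rho) = 1.
Proof. by case: lm => _ _ bl <- _; apply: DD_top. Qed.

(** Apply [DD] to Freudenthal's formula. By [DD_SD] the sum over positive roots becomes [SD] of the
    functions [dlt a (v a)], that is of (a|x) m(x), which is the cross term of [DD_norm]. *)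
Lemma num_norm x : J x != 0 -> '[x, x] = '[l + rho, l + rho].
Proof.
case: lm => fs _ _ _ [v [v1 v2]] h; apply: (mulIf h).
set c := '[l + rho, l + rho] - _ in v2.
suff : c * J x = '[x, x] * J x - '[rho, rho] * J x by rewrite /c => ?; lra.
rewrite DD_norm // addrK -[LHS]/((fun x => c * J x) x) -DDZ.
rewrite (_ : (fun x => c * m x) = fun x => '[x, x] * m x +
   \sum_(a <- posroots) sgm a (v a) x); last by apply/funext.
rewrite DDD; congr (_ + _); rewrite DD_sum -[LHS]/((fun x => _) x) DD_SD.
by congr (_ x); apply: eq_SD => b bP; apply/funext => y; apply: v1.
Qed.

(** With r = l + rho, equality of norms gives |r - x|^2 = -2(x|r - x), which is at most 0 because x
    is dominant and r - x is in the cone. Points on the walls are included, as [num_mul_minuscule]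
    requires. *)
Lemma num_dominant x : dominant x -> J x != 0 -> x = l + rho.
Proof.
move=> dx h; have cx := below_num h; have nx := num_norm h.
move: (l + rho) cx nx => r cx nx.
apply/esym/eqP; rewrite -subr_eq0; apply/eqP/ip_le0_eq0.
by have := dominant_cone dx cx; rewrite !ipE (ipC B r x) -nx => ?; lra.
Qed.

End WeylCharacter.

End RootBaseTheory.

(** * Weyl groups and alternating sums *)

Lemma finite_inj_in (T : choiceType) (U : finType) (A : set T) (f : T -> U) :
  (forall x y, A x -> A y -> f x = f y -> x = y) -> finite_set A.
Proof.
move=> inj; have [[x0 Ax0]|nA] := pselect (A !=set0); last first.
  by rewrite (_ : A = set0) // -subset0 => x Ax; apply: nA; exists x.
pose g u := xget x0 [set x | A x /\ f x = u].
apply: (@sub_finite_set _ _ (g @` [set: U])); last exact/finite_image/finite_finset.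
move=> x Ax; exists (f x) => //; rewrite /g.
by case: xgetP => [y _ [Ay fy]|/(_ x)]; [apply: inj|case].
Qed.

Section Expi.
Variable R : realType.
Implicit Types x y : R.

Lemma expi0 : expi (0 : R) = 1.
Proof. by rewrite /expi cos0 sin0. Qed.

Lemma expiD x y : expi (x + y) = expi x * expi y.
Proof. by rewrite /expi cosD sinD; simpc; rewrite [X in _ +i* X]addrC. Qed.

Lemma expi_neq0 x : expi x != 0.
Proof.
apply/eqP => h; have := expiD x (- x); rewrite subrr expi0 h mul0r => /eqP.
by rewrite oner_eq0.
Qed.

Lemma expi_int n : n \is a Num.int -> expi (2 * pi * n : R) = 1.
Proof.
have expi_nat m : expi (2 * pi * m%:R : R) = 1.
  elim: m => [|m IH]; first by rewrite mulr0 expi0.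
  rewrite -[X in _ * X]natr1 mulrDr expiD IH mul1r mulr1 /expi mulr_natl.
  by rewrite cos2pi sin2pi.
move=> /intrP[[m|m] ->]; first exact: expi_nat.
apply: (mulIf (expi_neq0 (2 * pi * m.+1%:R))).
by rewrite -expiD NegzE mulrNz -mulrDr addNr mulr0 expi0 expi_nat mulr1.
Qed.

Lemma expi_eq1 x : expi (2 * pi * x) = 1 -> x \is a Num.int.
Proof.
pose n := Num.floor x; pose y := x - n%:~R => h.
have yE : x = y + n%:~R by rewrite subrK.
have : expi (2 * pi * y) = 1.
  by move: h; rewrite yE mulrDr expiD (@expi_int n%:~R) ?intr_int ?mulr1.
have y0 : 0 <= y by rewrite subr_ge0 floor_le_tmp.
have y1 : y < 1.
  by rewrite ltrBlDl -[X in _ + X]/(1%:~R) -intrD floorD1_gt.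
move=> [] c1 _; have [y00|y0'] := eqVneq y 0.
  by rewrite yE y00 add0r intr_int.
have : sin (pi * y) != 0.
  rewrite gt_eqF // sin_gt0_pi // mulr_gt0 ?pi_gt0 ?lt_neqAle 1?eq_sym ?y0' //=.
  by rewrite eq_sym -lt_neqAle gtr_pMr ?pi_gt0.
move: c1; rewrite -mulrA mulr_natl cos_mulr2n => c1 /negP[]; apply/eqP.
have := cos2Dsin2 (pi * y) => cs.
by apply/eqP; rewrite -sqrf_eq0; apply/eqP; lra.
Qed.

Lemma expiB_sin x : expi (- x) - expi x = - (2 * sin x)%:C * 'i.
Proof.
rewrite /expi cosN sinN; simpc; congr (_ +i* _); ring.
Qed.

End Expi.

Section WeylGroup.
Variables (R : realType) (E : vectType R) (B : rootBase E).

Local Notation "''[' x , y ]" := (ip B x y).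
Local Notation Phi := (Phi B).
Local Notation base := (base B).
Local Notation srefl := (srefl B).
Local Notation rho := (weyl_vector B).
Local Notation wd := (weyl_denom B).

(** Generated by simple reflections, so that antisymmetry under these propagates by induction;
    [simple_weyl_srefl] recovers the reflections in all roots. *)
Inductive simple_weyl : (E -> E) -> Prop :=
| simple_weyl1 : simple_weyl id
| simple_weylM a w : a \in base -> simple_weyl w -> simple_weyl (srefl a \o w).

Lemma simple_weylD w x y : simple_weyl w -> w (x + y) = w x + w y.
Proof. by move=> hw; elim: hw x y => //= a {}w aB _ IH x y; rewrite IH sreflD. Qed.

Lemma simple_weylZ w c x : simple_weyl w -> w (c *: x) = c *: w x.
Proof. by move=> hw; elim: hw x => //= a {}w aB _ IH x; rewrite IH sreflZ. Qed.

Lemma simple_weyl_sum w c : simple_weyl w ->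
  w (lincomb B c) = \sum_(s <- base) c s *: w s.
Proof.
move=> hw; rewrite /lincomb.
have w0 : w 0 = 0 by have := simple_weylZ 0 0 hw; rewrite !scale0r.
rewrite (big_morph w (fun x y => simple_weylD x y hw) w0).
by apply: eq_bigr => s _; rewrite simple_weylZ.
Qed.

Lemma simple_weyl_ip w x y : simple_weyl w -> '[w x, w y] = '[x, y].
Proof.
move=> hw; elim: hw x y => //= a {}w aB _ IH x y.
by rewrite srefl_ip ?(base_neq0 aB).
Qed.

Lemma simple_weyl_root w a : simple_weyl w -> a \in Phi -> w a \in Phi.
Proof.
move=> hw; elim: hw a => //= b {}w bB _ IH a ra.
by apply: srefl_root; [apply: base_Phi|apply: IH].
Qed.

Lemma simple_weyl_comp w v : simple_weyl w -> simple_weyl v -> simple_weyl (w \o v).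
Proof.
move=> hw hv; elim: hw => [|a {}w aB _ IH]; first exact: hv.
exact: (simple_weylM aB IH).
Qed.

Lemma simple_weyl_base a : a \in base -> simple_weyl (srefl a).
Proof. by move=> aB; apply: (simple_weylM aB simple_weyl1). Qed.

Lemma simple_weyl_inv w : simple_weyl w ->
  exists v, [/\ simple_weyl v, cancel w v & cancel v w].
Proof.
elim=> [|a {}w aB _ [v [hv wv vw]]].
  by exists id; split=> //; apply: simple_weyl1.
have aK := sreflK B (base_neq0 aB).
exists (v \o srefl a); split.
- exact: simple_weyl_comp hv (simple_weyl_base aB).
- by move=> x /=; rewrite aK wv.
- by move=> x /=; rewrite vw aK.
Qed.

Lemma simple_weyl_srefl a : a \in Phi -> simple_weyl (srefl a).
Proof.
wlog aP : a / a \in posroots B.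
  move=> h ra; have [aP|aP] := root_sign ra; first exact: h.
  rewrite (_ : srefl a = srefl (- a)); last by apply/funext => x; rewrite sreflNr.
  by apply: h => //; apply: root_opp.
move=> _; move: aP; apply: (@posroots_ind _ _ B (fun a => simple_weyl (srefl a))) => [b|b c bB cP IH].
  exact: simple_weyl_base.
rewrite (_ : srefl (srefl b c) = srefl b \o (srefl c \o srefl b)); last first.
  by apply/funext => x; rewrite srefl_conj ?(base_neq0 bB).
by apply: (simple_weylM bB); apply: simple_weyl_comp => //; apply: simple_weyl_base.
Qed.

Lemma simple_weyl_intweight w x : simple_weyl w -> intweight B x -> intweight B (w x).
Proof.
move=> hw ix; elim: hw => //= a {}w aB _ IH.
by apply: intweight_srefl => //; apply: base_Phi.
Qed.

(** The determinant of [w], read off the Weyl denominator: its antisymmetry and its value 1 at rho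
    give multiplicativity and the sign of each reflection without counting letters in a word. *)
Definition weyl_sign (w : E -> E) : R := wd (w rho).
Local Notation eps := weyl_sign.

Lemma weyl_sign_srefl a w : a \in base -> eps (srefl a \o w) = - eps w.
Proof. by move=> aB; rewrite /eps /= antisymmetric_denom. Qed.

Lemma antisymmetric_weyl (phi : E -> R) w x : antisymmetric_fun B phi ->
  simple_weyl w -> phi (w x) = eps w * phi x.
Proof.
move=> anti; elim=> [|a {}w aB _ IH]; first by rewrite /eps denom_rho mul1r.
by rewrite weyl_sign_srefl //= anti // IH mulNr.
Qed.

Lemma weyl_sign_comp w v : simple_weyl w -> simple_weyl v ->
  eps (w \o v) = eps w * eps v.
Proof.
by move=> hw hv; rewrite {1}/eps /= (antisymmetric_weyl _ (@antisymmetric_denom _ _ B) hw).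
Qed.

Lemma weyl_sign_id : eps id = 1. Proof. exact: denom_rho. Qed.

Lemma weyl_sign_pm w : simple_weyl w -> eps w = 1 \/ eps w = -1.
Proof.
elim=> [|a {}w aB _ [] IH]; first by left; apply: denom_rho.
  by right; rewrite weyl_sign_srefl // IH.
by left; rewrite weyl_sign_srefl // IH opprK.
Qed.

Lemma weyl_sign_inv w v : simple_weyl w -> simple_weyl v -> cancel v w -> eps v = eps w.
Proof.
move=> hw hv vw; have := weyl_sign_comp hw hv.
rewrite (_ : w \o v = id) ?weyl_sign_id; last by apply/funext.
by case: (weyl_sign_pm hw) => ->; [rewrite mul1r|move=> ?; lra].
Qed.

Lemma weyl_sign_refl a : a \in Phi -> eps (srefl a) = -1.
Proof.
wlog aP : a / a \in posroots B.
  move=> h ra; have [aP|aP] := root_sign ra; first exact: h.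
  rewrite (_ : srefl a = srefl (- a)); last by apply/funext => x; rewrite sreflNr.
  by apply: h => //; apply: root_opp.
move=> _; move: aP; apply: (@posroots_ind _ _ B (fun a => eps (srefl a) = -1)) => [b bB|b c bB cP IH].
  by rewrite -[srefl b]/(srefl b \o id) weyl_sign_srefl // weyl_sign_id.
rewrite (_ : srefl (srefl b c) = srefl b \o (srefl c \o srefl b)); last first.
  by apply/funext => x; rewrite srefl_conj ?(base_neq0 bB).
have hb := simple_weyl_base bB.
have hc : simple_weyl (srefl c) by apply: simple_weyl_srefl; case/posrootsP: cP.
rewrite weyl_sign_srefl // weyl_sign_comp // IH //.
by rewrite -[srefl b]/(srefl b \o id) weyl_sign_srefl // weyl_sign_id; ring.
Qed.

Lemma simple_weyl_finite : finite_set [set w | simple_weyl w].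
Proof.
(* An element is determined by the positions in [Phi] of the images of the simple roots. *)
pose f (w : E -> E) := [ffun i : 'I_(size base) => inord (index (w base`_i) Phi) : 'I_(size Phi).+1].
apply: (@finite_inj_in _ _ _ f) => w v /= hw hv /ffunP fE.
have wv : {in base, w =1 v}.
  move=> s sB; have si : (index s base < size base)%N by rewrite index_mem.
  have := fE (Ordinal si); rewrite !ffunE /= nth_index // => /(congr1 val) /=.
  have rs := base_Phi sB.
  rewrite !inordK ?ltnS ?index_size // => h.
  rewrite -(nth_index 0 (simple_weyl_root hw rs)) h nth_index //.
  exact: simple_weyl_root.
apply/funext => x; rewrite (scoefE B x) !simple_weyl_sum //.
by apply: eq_big_seq => s sB; rewrite wv.
Qed.

Definition weyl_seq : seq (E -> E) :=
  finmap.enum_fset (fset_set [set w | simple_weyl w]).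

Lemma weyl_seqP w : reflect (simple_weyl w) (w \in weyl_seq).
Proof.
rewrite /weyl_seq in_fset_set; last exact: simple_weyl_finite.
by apply: (iffP idP); rewrite inE.
Qed.

Lemma weyl_seq_uniq : uniq weyl_seq. Proof. exact: finmap.fset_uniq. Qed.

Lemma perm_weyl_seq (f g : (E -> E) -> (E -> E)) :
  (forall w, simple_weyl w -> simple_weyl (f w)) ->
  (forall w, simple_weyl w -> simple_weyl (g w)) ->
  (forall w, simple_weyl w -> g (f w) = w) ->
  (forall w, simple_weyl w -> f (g w) = w) ->
  perm_eq [seq f w | w <- weyl_seq] weyl_seq.
Proof.
move=> hf hg fK gK; apply: uniq_perm; last 1 first.
- move=> w; apply/mapP/weyl_seqP => [[v /weyl_seqP hv ->]|hw]; first exact: hf.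
  by exists (g w); rewrite ?gK //; apply/weyl_seqP/hg.
- rewrite map_inj_in_uniq ?weyl_seq_uniq // => w v /weyl_seqP hw /weyl_seqP hv h.
  by rewrite -(fK w) // h fK.
- exact: weyl_seq_uniq.
Qed.

Lemma perm_weyl_seql v : simple_weyl v ->
  perm_eq [seq v \o w | w <- weyl_seq] weyl_seq.
Proof.
move=> hv; have [u [hu vu uv]] := simple_weyl_inv hv.
apply: (@perm_weyl_seq _ (fun w => u \o w)).
- by move=> w hw; apply: simple_weyl_comp.
- by move=> w hw; apply: simple_weyl_comp.
- by move=> w hw; apply/funext => x /=; rewrite vu.
- by move=> w hw; apply/funext => x /=; rewrite uv.
Qed.

Lemma perm_weyl_seqr v : simple_weyl v ->
  perm_eq [seq w \o v | w <- weyl_seq] weyl_seq.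
Proof.
move=> hv; have [u [hu vu uv]] := simple_weyl_inv hv.
apply: (@perm_weyl_seq _ (fun w => w \o u)).
- by move=> w hw; apply: simple_weyl_comp.
- by move=> w hw; apply: simple_weyl_comp.
- by move=> w hw; apply/funext => x /=; rewrite uv.
- by move=> w hw; apply/funext => x /=; rewrite vu.
Qed.

Definition weyl_inv (w : E -> E) : E -> E :=
  xget (id : E -> E) [set v | simple_weyl v /\ cancel w v /\ cancel v w].

Lemma weyl_invP w : simple_weyl w ->
  [/\ simple_weyl (weyl_inv w), cancel w (weyl_inv w) & cancel (weyl_inv w) w].
Proof.
move=> /simple_weyl_inv[v [hv wv vw]]; rewrite /weyl_inv.
by case: xgetP => [u _ [? []]//|/(_ v)]; case.
Qed.

Lemma perm_weyl_seqV : perm_eq [seq weyl_inv w | w <- weyl_seq] weyl_seq.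
Proof.
have K w : simple_weyl w -> weyl_inv (weyl_inv w) = w.
  move=> /weyl_invP[h1 wv vw]; have [_ _ vw'] := weyl_invP h1.
  by apply/funext => x; rewrite -[LHS]vw vw'.
by apply: (@perm_weyl_seq _ weyl_inv) => // w /weyl_invP[].
Qed.

(** A sum over the group meets each point of the orbit of [mu] this many times; alternating sums
    carry the factor along and it is divided out, being positive. *)
Definition stab_card (mu : E) : nat := count (fun w => w mu == mu) weyl_seq.

Lemma stab_card_gt0 mu : (0 < stab_card mu)%N.
Proof.
rewrite -has_count; apply/hasP; exists id; rewrite ?eqxx //.
exact/weyl_seqP/simple_weyl1.
Qed.

(* An antisymmetric function whose only strictly dominant support point is mu is
   proportional to the alternating sum over the orbit of mu. *)
Lemma alternating_sum (phi : E -> R) mu : antisymmetric_fun B phi -> fin_supp phi ->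
  phi mu = 1 -> sdominant B mu ->
  (forall x, sdominant B x -> phi x != 0 -> x = mu) ->
  forall x, \sum_(w <- weyl_seq) eps w * (w mu == x)%:R = (stab_card mu)%:R * phi x.
Proof.
move=> anti fs top smu dom x; apply/eqP; rewrite -subr_eq0; apply/eqP.
pose a x := \sum_(w <- weyl_seq) eps w * (w mu == x)%:R.
move: x; apply: (@antisymmetric_eq0 _ _ B (fun x => a x - (stab_card mu)%:R * phi x)).
- move=> b x bB; rewrite anti // mulrN opprB opprK addrC; congr (_ + _).
  rewrite /a -(perm_big _ (perm_weyl_seql (simple_weyl_base bB))) big_map -sumrN.
  apply: eq_big_seq => w _; rewrite weyl_sign_srefl // mulNr /=.
  by rewrite (inj_eq (can_inj (sreflK B (base_neq0 bB)))).
- case: fs => s sP; exists ([seq w mu | w <- weyl_seq] ++ s) => x.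
  rewrite mem_cat; apply: contraR; rewrite negb_or => /andP[h1 h2].
  have -> : phi x = 0 by apply/eqP/negPn/negP => /sP h; rewrite h in h2.
  rewrite mulr0 subr0 /a big1_seq // => w /andP[_ ws].
  case: eqP => [wx|_]; last by rewrite mulr0.
  by case/negP: h1; apply/mapP; exists w.
- move=> x sx.
  have wE w : simple_weyl w -> w mu = x -> phi x = eps w.
    by move=> hw <-; rewrite (antisymmetric_weyl _ anti hw) top mulr1.
  have [xmu|xmu] := eqVneq x mu.
    rewrite xmu top mulr1 /a /stab_card -sum1_count natr_sum [X in _ - X]big_mkcond /=.
    rewrite -sumrB big1_seq // => w /andP[_ /weyl_seqP hw].
    case: eqP => [h|_]; last by rewrite mulr0 subrr.
    by rewrite -(wE w hw) ?xmu // top mulr1 subrr.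
  have -> : phi x = 0 by apply/eqP/negPn/negP => /(dom _ sx)/eqP; rewrite (negPf xmu).
  rewrite mulr0 subr0 /a big1_seq // => w /andP[_ /weyl_seqP hw].
  case: eqP => [h|_]; last by rewrite mulr0.
  have e0 : phi x != 0.
    by rewrite (wE w hw h); case: (weyl_sign_pm hw) => ->; rewrite ?oppr_eq0 oner_neq0.
  by have := dom _ sx e0 => /eqP; rewrite (negPf xmu).
Qed.

End WeylGroup.

(** * Discretized characters *)

Section Evaluation.
Variables (R : realType) (E : vectType R) (B : rootBase E).
Local Notation C := R[i].
Local Notation "''[' x , y ]" := (ip B x y).

(** The value of the formal character [phi] under e^x -> [f x]; it is a ring evaluation when [f] is
    multiplicative. *)
Definition ev (phi : E -> R) (f : E -> C) : C :=
  \sum_(x \in [set: E]) (phi x)%:C * f x.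

Lemma evE (r : seq E) phi f : uniq r -> (forall x, phi x != 0 -> x \in r) ->
  ev phi f = \sum_(x <- r) (phi x)%:C * f x.
Proof.
move=> ur sr; rewrite /ev (@fsbigE _ _ _ _ _ r) //.
  by apply: eq_bigl => x; rewrite in_setT.
move=> x _ xr; have -> : phi x = 0 by apply/eqP/negPn/negP => /sr h; rewrite h in xr.
by rewrite mul0r.
Qed.

Lemma fin_supp_uniq phi : fin_supp phi ->
  exists2 r : seq E, uniq r & forall x, (phi x != 0) = (x \in r).
Proof.
move=> [s sP]; exists [seq x <- undup s | phi x != 0].
  by rewrite filter_uniq // undup_uniq.
move=> x; rewrite mem_filter mem_undup.
by case: (boolP (phi x != 0)) => // /sP ->.
Qed.

Lemma evD phi psi f : fin_supp phi -> fin_supp psi ->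
  ev (fun x => phi x + psi x) f = ev phi f + ev psi f.
Proof.
move=> [s sP] [t tP]; rewrite !(@evE (undup (s ++ t))) ?undup_uniq //; first last.
- move=> x h; rewrite mem_undup mem_cat.
  have [p0|/sP->//] := eqVneq (phi x) 0.
  by move: h; rewrite p0 add0r => /tP ->; rewrite orbT.
- by move=> x /sP xs; rewrite mem_undup mem_cat xs.
- by move=> x /tP xs; rewrite mem_undup mem_cat xs orbT.
by rewrite -big_split; apply: eq_bigr => x _; rewrite rmorphD mulrDl.
Qed.

Lemma evZ c phi f : ev (fun x => c * phi x) f = c%:C * ev phi f.
Proof. by rewrite /ev mulr_fsumr; apply: eq_fsbigr => x _; rewrite rmorphM mulrA. Qed.

Lemma ev0 f : ev (fun=> 0) f = 0.
Proof. by rewrite (@evE [::]) ?big_nil // => x; rewrite eqxx. Qed.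

Lemma fin_supp_shift k (phi : E -> R) : fin_supp phi -> fin_supp (fun x => phi (x - k)).
Proof.
move=> [s sP]; exists [seq x + k | x <- s] => x /sP xs.
by apply/mapP; exists (x - k); rewrite ?subrK.
Qed.

Lemma fin_suppZ c (phi : E -> R) : fin_supp phi -> fin_supp (fun x : E => c * phi x).
Proof.
by move=> [s sP]; exists s => x; rewrite mulf_eq0 negb_or => /andP[_ /sP].
Qed.

Lemma fin_suppD (phi psi : E -> R) : fin_supp phi -> fin_supp psi ->
  fin_supp (fun x : E => phi x + psi x).
Proof.
move=> [s sP] [t tP]; exists (s ++ t) => x; rewrite mem_cat.
have [->|/sP->//] := eqVneq (phi x) 0.
by rewrite add0r => /tP->; rewrite orbT.
Qed.

Lemma fin_supp_sum (I : eqType) (r : seq I) (P : pred I) (F : I -> E -> R) :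
  (forall i, i \in r -> P i -> fin_supp (F i)) ->
  fin_supp (fun x => \sum_(i <- r | P i) F i x).
Proof.
elim: r => [|i r IH] h; first by exists [::] => x; rewrite big_nil eqxx.
have IH' : fin_supp (fun x => \sum_(i <- r | P i) F i x).
  by apply: IH => j jr; apply: h; rewrite in_cons jr orbT.
case: (boolP (P i)) => Pi.
  rewrite (_ : (fun x => _) = fun x => F i x + \sum_(i <- r | P i) F i x).
    by apply: fin_suppD => //; apply: h; rewrite ?mem_head.
  by apply/funext => x; rewrite big_cons Pi.
rewrite (_ : (fun x => _) = fun x => \sum_(i <- r | P i) F i x) //.
by apply/funext => x; rewrite big_cons (negPf Pi).
Qed.

Lemma ev_sum (I : eqType) (r : seq I) (P : pred I) (F : I -> E -> R) f :
  (forall i, i \in r -> P i -> fin_supp (F i)) ->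
  ev (fun x => \sum_(i <- r | P i) F i x) f = \sum_(i <- r | P i) ev (F i) f.
Proof.
elim: r => [|i r IH] h.
  rewrite big_nil -(ev0 f); congr (ev _ f); apply/funext => x; exact: big_nil.
have h' j : j \in r -> P j -> fin_supp (F j).
  by move=> jr; apply: h; rewrite in_cons jr orbT.
rewrite big_cons -(IH h'); case: (boolP (P i)) => Pi.
  rewrite -evD; first 1 last.
  - by apply: h; rewrite ?mem_head.
  - exact: fin_supp_sum.
  by congr (ev _ f); apply/funext => x; rewrite big_cons Pi.
by congr (ev _ f); apply/funext => x; rewrite big_cons (negPf Pi).
Qed.

Lemma ev_shift k phi f : fin_supp phi ->
  ev (fun x => phi (x - k)) f = ev phi (fun x => f (x + k)).
Proof.
move=> /fin_supp_uniq[r ur rP].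
rewrite (@evE [seq x + k | x <- r]); first last.
- by move=> x; rewrite rP => xr; apply/mapP; exists (x - k); rewrite ?subrK.
- by rewrite map_inj_uniq //; apply: addIr.
rewrite (@evE r) //; last by move=> x; rewrite rP.
by rewrite big_map; apply: eq_bigr => x _; rewrite addrK.
Qed.

Section Multiplicative.
Variable f : E -> C.
Hypothesis fD : forall x y, f (x + y) = f x * f y.

Lemma ev_shiftM k phi : fin_supp phi -> ev (fun x => phi (x - k)) f = f k * ev phi f.
Proof.
move=> fs; rewrite ev_shift // /ev mulr_fsumr; apply: eq_fsbigr => x _.
by rewrite fD; ring.
Qed.

Lemma ev_dlt a phi : fin_supp phi ->
  ev (dlt a phi) f = (f (2^-1 *: a) - f (- (2^-1 *: a))) * ev phi f.
Proof.
move=> fs; rewrite (_ : dlt a phi =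
    fun x => phi (x - 2^-1 *: a) + (-1) * phi (x - - (2^-1 *: a))); last first.
  by apply/funext => x; rewrite opprK mulN1r.
rewrite evD ?evZ ?ev_shiftM ?rmorphN ?rmorph1 //; first ring.
- exact: fin_supp_shift.
- by apply: fin_suppZ; apply: fin_supp_shift.
Qed.

Lemma ev_DD s phi : fin_supp phi ->
  ev (DD s phi) f = \prod_(a <- s) (f (2^-1 *: a) - f (- (2^-1 *: a))) * ev phi f.
Proof.
move=> fs; elim: s => [|a s IH]; first by rewrite big_nil mul1r.
by rewrite /= ev_dlt ?IH ?big_cons ?mulrA //; apply: fin_supp_DD.
Qed.

Lemma ev_denom : f 0 = 1 -> ev (weyl_denom B) f =
  \prod_(a <- posroots B) (f (2^-1 *: a) - f (- (2^-1 *: a))).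
Proof.
move=> f0; rewrite ev_DD; last exact: fin_supp_unitc.
rewrite (@evE [:: 0]) // => [|x]; first by rewrite big_seq1 /unitc eqxx f0 !mulr1.
by rewrite /unitc inE; case: (x == 0); rewrite // eqxx.
Qed.

End Multiplicative.

Lemma ev_alternating (phi : E -> R) mu f : antisymmetric_fun B phi -> fin_supp phi ->
  phi mu = 1 -> sdominant B mu ->
  (forall x, sdominant B x -> phi x != 0 -> x = mu) ->
  \sum_(w <- weyl_seq B) (weyl_sign B w)%:C * f (w mu) =
  (stab_card B mu)%:R * ev phi f.
Proof.
move=> anti fs top smu dom; have [s sP] := fs.
pose r := undup ([seq w mu | w <- weyl_seq B] ++ s).
rewrite (@evE r) ?undup_uniq //; last first.
  by move=> x /sP xs; rewrite mem_undup mem_cat xs orbT.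
rewrite mulr_sumr.
transitivity (\sum_(x <- r) \sum_(w <- weyl_seq B)
    (weyl_sign B w * (w mu == x)%:R)%:C * f x).
  rewrite exchange_big /=; apply: eq_big_seq => w ww.
  have wr : w mu \in r by rewrite mem_undup mem_cat map_f.
  rewrite (bigD1_seq (w mu)) ?undup_uniq //= eqxx mulr1 big1 ?addr0 // => x.
  by rewrite eq_sym => /negPf ->; rewrite mulr0 mul0r.
apply: eq_bigr => x _; rewrite mulrA -[_%:R](rmorph_nat (real_complex R)) -rmorphM.
rewrite -(alternating_sum anti fs top smu dom) rmorph_sum mulr_suml.
by apply: eq_bigr.
Qed.

End Evaluation.

(** * Characters at the points of the alcove, and products with a minuscule character *)

Section Level.
Variables (R : realType) (E : vectType R) (B : rootBase E).
Local Notation C := R[i].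
Local Notation "''[' x , y ]" := (ip B x y).
Local Notation Phi := (Phi B).
Local Notation base := (base B).
Local Notation srefl := (srefl B).
Local Notation rho := (weyl_vector B).
Local Notation wd := (weyl_denom B).
Local Notation eps := (weyl_sign B).
Local Notation intweight := (intweight B).
Local Notation dominant := (dominant B).

Variables (theta : E) (k : nat).
Hypothesis theta_root : theta \in Phi.
Hypothesis theta_high : forall a, a \in Phi -> cone B (theta - a).
Hypothesis theta_norm : '[theta, theta] = 2.

(** This is k + h^vee, since rho(theta^v) = (rho|theta) when (theta|theta) = 2. *)
Definition level_M : R := k%:R + 1 + '[rho, theta].
Local Notation M := level_M.

Definition level_wt : set E :=
  [set x | [/\ intweight x, dominant x & '[x, theta] <= k%:R]].

(** The exponential of weight [x] at the point -nu^-1(kap/M); [chi] uses kap = sigma + rho. Its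
    symmetry in [kap] and [x] is what [fchar_ratio] and the independence of characters exploit. *)
Definition wave (kap x : E) : C := expi (2 * pi * - (M^-1 * '[x, kap])).

Lemma waveD kap x y : wave kap (x + y) = wave kap x * wave kap y.
Proof. by rewrite /wave -expiD -mulrDr -opprD -mulrDr ipDl. Qed.

Lemma wave0 kap : wave kap 0 = 1.
Proof. by rewrite /wave ip0l mulr0 oppr0 mulr0 expi0. Qed.

Lemma waveC kap x : wave kap x = wave x kap.
Proof. by rewrite /wave ipC. Qed.

Lemma pairing_theta x : pairing B x theta = '[x, theta].
Proof. by rewrite /pairing theta_norm mulrAC mulfV ?mul1r ?pnatr_eq0. Qed.

Lemma theta_cone : cone B theta.
Proof.
have h := theta_high (root_opp theta_root); rewrite opprK in h.
apply/coneP => s sB; have /root_sign[] := theta_root; first by case/posrootsP => _ /coneP ->.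
case/posrootsP => _ c; have := coneD h c; rewrite addrK => /coneP; exact.
Qed.

Lemma rho_theta_ge0 : 0 <= '[rho, theta].
Proof.
by apply: dominant_cone theta_cone; apply/sdominant_dominant/sdominant_rho.
Qed.

Lemma M_gt0 : 0 < M.
Proof. by rewrite /M -addrA ltr_wpDl // ltr_pwDl // rho_theta_ge0. Qed.

Lemma M_int : M \is a Num.int.
Proof.
rewrite /M !rpredD ?natr_int ?rpred1 // -pairing_theta.
exact: intweight_rho.
Qed.

Lemma level0 : level_wt 0.
Proof.
split; [exact: intweight0| by move=> a aB; rewrite pairing0l|by rewrite ip0l].
Qed.

Lemma level_sdominant s : level_wt s -> sdominant B (s + rho).
Proof. by case=> _ ds _; apply: sdominantD_rho. Qed.

(** The highest root dominates all others: (a|s + rho) <= (theta|s + rho) <= k + (rho|theta) = M -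
    1. *)
Lemma level_root_bound s a : level_wt s -> a \in posroots B ->
  0 < '[a, s + rho] < M.
Proof.
move=> ls /[dup] aP /posrootsP[ra ca]; have sd := level_sdominant ls.
rewrite ipC (sdominant_cone sd) ?(posroots_neq0 aP) //=.
have := dominant_cone (sdominant_dominant sd) (theta_high ra).
case: ls => _ _ ls; rewrite ipBr subr_ge0 => h; apply: le_lt_trans h _.
rewrite ipDl /M -addrA ler_ltD // ltrDr ltr01 //.
Qed.

Lemma wave_denom kap : ev wd (wave kap) =
  \prod_(a <- posroots B) (- (2 * sin (pi * (M^-1 * '[a, kap])))%:C * 'i).
Proof.
rewrite (ev_denom B (waveD kap) (wave0 kap)); apply: eq_bigr => a _.
rewrite -expiB_sin /wave !ipE; congr (expi _ - expi _); field; by rewrite (gt_eqF M_gt0).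
Qed.

Lemma level_sin_gt0 s a : level_wt s -> a \in posroots B ->
  0 < sin (pi * (M^-1 * '[a, s + rho])).
Proof.
move=> ls aP; have /andP[h1 h2] := level_root_bound ls aP.
have p := pi_gt0 R; have m := M_gt0.
rewrite sin_gt0_pi // mulr_gt0 ?mulr_gt0 ?invr_gt0 //= gtr_pMr // mulrC ltr_pdivrMr //.
by rewrite mul1r.
Qed.

Lemma wave_denom_neq0 s : level_wt s -> ev wd (wave (s + rho)) != 0.
Proof.
move=> ls; rewrite wave_denom prodf_seq_neq0; apply/allP => a aP /=.
rewrite mulf_neq0 ?oppr_eq0 ?neq0Ci // fmorph_eq0.
by rewrite mulf_neq0 ?pnatr_eq0 // gt_eqF // (level_sin_gt0 ls).
Qed.

Lemma wave_denom_ratio s t : level_wt s -> level_wt t ->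
  0 < ev wd (wave (s + rho)) / ev wd (wave (t + rho)).
Proof.
move=> ls lt; rewrite !wave_denom -prodf_div big_seq; apply: prodr_gt0 => a aP.
rewrite -mulf_div divff ?neq0Ci // mulr1 invrN mulrNN -fmorph_div ltcR.
by rewrite divr_gt0 // mulr_gt0 // level_sin_gt0.
Qed.

Variable mult : E -> E -> R.
Hypothesis multP : forall l, intweight l -> dominant l -> irr_mult B l (mult l).

Definition fchar (l s : E) : C := ev (mult l) (wave (s + rho)).

Local Notation J l := (weyl_num B (mult l)).

Lemma num_sdominant l x : intweight l -> dominant l -> sdominant B x -> J l x != 0 ->
  x = l + rho.
Proof.
by move=> il dl /sdominant_dominant dx; apply: num_dominant; first exact: multP.
Qed.

Lemma fchar_denom l s : intweight l -> dominant l ->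
  fchar l s * ev wd (wave (s + rho)) = ev (J l) (wave (s + rho)).
Proof.
move=> il dl; have [fs _ _ _ _] := multP il dl.
rewrite (ev_denom B (waveD _) (wave0 _)) mulrC /weyl_num.
by rewrite (ev_DD (waveD _)).
Qed.

Lemma num_alternating l (f : E -> C) : intweight l -> dominant l ->
  \sum_(w <- weyl_seq B) (eps w)%:C * f (w (l + rho)) =
  (stab_card B (l + rho))%:R * ev (J l) f.
Proof.
move=> il dl; have lm := multP il dl; apply: ev_alternating.
- exact: antisymmetric_num lm.
- exact: fin_supp_num lm.
- exact: num_top lm.
- exact: sdominantD_rho.
- by move=> x; apply: num_sdominant.
Qed.

Lemma denom_alternating (f : E -> C) :
  \sum_(w <- weyl_seq B) (eps w)%:C * f (w rho) = (stab_card B rho)%:R * ev wd f.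
Proof.
apply: ev_alternating.
- exact: antisymmetric_denom.
- exact: fin_supp_denom.
- exact: denom_rho.
- exact: sdominant_rho.
- exact: denom_sdominant.
Qed.

Lemma stab_card_neq0 x : (stab_card B x)%:R != 0 :> C.
Proof. by rewrite pnatr_eq0 -lt0n stab_card_gt0. Qed.

(* Reflecting l + rho in the affine wall (x|theta) = M changes the sign of the
   alternating sum but not the waves. *)
Lemma num_wall l s : intweight l -> dominant l -> '[l + rho, theta] = M ->
  level_wt s -> ev (J l) (wave (s + rho)) = 0.
Proof.
move=> il dl wall ls; apply: (mulfI (stab_card_neq0 (l + rho))).
rewrite mulr0 -num_alternating //; set S := \sum_(w <- _) _.
suff : S = - S by move=> /eqP; rewrite -addr_eq0 -mulr2n mulrn_eq0 => /eqP.
have th := simple_weyl_srefl theta_root.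
rewrite /S -{1}(perm_big _ (perm_weyl_seqr th)) big_map -sumrN.
apply: eq_big_seq => w /weyl_seqP hw.
rewrite weyl_sign_comp // weyl_sign_refl // mulrN1 rmorphN mulNr; congr (- (_ * _)).
rewrite /= sreflE pairing_theta wall (simple_weylD _ _ hw) -scaleNr (simple_weylZ _ _ hw).
rewrite waveD -[RHS]mulr1; congr (_ * _); rewrite /wave ipZl.
rewrite (_ : - (_ * _) = '[w theta, s + rho]); last first.
  by field; rewrite (gt_eqF M_gt0).
rewrite expi_int //.
have ri : intweight (s + rho) by case: ls => si _ _; apply: intweightD => //; apply: intweight_rho.
have /ri : w theta \in Phi by apply: simple_weyl_root.
by rewrite /pairing (simple_weyl_ip _ _ hw) theta_norm mulrAC mulfV ?pnatr_eq0 // mul1r ipC.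
Qed.

(** The waves are symmetric and the Weyl group preserves the form, so replacing w by its inverse
    turns the alternating sum over the orbit of l + rho, evaluated at rho, into the one over the
    orbit of rho, evaluated at l + rho. The latter is the denominator, which is a product. *)
Lemma fchar_ratio l : level_wt l ->
  fchar l 0 = (stab_card B rho)%:R / (stab_card B (l + rho))%:R *
    (ev wd (wave (l + rho)) / ev wd (wave (0 + rho))).
Proof.
move=> ll; have [il dl _] := ll.
have d0 := wave_denom_neq0 level0.
rewrite mulrA; apply: (canRL (mulfK d0)); rewrite fchar_denom //.
apply: (mulfI (stab_card_neq0 (l + rho))).
rewrite mulrA mulrCA divff ?stab_card_neq0 // mulr1 -num_alternating //.
rewrite -denom_alternating -(perm_big _ (perm_weyl_seqV B)) big_map /=.
apply: eq_big_seq => w /weyl_seqP hw; have [hv wv vw] := weyl_invP hw.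
rewrite (weyl_sign_inv hw hv vw) add0r; congr (_ * _).
rewrite waveC /wave; congr (expi (_ * - (_ * _))).
by rewrite -[LHS](simple_weyl_ip _ _ hw) vw.
Qed.

Lemma fchar_gt0 l : level_wt l -> 0 < fchar l 0.
Proof.
move=> ll; rewrite fchar_ratio //; apply: mulr_gt0.
  by rewrite divr_gt0 // ltr0n stab_card_gt0.
exact: wave_denom_ratio ll level0.
Qed.

(** The numerator for l = 0 and the denominator are antisymmetric and agree at strictly dominant
    points, hence coincide. The value 1 shows that the eigenfunctions are not identically zero. *)
Lemma fchar0 s : level_wt s -> fchar 0 s = 1.
Proof.
move=> ls; have [i0 d0 _] := level0; have lm := multP i0 d0.
apply: (mulIf (wave_denom_neq0 ls)); rewrite fchar_denom // mul1r.
congr (ev _ _); apply/funext => x; apply/eqP; rewrite -subr_eq0; apply/eqP.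
move: x; apply: (antisymmetric_eq0 (B := B)).
- move=> a x aB; rewrite (antisymmetric_num lm) // antisymmetric_denom //.
  by rewrite opprK opprB addrC.
- case: (fin_supp_num lm) => r rP; case: (fin_supp_denom B) => r' r'P.
  exists (r ++ r') => x; rewrite mem_cat; have [->|/rP->//] := eqVneq (J 0 x) 0.
  by rewrite sub0r oppr_eq0 => /r'P->; rewrite orbT.
- move=> x sx; have [->|xr] := eqVneq x rho.
    by rewrite denom_rho -[X in J 0 X]add0r (num_top lm) subrr.
  have -> : J 0 x = 0.
    apply/eqP/negPn/negP => /(num_sdominant i0 d0 sx); rewrite add0r => /eqP.
    by rewrite (negPf xr).
  have -> : wd x = 0.
    by apply/eqP/negPn/negP => /(denom_sdominant sx)/eqP; rewrite (negPf xr).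
  exact: subrr.
Qed.

Lemma intweight_bounded (b : E -> R) :
  finite_set [set x | intweight x /\ forall a, a \in base -> `|pairing B x a| <= b a].
Proof.
pose n := (Num.truncn (\sum_(a <- base) `|b a|)).+1.
pose f (x : E) := [ffun i : 'I_(size base) =>
  inord (Num.truncn (pairing B x base`_i + n%:R)) : 'I_(n + n).+1].
have bn a : a \in base -> b a <= n%:R.
  move=> aB; apply: le_trans (ler_norm _) _.
  apply: (@le_trans _ _ (\sum_(a <- base) `|b a|)).
    by rewrite (big_rem a) //= lerDl sumr_ge0.
  exact/ltW/truncnS_gt.
have bound x a : intweight x -> `|pairing B x a| <= b a -> a \in base ->
    pairing B x a + n%:R \is a Num.nat /\ pairing B x a + n%:R <= (n + n)%:R.
  move=> ix + aB; move=> /le_trans/(_ (bn a aB)); rewrite ler_norml natrD => /andP[h3 h4].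
  split; last lra; rewrite natrEint rpredD ?natr_int ?ix ?base_Phi //=; lra.
apply: (@finite_inj_in _ _ _ f) => x y /= [ix xr] [iy yr] /ffunP fE.
apply: (@ip_eq_inj _ _ B) => z; rewrite (scoefE B z) !ip_sumr.
apply: eq_big_seq => a aB; rewrite !ipZr; congr (_ * _).
have ai : (index a base < size base)%N by rewrite index_mem.
have := fE (Ordinal ai); rewrite !ffunE /= nth_index // => /(congr1 val) /=.
have [nx xn] := bound x a ix (xr a aB) aB; have [ny yn] := bound y a iy (yr a aB) aB.
rewrite !inordK ?ltnS -?(ler_nat R) ?truncnK // => h.
have a0 := base_neq0 aB.
rewrite (pairing_half B x a0) (pairing_half B y a0); congr (_ * _ / _).
by apply: (@addIr _ n%:R); rewrite -(truncnK nx) h truncnK.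
Qed.

(** Expanding |x + a|^2 >= 0 and |x - a|^2 >= 0 bounds 2|(x|a)| by r + (a|a). *)
Lemma intweight_ball r : finite_set [set x | intweight x /\ '[x, x] <= r].
Proof.
apply: sub_finite_set (intweight_bounded (fun a => (r + '[a, a]) / '[a, a])).
move=> x /= [ix xr]; split=> // a aB; have a0 := base_neq0 aB.
have aa := ip_gt0 B a0; have h1 := ip_ge0 B (x + a); have h2 := ip_ge0 B (x - a).
rewrite !ipE (ipC B a x) in h1 h2.
rewrite ler_norml /pairing lerNl -mulNr !ler_pM2r ?invr_gt0 //.
by apply/andP; split; lra.
Qed.

Lemma level_finite : finite_set level_wt.
Proof.
apply: sub_finite_set (intweight_bounded (fun a => (2 * k%:R) / '[a, a])).
move=> x /= [ix dx xk]; split=> // a aB; have a0 := base_neq0 aB.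
have aa := ip_gt0 B a0; rewrite ger0_norm ?dx // /pairing ler_pM2r ?invr_gt0 //.
have := dominant_cone dx (theta_high (base_Phi aB)); rewrite ipBr => ?; lra.
Qed.

(* For a minuscule weight c, adding a weight of V_c to a dominant weight moves it at
   most onto the walls of the rho-shifted chamber. *)
Lemma num_mul_minuscule l c (r : seq E) : intweight l -> dominant l ->
  uniq r -> (forall x, (mult c x != 0) = (x \in r)) ->
  (forall a x, a \in base -> mult c (srefl a x) = mult c x) ->
  (forall nu, nu \in r -> intweight nu /\
     forall a, a \in Phi -> `|pairing B nu a| <= 1) ->
  forall x, \sum_(nu <- r) mult c nu * J l (x - nu) =
    \sum_(nu <- r | `[< dominant (l + nu) >]) mult c nu * J (l + nu) x.
Proof.
move=> il dl ur rP inv rint x; apply/eqP; rewrite -subr_eq0; apply/eqP; move: x.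
have lm := multP il dl.
have int_nu nu : nu \in r -> intweight (l + nu).
  by move=> /rint[inu _]; apply: intweightD.
have fsJ nu : nu \in r -> fin_supp (J l) -> fin_supp (fun x => mult c nu * J l (x - nu)).
  by move=> _ fs; apply: fin_suppZ; apply: fin_supp_shift.
apply: (antisymmetric_eq0 (B := B)).
- move=> a x aB; have aK := sreflK B (base_neq0 aB).
  have pr : perm_eq [seq srefl a nu | nu <- r] r.
    apply: uniq_perm => // [|nu]; first by rewrite map_inj_uniq //; apply: can_inj aK.
    apply/mapP/idP => [[mu mur ->]|nur]; first by rewrite -rP inv // rP.
    by exists (srefl a nu); rewrite ?aK // -rP inv // rP.
  have -> : \sum_(nu <- r) mult c nu * J l (srefl a x - nu) =
      - \sum_(nu <- r) mult c nu * J l (x - nu).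
    rewrite -(perm_big _ pr) big_map -sumrN; apply: eq_bigr => nu _.
    by rewrite -sreflB inv // (antisymmetric_num lm) // mulrN.
  have -> : \sum_(nu <- r | `[< dominant (l + nu) >])
        mult c nu * J (l + nu) (srefl a x) =
      - \sum_(nu <- r | `[< dominant (l + nu) >]) mult c nu * J (l + nu) x; last first.
    by rewrite opprK opprB addrC.
  rewrite -sumrN big_seq_cond [RHS]big_seq_cond.
  apply: eq_bigr => nu /andP[nur /asboolP dnu].
  by rewrite (antisymmetric_num (multP (int_nu _ nur) dnu)) // mulrN.
- rewrite (_ : (fun x => _) = fun x => \sum_(nu <- r) mult c nu * J l (x - nu) +
     (-1) * \sum_(nu <- r | `[< dominant (l + nu) >]) mult c nu * J (l + nu) x).
    apply: fin_suppD; first apply: fin_supp_sum => nu nur _.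
      by apply: fin_suppZ; apply: fin_supp_shift; apply: fin_supp_num lm.
    apply: fin_suppZ; apply: fin_supp_sum => nu nur /asboolP dnu.
    by apply: fin_suppZ; apply: fin_supp_num (multP (int_nu _ nur) dnu).
  by apply/funext => x; rewrite mulN1r.
- move=> x sx; apply/eqP; rewrite subr_eq0 [X in _ == X]big_mkcond /=; apply/eqP.
  apply: eq_big_seq => nu nur; have [inu nu1] := rint nu nur.
  have sx' : l + nu + rho = x -> dominant (l + nu).
    by move=> xE; rewrite -[l + nu](addrK rho) xE; apply: sdominantB_rho => //;
      rewrite -xE; apply: intweightD; [apply: int_nu|apply: intweight_rho].
  have [h|h] := eqVneq (J l (x - nu)) 0.
    rewrite h mulr0; case: asboolP => // dnu.
    have [->|h'] := eqVneq (J (l + nu) x) 0; first by rewrite mulr0.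
    have xE := num_sdominant (int_nu _ nur) dnu sx h'.
    move: h; rewrite xE addrAC addrK (num_top lm) => /eqP.
    by rewrite oner_eq0.
  have ix : intweight x.
    rewrite -(subrK nu x); apply: intweightD => //.
    apply: (intweight_below _ (below_num lm) h).
    by apply: intweightD => //; apply: intweight_rho.
  (* Pairing with a simple coroot gives a positive integer for x and at most 1 for nu, so x - nu may
     reach a wall but not cross it. *)
  have dx : dominant (x - nu).
    move=> a aB; have := sx a aB; have /intrP[n nE] := ix a (base_Phi aB).
    have := nu1 a (base_Phi aB); rewrite ler_norml pairingBl nE ltr0z => /andP[_ h1] n0.
    have : (1 <= n)%R by lia.
    by rewrite -(ler1z R) => ?; lra.
  have xE : x - nu = l + rho by apply: num_dominant dx h.
  have xE' : l + nu + rho = x by rewrite addrAC -xE subrK.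
  have dnu := sx' xE'; case: asboolP => // _.
  rewrite xE (num_top lm) -[in RHS]xE' (num_top (multP (int_nu _ nur) dnu)) //.
Qed.

Lemma fchar_minuscule l c s : level_wt l -> level_wt c -> level_wt s ->
  (forall nu, mult c nu != 0 -> intweight nu /\
     forall a, a \in Phi -> `|pairing B nu a| <= 1) ->
  fchar c s * fchar l s =
    \sum_(b \in level_wt) (mult c (b - l))%:C * fchar b s.
Proof.
move=> [il dl lk] [ic dc _] ls min; have lm := multP il dl.
have [fsc invc _ _ _] := multP ic dc; have [r ur rP] := fin_supp_uniq fsc.
have rint nu : nu \in r -> intweight nu /\
    forall a, a \in Phi -> `|pairing B nu a| <= 1 by rewrite -rP => /min.
have int_nu nu : nu \in r -> intweight (l + nu).
  by move=> /rint[inu _]; apply: intweightD.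
apply: (mulIf (wave_denom_neq0 ls)); rewrite -mulrA fchar_denom // [in RHS]mulr_fsuml.
transitivity (\sum_(nu <- r | `[< dominant (l + nu) >])
    (mult c nu)%:C * ev (J (l + nu)) (wave (s + rho))).
  transitivity (ev (fun x => \sum_(nu <- r) mult c nu * J l (x - nu)) (wave (s + rho))).
    rewrite ev_sum; last first.
      by move=> nu _ _; apply: fin_suppZ; apply: fin_supp_shift; apply: fin_supp_num lm.
    rewrite /fchar (@evE _ _ r (mult c)) //; last by move=> x; rewrite rP.
    rewrite mulr_suml; apply: eq_bigr => nu _.
    by rewrite evZ (ev_shiftM (waveD _)) ?mulrA //; apply: fin_supp_num lm.
  rewrite (_ : (fun x => _) = fun x => \sum_(nu <- r | `[< dominant (l + nu) >])
     mult c nu * J (l + nu) x); last first.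
    by apply/funext; apply: num_mul_minuscule.
  rewrite ev_sum; first by apply: eq_bigr => nu _; rewrite evZ.
  move=> nu nur /asboolP dnu; apply: fin_suppZ.
  exact: fin_supp_num (multP (int_nu _ nur) dnu).
rewrite (@fsbigE _ _ _ _ _ [seq l + nu | nu <- r & `[< level_wt (l + nu) >]]).
- rewrite big_map big_filter_cond big_mkcond [RHS]big_mkcond.
  apply: eq_big_seq => nu nur /=; have [inu nu1] := rint nu nur.
  rewrite (_ : l + nu - l = nu); last by rewrite addrC addKr.
  have -> : (l + nu \in level_wt) = `[< level_wt (l + nu) >].
    by apply/idP/asboolP; rewrite inE.
  rewrite andbb; case: asboolP => dnu; last by case: asboolP => // -[].
  case: asboolP => lnu; first by rewrite -mulrA (fchar_denom _ (int_nu _ nur) dnu).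
  suff -> : ev (J (l + nu)) (wave (s + rho)) = 0 by rewrite mulr0.
  apply: num_wall => //; first exact: int_nu.
  (* Here (l + nu|theta) is an integer greater than k, and at most k + 1 since (l|theta) <= k and
     (nu|theta) <= 1; so l + nu + rho is on the affine wall. *)
  have := nu1 _ theta_root; rewrite pairing_theta ler_norml => /andP[_ h1].
  have h2 : ~ '[l + nu, theta] <= k%:R by move=> h; apply: lnu; split; [exact: int_nu| |].
  have /intrP[n nE] : '[l + nu, theta] \is a Num.int.
    by rewrite -pairing_theta; apply: int_nu.
  move/negP: h2; rewrite -ltNge nE -[k%:R]/(k%:Z%:~R) ltr_int => kn.
  have : '[l + nu, theta] <= (k%:Z + 1)%:~R by rewrite intrD ipDl; lra.
  rewrite nE ler_int => nk; rewrite ipDl nE /level_M; congr (_ + _).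
  by rewrite (_ : n = k%:Z + 1) ?intrD //; lia.
- by rewrite map_inj_uniq ?filter_uniq //; apply: addrI.
- by move=> x /= /mapP[nu]; rewrite mem_filter => /andP[/asboolP lnu _ ->].
- move=> b lb; apply: contraNeq => h; apply/mapP; exists (b - l); rewrite ?subrKC //.
  rewrite mem_filter subrKC -rP; apply/andP; split; first exact/asboolP.
  by apply: contra_neq h => ->; rewrite !mul0r.
Qed.

(** Artin's independence of characters. Several points may define the same character of the weight
    lattice, so only the sum of the coefficients over a class is determined. Each step removes one j
    outside the class of [mu] by combining two relations, which multiplies all coefficients of the
    class by the same nonzero constant. *)
Lemma wave_independent (I : eqType) (L : seq I) (c : I -> C) (pt : I -> E) mu :
  (forall kap, intweight kap -> \sum_(i <- L) c i * wave kap (pt i) = 0) ->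
  \sum_(i <- L | `[< forall kap, intweight kap -> wave kap (pt i) = wave kap mu >]) c i = 0.
Proof.
pose eqv i := `[< forall kap, intweight kap -> wave kap (pt i) = wave kap mu >].
move: c; have [n] := ubnP (count (predC eqv) L); elim: n L => // n IH L Ln c h.
have [hL|] := boolP (has (predC eqv) L); last first.
  move=> /hasPn hL; rewrite -[RHS](h 0 (@intweight0 _ _ B)).
  rewrite big_seq_cond [RHS]big_seq; apply: eq_big => [i|i _].
    by case iL : (i \in L) => //=; apply/negbNE/hL.
  by rewrite waveC wave0 mulr1.
case/hasP: hL => j jL nj.
have [kap1 [ik1 nk]] : exists kap, intweight kap /\ wave kap (pt j) <> wave kap mu.
  move/negP: nj => nj; apply: contrapT => h'; apply: nj; apply/asboolP => kap ik.
  by apply: contrapT => nk; apply: h'; exists kap.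
have pr := perm_to_rem jL.
have := IH (rem j L) _ (fun i => c i * (wave kap1 (pt i) - wave kap1 (pt j))).
have -> : (count (predC eqv) (rem j L) < n)%N.
  have c0 : (0 < count (predC eqv) L)%N by rewrite -has_count; apply/hasP; exists j.
  by rewrite count_rem jL nj; lia.
move=> /(_ isT) H; have {}H : \sum_(i <- rem j L | eqv i)
    c i * (wave kap1 (pt i) - wave kap1 (pt j)) = 0.
  apply: H => kap ik; have := h (kap + kap1) (intweightD ik ik1).
  have := h kap ik; rewrite !(perm_big _ pr) /= !big_cons => h1 h2.
  transitivity ((c j * wave (kap + kap1) (pt j) +
      \sum_(i <- rem j L) c i * wave (kap + kap1) (pt i)) -
    wave kap1 (pt j) * (c j * wave kap (pt j) +
      \sum_(i <- rem j L) c i * wave kap (pt i))); last by rewrite h1 h2 mulr0 subrr.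
  rewrite mulrDr opprD addrACA.
  rewrite (_ : c j * wave (kap + kap1) (pt j) - _ = 0); last first.
    by rewrite !(waveC _ (pt j)) waveD; ring.
  rewrite add0r mulr_sumr -sumrB; apply: eq_bigr => i _.
  by rewrite (waveC (kap + kap1)) waveD !(waveC (pt i)); ring.
rewrite (perm_big _ pr) /= big_cons.
have -> : `[< forall kap, intweight kap -> wave kap (pt j) = wave kap mu >] = false.
  exact/negbTE.
have d0 : wave kap1 mu - wave kap1 (pt j) != 0.
  by rewrite subr_eq0; apply/eqP => /esym.
apply: (mulIf d0); rewrite mul0r -[RHS]H mulr_suml.
by apply: eq_bigr => i /asboolP /(_ _ ik1) ->.
Qed.

(** * The coroot lattice and the linear independence of the discretized characters *)

Definition corootv (a : E) : E := (2 / '[a, a]) *: a.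

Lemma ip_corootv x a : '[x, corootv a] = pairing B x a.
Proof. by rewrite /corootv ipZr /pairing; ring. Qed.

Lemma srefl_corootv a x : srefl a x = x - '[x, a] *: corootv a.
Proof. by rewrite sreflE /corootv scalerA; congr (_ - _ *: _); rewrite /pairing; ring. Qed.

Lemma corootv_srefl b c : b \in Phi -> corootv (srefl b c) = corootv c - pairing B b c *: corootv b.
Proof.
move=> rb; have b0 := root_neq0 rb.
by rewrite {1}/corootv srefl_ip // -sreflZ -/(corootv c) srefl_corootv ipC ip_corootv.
Qed.

Lemma corootvN a : corootv (- a) = - corootv a.
Proof. by rewrite /corootv !ipE opprK scalerN. Qed.

(** Both pairings are negative integers. If one is -1, the sum is the coroot of a reflected root; if
    both are at most -2, then |b + c|^2 <= 0, so c = -b. *)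
Lemma corootv_merge b c : b \in Phi -> c \in Phi -> '[b, c] < 0 ->
  corootv b + corootv c = 0 \/ exists2 d, d \in Phi & corootv b + corootv c = corootv d.
Proof.
move=> rb rc bc; have b0 := root_neq0 rb; have c0 := root_neq0 rc.
have bb := root_ip_gt0 rb; have cc := root_ip_gt0 rc.
have /intrP[m mE] := pairing_root_int rc rb; have /intrP[n nE] := pairing_root_int rb rc.
have m0 : (m < 0)%R by rewrite -(ltrz0 R) -mE pairing_lt0.
have n0 : (n < 0)%R by rewrite -(ltrz0 R) -nE pairing_lt0 // ipC.
have [m1|m1] := eqVneq m (-1).
  right; exists (srefl b c); first exact: srefl_root.
  by rewrite corootv_srefl // mE m1 mulrNz scaleN1r opprK addrC.
have [n1|n1] := eqVneq n (-1).
  right; exists (srefl c b); first exact: srefl_root.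
  by rewrite corootv_srefl // nE n1 mulrNz scaleN1r opprK.
left; suff /eqP : b + c = 0 by rewrite addr_eq0 => /eqP->; rewrite corootvN addNr.
have m2 : pairing B b c <= -2 by rewrite mE -[-2]/((-2)%:~R) ler_int; lia.
have n2 : pairing B c b <= -2 by rewrite nE -[-2]/((-2)%:~R) ler_int; lia.
apply: (@ip_le0_eq0 _ _ B); rewrite !ipE (ipC B c b).
move: m2 n2; rewrite /pairing !ler_pdivrMr // (ipC B c b) => ? ?; lra.
Qed.

(** If the first root b pairs nonnegatively with all the others, its own coroot contributes 2 and
    the bound 1 fails. Otherwise b merges with some c by [corootv_merge], and the list gets
    shorter. *)
Lemma corootv_sum_eq0 (t : seq E) : {subset t <= Phi} ->
  (forall a, a \in Phi -> '[a, \sum_(b <- t) corootv b] <= 1) ->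
  \sum_(b <- t) corootv b = 0.
Proof.
have [n] := ubnP (size t); elim: n t => // n IH [|b t] tn sub h.
  by rewrite big_nil.
have rb : b \in Phi by apply/sub/mem_head.
have subt : {subset t <= Phi} by move=> c ct; apply: sub; rewrite in_cons ct orbT.
have [/allP hall|/allPn[c ct bc]] := boolP (all (fun c => 0 <= '[b, c]) t).
  have {h} := h b rb; rewrite big_cons ipDr ip_corootv.
  rewrite (pairing_id _ (root_neq0 rb)) ip_sumr.
  have : 0 <= \sum_(c <- t) '[b, corootv c].
    rewrite big_seq; apply: sumr_ge0 => c ct.
    by rewrite ip_corootv pairing_ge0 ?hall // (root_neq0 (subt _ ct)).
  by move=> ? ?; exfalso; lra.
rewrite -ltNge in bc.
have pr := perm_to_rem ct.
have subr : {subset rem c t <= Phi} by move=> d /mem_rem/subt.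
have sz : (size (rem c t) < n)%N by have := perm_size pr; rewrite /= in tn * => e; lia.
have sz' : ((size (rem c t)).+1 < n)%N by have := perm_size pr; rewrite /= in tn * => e; lia.
move: h; rewrite !big_cons (perm_big _ pr) /= big_cons addrA.
have [->|[d rd ->]] := corootv_merge rb (subt _ ct) bc.
  by rewrite !add0r; apply: IH.
have -> : corootv d + \sum_(j <- rem c t) corootv j = \sum_(j <- d :: rem c t) corootv j.
  by rewrite big_cons.
apply: IH => // e.
by rewrite in_cons => /predU1P[->|/subr].
Qed.

(** The Gram matrix of the base is invertible because the form is positive definite. The fundamental
    weights of [corootv_span] come from here. *)
Lemma ip_represent (v : E -> R) : exists om, forall a, a \in base -> '[om, a] = v a.
Proof.
pose n := size base; pose b (i : 'I_n) := base`_i.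
pose G : 'M[R]_n := \matrix_(i, j) '[b i, b j].
have bB i : b i \in base by apply: mem_nth.
have Gu : G \in unitmx.
  rewrite -row_free_unit -kermx_eq0; apply/negPn/negP => /rowV0Pn[u /sub_kermxP uG].
  move=> /eqP; apply; apply/rowP => i; rewrite mxE.
  have x0 : \sum_j u 0 j *: b j = 0.
    apply: (@ip_le0_eq0 _ _ B); rewrite {2}[\sum_j _]big_mkcond ip_sumr big1 // => j _ /=.
    rewrite ipZr ip_suml; have /rowP/(_ j) := uG; rewrite !mxE => e.
    rewrite (_ : \sum_j _ = 0) ?mulr0 // -[RHS]e; apply: eq_bigr => l _.
    by rewrite mxE ipZl.
  have /freeP := basis_free (base_basis B : basis_of fullv (in_tuple base)).
  by move=> /(_ (fun i => u 0 i) x0 i).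
pose u := (\row_j v (b j)) *m invmx G.
exists (\sum_i u 0 i *: b i) => a aB.
have ai : (index a base < n)%N by rewrite index_mem.
have aE : a = b (Ordinal ai) by rewrite /b nth_index.
rewrite {1}aE ip_suml; have : u *m G = \row_j v (b j) by rewrite /u mulmxKV.
move=> /rowP/(_ (Ordinal ai)); rewrite !mxE -aE => <-.
by apply: eq_bigr => i _; rewrite ipZl [G _ _]mxE -aE.
Qed.

(** The coroot lattice is dual to the weight lattice: pairing [q] with the fundamental weights
    yields its coefficients on the simple coroots. Negative coefficients are absorbed by using
    opposite roots. *)
Lemma corootv_span q : (forall kap, intweight kap -> '[q, kap] \is a Num.int) ->
  exists2 t : seq E, {subset t <= Phi} & q = \sum_(a <- t) corootv a.
Proof.
move=> hq; pose d a := scoef B q a * '[a, a] / 2.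
have dint a : a \in base -> d a \is a Num.int.
  move=> aB; have [om omE] := ip_represent (fun s => (s == a)%:R * '[a, a] / 2).
  have iom : intweight om.
    apply: intweight_base => s sB; rewrite /pairing omE //.
    case: (s =P a) => [->|_]; last by rewrite !mul0r mulr0 mul0r.
    rewrite mul1r (_ : 2 * ('[a, a] / 2) / '[a, a] = 1) ?rpred1 //; field.
    by rewrite gt_eqF // ip_gt0 // (base_neq0 aB).
  have := hq om iom; rewrite {1}(scoefE B q) ip_suml (bigD1_seq a) ?base_uniq //=.
  rewrite big1_seq => [|s /andP[sa sB]]; last first.
    by rewrite ipZl ipC omE // (negPf sa) !mul0r mulr0.
  by rewrite addr0 ipZl ipC omE // eqxx mul1r mulrA.
have qE : q = \sum_(a <- base) d a *: corootv a.
  rewrite [LHS](scoefE B q); apply: eq_big_seq => a aB.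
  rewrite /corootv scalerA /d; congr (_ *: _); field.
  by rewrite gt_eqF // ip_gt0 // (base_neq0 aB).
rewrite {}qE; have : {subset base <= Phi} by move=> a; apply: base_Phi.
elim: base dint => [|a s IH] dint sub; first by exists [::]; rewrite ?big_nil.
have [||t tsub tE] := IH.
- by move=> c cs; apply: dint; rewrite in_cons cs orbT.
- by move=> c cs; apply: sub; rewrite in_cons cs orbT.
have ra : a \in Phi by apply/sub/mem_head.
have /intrP[m mE] := dint a (mem_head _ _).
have sum_nseq n c : \sum_(b <- nseq n c) corootv b = corootv c *+ n.
  by elim: n => [|n IHn]; rewrite /= ?big_nil ?big_cons ?IHn ?mulrS.
rewrite big_cons tE mE scaler_int; case: m {mE} => m.
  exists (nseq m a ++ t).
    by move=> c; rewrite mem_cat => /orP[/nseqP[-> _]//|/tsub].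
  by rewrite big_cat /= sum_nseq.
exists (nseq m.+1 (- a) ++ t).
  by move=> c; rewrite mem_cat => /orP[/nseqP[-> _]|/tsub//]; apply: root_opp.
by rewrite big_cat sum_nseq /= corootvN mulNrn.
Qed.

(* F is antisymmetric under the affine Weyl group of level M: the point of its support
   nearest to rho lies inside the alcove. *)
Lemma affine_antisymmetric_eq0 (F : E -> C) :
  (forall a x, a \in base -> F (srefl a x) = - F x) ->
  (forall x, intweight x -> F (srefl theta x + M *: theta) = - F x) ->
  (forall s, level_wt s -> F (s + rho) = 0) ->
  forall x, intweight x -> F x = 0.
Proof.
have C0 (z : C) : z = - z -> z = 0.
  by move=> /eqP; rewrite -addr_eq0 -mulr2n mulrn_eq0 => /eqP.
move=> Fb Fth Fl x ix; apply/eqP/negPn/negP => x0.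
pose d y := '[y - rho, y - rho].
have irho := @intweight_rho _ _ B.
(* Only finitely many weights are no farther from rho than x, so the support has a point nearest to
   rho among them. *)
have /finite_seqP[s sE] : finite_set [set y | intweight y /\ d y <= d x].
  pose A := [set y | intweight y /\ '[y, y] <= d x].
  apply: (@sub_finite_set _ _ ((fun y => y + rho) @` A)).
    move=> y [iy yx]; exists (y - rho); rewrite ?subrK //; split=> //.
    exact: intweightB.
  exact/finite_image/intweight_ball.
have sP y : (y \in s) <-> intweight y /\ d y <= d x.
  by have -> : (y \in s) = [set` s] y :> Prop by []; rewrite -sE.
clear sE; have xs : x \in [seq y <- s | F y != 0] by rewrite mem_filter x0; apply/sP.
have [y] := seq_argmax (fun y => - d y) xs.
rewrite mem_filter => /andP[y0 /sP[iy yx]] ymin.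
have closer z : intweight z -> F z = - F y -> d y <= d z.
  move=> iz Fz; rewrite leNgt; apply/negP => zy.
  have : z \in [seq y <- s | F y != 0].
    rewrite mem_filter Fz oppr_eq0 y0; apply/sP; split=> //.
    exact: ltW (lt_le_trans zy yx).
  by move=> /ymin; rewrite lerN2 leNgt zy.
have sy : sdominant B y.
  move=> a aB; have a0 := base_neq0 aB; rewrite ltNge; apply/negP; rewrite le_eqVlt.
  move=> /predU1P[ya|ya].
    move/eqP: y0; apply; apply: C0; rewrite -(Fb _ _ aB).
    by rewrite sreflE ya scale0r subr0.
  have := closer _ (intweight_srefl (base_Phi aB) iy) (Fb _ _ aB).
  rewrite /d; have nsy := srefl_ip B y y a0.
  have pr := pairing_rho aB; have : 0 < '[a, rho].
    by rewrite ipC -pairing_gt0 // pr.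
  have zr : '[srefl a y, rho] = '[y, rho] - pairing B y a * '[a, rho].
    by rewrite ipBl ipZl.
  move: (srefl a y) nsy zr => z nsy zr.
  rewrite !ipBl !ipBr nsy (ipC B rho z) (ipC B rho y) zr => ar.
  have : pairing B y a * '[a, rho] < 0 by rewrite nmulr_rlt0.
  by move: ar; lra.
(* Since M - (rho|theta) = k + 1 > 0, rho is strictly below the affine wall; reflecting a point
   above the wall brings it closer to rho. *)
have yth : '[y, theta] < M.
  have th0 := root_neq0 theta_root.
  have Fy := Fth y iy; have sE' : srefl theta y = y - '[y, theta] *: theta.
    by rewrite sreflE pairing_theta.
  rewrite ltNge; apply/negP; rewrite le_eqVlt => /predU1P[yM|yM].
    by move/eqP: y0; apply; apply: C0; rewrite -Fy sE' -yM subrK.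
  have iz : intweight (srefl theta y + M *: theta).
    apply: intweightD; first exact: intweight_srefl.
    by apply: intweightZ; [exact: M_int|exact: intweight_root].
  have := closer _ iz Fy; rewrite sE' /d.
  have := rho_theta_ge0; set z := '[y, theta] in yM *.
  rewrite (_ : _ - _ + _ - rho = (y - rho) - (z - M) *: theta); last first.
    by rewrite scalerBl opprB (addrC (M *: theta)) addrA (addrAC _ (M *: theta)) (addrAC y).
  move: M_gt0 => m0 r0; rewrite [X in _ <= X](_ : _ = '[y - rho, y - rho] -
     2 * (z - M) * (M - '[rho, theta])); last first.
    rewrite -[y - rho]/(y - rho) !ipBl !ipBr !ipZl !ipZr.
    rewrite !(ipC B theta) -/z theta_norm; ring.
  have : 0 < (z - M) * (M - '[rho, theta]).
    by rewrite mulr_gt0 ?subr_gt0 // /level_M ltrDr -(natrD _ k 1) ltr0n addn1.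
  by lra.
move/eqP: y0; apply; rewrite -(subrK rho y); apply: Fl; split.
- exact: intweightB.
- exact: sdominantB_rho.
- have /intrP[n nE] : '[y - rho, theta] \is a Num.int.
    by rewrite -pairing_theta; apply: intweightB.
  have : n%:~R < (k%:Z + 1)%:~R :> R.
    by rewrite -nE intrD ipBl; move: yth; rewrite /level_M => ?; lra.
  by rewrite nE ltr_int -[k%:R]/(k%:Z%:~R) ler_int; lia.
Qed.

(** The difference of w(b + rho) and l + rho, divided by M, is in the coroot lattice. A positive
    root takes on it an integer value strictly between -2 and 1, so every root is at most 1 on it
    and [corootv_sum_eq0] applies. Then w(b + rho) = l + rho is a strictly dominant point in the
    support of the numerator of b, which has only one. *)
Lemma alcove_coincidence l b w : level_wt l -> level_wt b -> simple_weyl B w ->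
  (forall kap, intweight kap -> wave kap (w (b + rho)) = wave kap (l + rho)) ->
  b = l /\ eps w = 1.
Proof.
move=> ll lb hw h; have m0 := M_gt0.
have sdl := level_sdominant ll; have sdb := level_sdominant lb.
pose q := M^-1 *: (w (b + rho) - (l + rho)).
have qint kap : intweight kap -> '[q, kap] \is a Num.int.
  move=> /h; rewrite /wave => e.
  have : expi (2 * pi * '[q, kap]) = 1.
    apply: (mulIf (expi_neq0 (2 * pi * - (M^-1 * '[w (b + rho), kap])))).
    rewrite mul1r [in RHS]e -expiD -mulrDr; congr (expi (_ * _)).
    by rewrite /q ipZl ipBl; ring.
  exact: expi_eq1.
have bnd (s a : E) : level_wt s -> a \in Phi -> `|'[a, s + rho]| < M.
  move=> ls ra; rewrite ltr_norml; have [aP|aP] := root_sign ra.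
    by have /andP[h1 ->] := level_root_bound ls aP; rewrite andbT; lra.
  by have /andP[] := level_root_bound ls aP; rewrite ipNl => h1 h2; apply/andP; split; lra.
have posq a : a \in posroots B -> -1 <= '[a, q] <= 0.
  move=> aP; case/posrootsP: (aP) => ra _.
  have /intrP[n nE] : '[a, q] \is a Num.int by rewrite ipC qint //; apply: intweight_root.
  have [v [hv wv vw]] := simple_weyl_inv hw.
  have : `|'[a, w (b + rho)]| < M.
    rewrite -(vw a) simple_weyl_ip //; apply: bnd => //; exact: simple_weyl_root.
  rewrite ltr_norml => /andP[h1 h2]; have /andP[h3 h4] := level_root_bound ll aP.
  have qE : M * '[a, q] = '[a, w (b + rho)] - '[a, l + rho].
    by rewrite /q ipZr ipBr mulrA divff ?gt_eqF // mul1r.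
  have : (n < 1)%R by rewrite -(ltr_int R) -nE -(ltr_pM2l m0) qE; lra.
  have : (-2 < n)%R by rewrite -(ltr_int R) -nE -(ltr_pM2l m0) qE; lra.
  by rewrite nE -[-1]/((-1)%:~R) -[0]/(0%:~R) !ler_int => ? ?; lia.
have q0 : q = 0.
  have [t tsub tE] := corootv_span qint; rewrite tE; apply: corootv_sum_eq0 => // a ra.
  rewrite -tE; have [/posq/andP[_ h1]|/posq/andP[h1 _]] := root_sign ra; first lra.
  by move: h1; rewrite ipNl; lra.
have wb : w (b + rho) = l + rho.
  apply/eqP; rewrite -subr_eq0; move/eqP: q0.
  by rewrite /q scaler_eq0 invr_eq0 (gt_eqF m0).
case: lb => ib db _; have bm := multP ib db.
have Jw := antisymmetric_weyl (b + rho) (antisymmetric_num bm) hw.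
rewrite (num_top bm) mulr1 wb in Jw.
have J0 : J b (l + rho) != 0.
  by rewrite Jw; case: (weyl_sign_pm hw) => ->; rewrite ?oppr_eq0 oner_neq0.
have lE := num_sdominant ib db sdl J0.
split; first by apply: (addIr rho); rewrite lE.
by rewrite -Jw lE (num_top bm).
Qed.

(** Multiplied by the denominator, the relation says that a combination [F] of waves vanishes at s +
    rho. As a function of [kap], [F] is antisymmetric under the affine Weyl group, hence zero on the
    whole weight lattice, and [wave_independent] isolates the class of b + rho. *)
Lemma fchar_independent (c : E -> C) :
  (forall s, level_wt s -> \sum_(b \in level_wt) c b * fchar b s = 0) ->
  forall b, level_wt b -> c b = 0.
Proof.
move=> h; have /finite_seqP[r0 r0E] := level_finite.
pose r := undup r0; have ur : uniq r := undup_uniq r0.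
have rP b : (b \in r) <-> level_wt b by rewrite mem_undup r0E.
have sumr (f : E -> C) : \sum_(b \in level_wt) f b = \sum_(b <- r) f b.
  rewrite (_ : level_wt = [set` r]) -?fsbig_seq //.
  by apply/seteqP; split=> b /= /rP.
pose L := [seq (b, w) | b <- r, w <- weyl_seq B].
pose cc (p : E * (E -> E)) : C :=
  c p.1 / (stab_card B (p.1 + rho))%:R * (eps p.2)%:C.
pose pt (p : E * (E -> E)) := p.2 (p.1 + rho).
pose F kap := \sum_(p <- L) cc p * wave kap (pt p).
have FE kap : F kap = \sum_(b <- r) c b / (stab_card B (b + rho))%:R *
    \sum_(w <- weyl_seq B) (eps w)%:C * wave kap (w (b + rho)).
  rewrite /F big_allpairs; apply: eq_bigr => b _; rewrite mulr_sumr.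
  by apply: eq_bigr => w _; rewrite /cc /pt /= mulrA.
have F0 kap : intweight kap -> F kap = 0.
  move: kap; apply: affine_antisymmetric_eq0.
  - move=> a x aB; have ha := simple_weyl_base aB.
    rewrite !FE -sumrN; apply: eq_bigr => b _; rewrite -mulrN; congr (_ * _).
    rewrite -(perm_big _ (perm_weyl_seql ha)) big_map -sumrN; apply: eq_bigr => w _.
    rewrite weyl_sign_srefl // rmorphN mulNr; congr (- (_ * _)).
    by rewrite /wave /= srefl_ip // (base_neq0 aB).
  - move=> x ix; have ht := simple_weyl_srefl theta_root.
    rewrite !FE -sumrN big_seq [RHS]big_seq; apply: eq_bigr => b /rP lb.
    rewrite -mulrN; congr (_ * _).
    rewrite -(perm_big _ (perm_weyl_seql ht)) big_map -sumrN.
    apply: eq_big_seq => w /weyl_seqP hw.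
    rewrite weyl_sign_comp // weyl_sign_refl // mulN1r rmorphN mulNr; congr (- (_ * _)).
    have ib : intweight (b + rho).
      by case: lb => ib _ _; apply: intweightD => //; apply: intweight_rho.
    set z := srefl theta (w (b + rho)); have iz : intweight z.
      by apply: intweight_srefl => //; apply: simple_weyl_intweight.
    (* Translating by M theta multiplies the wave at z by exp(-2 i pi (theta|z)), and (theta|z) is
       an integer. *)
    have e1 : wave z (M *: theta) = 1.
      rewrite /wave ipZl mulrA mulVf ?(gt_eqF M_gt0) // mul1r expi_int //.
      by rewrite rpredN ipC -pairing_theta iz.
    rewrite /= -/z waveC waveD e1 mulr1 waveC /wave /z.
    by rewrite srefl_ip ?(root_neq0 theta_root).
  - move=> s ls; rewrite FE.
    transitivity (\sum_(b <- r) c b * fchar b s * ev wd (wave (s + rho))).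
      apply: eq_big_seq => b /rP[ib db _]; rewrite -[RHS]mulrA fchar_denom //.
      by rewrite num_alternating // mulrA mulfVK ?stab_card_neq0.
    by rewrite -mulr_suml -sumr h // mul0r.
move=> b lb; have := wave_independent (b + rho) F0.
pose X p := `[< forall kap, intweight kap -> wave kap (pt p) = wave kap (b + rho) >].
rewrite big_seq_cond big_mkcond /= => H.
pose d := (stab_card B (b + rho))%:R : C.
(* By [alcove_coincidence] all terms in the class of b + rho have coefficient [c b / d]; their
   number is not zero because (b, id) is one of them. *)
suff : (count (fun p => (p \in L) && X p) L)%:R * (c b / d) = 0.
  move=> /eqP; rewrite !mulf_eq0 invr_eq0 (negPf (stab_card_neq0 _)) orbF.
  rewrite pnatr_eq0 -[_ == 0%N]negbK -lt0n -has_count => /orP[/hasPn h0|/eqP//].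
  have bL : (b, id) \in L.
    apply/allpairsP; exists (b, id); split=> //=; first exact/rP.
    exact/weyl_seqP/simple_weyl1.
  by have := h0 _ bL; rewrite bL /= => /asboolP[].
rewrite -[RHS]H -sum1_count natr_sum mulr_suml big_mkcond /=.
apply: eq_bigr => p _; case: ifP => // /andP[/allpairsP[[b' w] [/= /rP lb' /weyl_seqP hw ->]]].
move=> /asboolP h'; have [bE e1] := alcove_coincidence lb lb' hw h'.
by rewrite /cc /= bE e1 mulr1 mul1r.
Qed.

End Level.

(** * Complexified Lie algebras *)

Section EigenDecomposition.
Variables (R : realType) (W : vectType R[i]).
Local Notation C := R[i].
Implicit Types (A : 'End(W)) (u v w : W) (cs : seq C).

Definition shifts A u cs : W := foldl (fun w c => A w - c *: w) u cs.

Lemma shifts_mx n (M : 'M[C]_n) : exists cs : seq C, forall u : 'rV_n,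
  foldl (fun (x : 'rV_n) c => x *m M - c *: x) u cs = 0.
Proof.
case: n M => [|n] M; first by exists [::] => u; apply: thinmx0.
have [cs csE] := closed_field_poly_normal (char_poly M).
have := Cayley_Hamilton M.
rewrite csE (monicP (char_poly_monic M)) scale1r => M0.
exists cs => u.
suff h s : forall u : 'rV_n.+1, u *m horner_mx M (\prod_(z <- s) ('X - z%:P)) =
    foldl (fun (x : 'rV_n.+1) c => x *m M - c *: x) u s by rewrite -h M0 mulmx0.
elim: s {u} => [|z s IH] u; first by rewrite big_nil rmorph1 mulmx1.
rewrite big_cons rmorphM rmorphB /= horner_mx_X horner_mx_C mulmxA IH.
by rewrite mulmxBr mul_mx_scalar.
Qed.

Import VectorInternalTheory.

Lemma shifts_eq0 A : exists cs, forall u, shifts A u cs = 0.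
Proof.
have [cs h] := shifts_mx (f2mx A); exists cs => u.
apply: v2r_inj; rewrite linear0 -[RHS](h (v2r u)) /shifts.
elim: cs u {h} => //= c cs IH u; rewrite {}IH; congr foldl.
by rewrite linearB linearZ /= unlock /= r2vK.
Qed.

Lemma shifts_eigen A u c cs : A u = c *: u ->
  shifts A u cs = (\prod_(z <- cs) (c - z)) *: u.
Proof.
rewrite /shifts; have [n] := ubnP (size cs); elim: n cs u => // n IH [|z cs] u.
  by rewrite big_nil scale1r.
rewrite ltnS /= => sz Au; rewrite big_cons Au -scalerBl IH //.
  by rewrite scalerA mulrC.
by rewrite linearZ /= Au !scalerA mulrC.
Qed.

Lemma eigenvalue_in A cs u c : (forall u, shifts A u cs = 0) ->
  A u = c *: u -> u != 0 -> c \in cs.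
Proof.
move=> h Au; have := shifts_eigen cs Au; rewrite h => /esym/eqP; rewrite scaler_eq0.
move=> /orP[|/eqP->]; last by rewrite eqxx.
rewrite prodf_seq_eq0 => /hasP[z zs /=]; rewrite subr_eq0 => /eqP -> _ //.
Qed.

(** The first hypothesis says that generalized eigenvectors are eigenvectors. The predicate [Q], an
    invariant subspace, is carried through the decomposition so that commuting operators can be
    diagonalized one after the other. *)
Lemma eigen_decomposition A (Q : W -> Prop) :
  (forall c u, A (A u - c *: u) = c *: (A u - c *: u) -> A u = c *: u) ->
  (forall c u v, Q u -> Q v -> Q (c *: u + v)) ->
  (forall u, Q u -> Q (A u)) ->
  forall u, Q u -> exists2 s : seq (C * W), u = \sum_(p <- s) p.2 &
    forall p, p \in s -> Q p.2 /\ A p.2 = p.1 *: p.2.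
Proof.
move=> ss QZ QA u Qu; have [cs h] := shifts_eq0 A.
have Q0 : Q 0 by rewrite -(addNr u) -scaleN1r; apply: QZ.
have QB c v w : Q v -> Q w -> Q (v - c *: w).
  by move=> Qv Qw; rewrite addrC -scaleNr; apply: QZ.
move: (h u); rewrite /shifts; elim: cs u Qu {h} => [|c cs IH] u Qu /=.
  by move=> ->; exists [::]; rewrite ?big_nil.
move=> /(IH _ (QB _ _ _ (QA _ Qu) Qu))[s sE sP].
(* [w] is chosen so that (A - c)w is the part of (A - c)u with eigenvalues other than c; then (A -
   c)(u - w) is in the c-eigenspace, and the first hypothesis puts u - w there too. *)
pose w := \sum_(p <- s | p.1 != c) (p.1 - c)^-1 *: p.2.
have wE : A w - c *: w = \sum_(p <- s | p.1 != c) p.2.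
  rewrite /w linear_sum scaler_sumr -sumrB big_seq_cond [RHS]big_seq_cond.
  apply: eq_bigr => p /andP[ps pc]; rewrite linearZ /= (sP _ ps).2 !scalerA -scalerBl.
  by rewrite (mulrC c) -mulrBr mulVf ?scale1r // subr_eq0.
have Qw : Q w.
  rewrite /w big_seq_cond; apply: (big_ind Q) => // [x y Qx Qy|p /andP[ps _]].
    by rewrite -[x]scale1r; apply: QZ.
  by rewrite -[_ *: _]addr0; apply: QZ => //; have [] := sP p ps.
exists ((c, u - w) :: [seq (p.1, (p.1 - c)^-1 *: p.2) | p <- s & p.1 != c]).
  by rewrite big_cons big_map big_filter /= subrK.
move=> p; rewrite in_cons => /predU1P[->|/mapP[q]]; last first.
  rewrite mem_filter => /andP[_ qs] ->; have [Qq Aq] := sP q qs; split=> /=.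
    by rewrite -[_ *: _]addr0; apply: QZ.
  by rewrite linearZ /= Aq !scalerA mulrC.
split=> /=; first by rewrite -[w]scale1r; apply: QB.
apply: ss; have -> : A (u - w) - c *: (u - w) = \sum_(p <- s | p.1 == c) p.2.
  rewrite linearB scalerBr opprD opprK addrACA -[- A w + _]opprK opprD opprK wE.
  rewrite sE (bigID (fun p => p.1 == c)) /= addrK //.
rewrite linear_sum scaler_sumr big_seq_cond [RHS]big_seq_cond.
by apply: eq_bigr => r /andP[rs /eqP <-]; have [] := sP r rs.
Qed.

End EigenDecomposition.

(** * Strings of an sl2-triple *)

Section Sl2.
Variables (R : realType) (W : lmodType R[i]) (e f h : W -> W).
Hypothesis e0 : e 0 = 0.
Hypothesis f0 : f 0 = 0.
Hypothesis fZ : forall c v, f (c *: v) = c *: f v.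
Hypothesis fD : forall u v, f (u + v) = f u + f v.
Hypothesis ef : forall v, e (f v) = f (e v) + h v.
Definition sl2_wt (m : R) (v : W) : Prop := h v = m%:C *: v.
Hypothesis he : forall m v, sl2_wt m v -> sl2_wt (m + 2) (e v).
Hypothesis hf : forall m v, sl2_wt m v -> sl2_wt (m - 2) (f v).

Lemma iter_f0 n : iter n f 0 = 0.
Proof. by elim: n => //= n ->. Qed.

Lemma sl2_wt_iterf m v n : sl2_wt m v -> sl2_wt (m - 2 * n%:R) (iter n f v).
Proof.
move=> hv; elim: n => [|n IH] /=; first by rewrite mulr0 subr0.
have -> : m - 2 * n.+1%:R = m - 2 * n%:R - 2 by rewrite -natr1; ring.
exact: hf.
Qed.

Lemma sl2_wt_itere m v n : sl2_wt m v -> sl2_wt (m + 2 * n%:R) (iter n e v).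
Proof.
move=> hv; elim: n => [|n IH] /=; first by rewrite mulr0 addr0.
have -> : m + 2 * n.+1%:R = m + 2 * n%:R + 2 by rewrite -natr1; ring.
exact: he.
Qed.

Lemma sl2_e_iterf m v n : sl2_wt m v ->
  e (iter n.+1 f v) = iter n.+1 f (e v) + (n.+1%:R * (m - n%:R))%:C *: iter n f v.
Proof.
move=> hv; elim: n => [|n IH]; first by rewrite /= ef mul1r subr0 hv.
rewrite [iter n.+2 f v]/= ef IH fD fZ -/(iter n.+2 f _) -addrA; congr (_ + _).
rewrite (sl2_wt_iterf n.+1 hv) -scalerDl -rmorphD /=; congr (_%:C *: _).
by rewrite -!natr1; ring.
Qed.

(** f^n is injective on weights m >= n. Induction on the nilpotency of e at v: e v has weight m + 2
    and is killed by f^(n+2), so it is 0; then e f^(j+1) v = (j+1)(m-j) f^j v descends from j = n -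
    1 to v. *)
Lemma sl2_f_inj p m v n : sl2_wt m v -> iter p e v = 0 -> iter n f v = 0 ->
  n%:R <= m -> v = 0.
Proof.
elim: p m v n => // p IH m v n hv ep fn nm.
have ev0 : e v = 0.
  have fn1 : iter n.+1 f v = 0 by rewrite iterS fn f0.
  have fn2 : iter n.+2 f v = 0 by rewrite iterS fn1 f0.
  apply: (IH (m + 2) (e v) n.+2 (he hv)); first by rewrite -iterSr.
    by have := sl2_e_iterf n.+1 hv; rewrite fn1 fn2 e0 scaler0 addr0.
  by rewrite -addn2 natrD lerD2r.
elim: n fn nm => // n IHn fn nm.
apply: IHn; last by apply: le_trans nm; rewrite ler_nat.
have := sl2_e_iterf n hv; rewrite fn ev0 iter_f0 add0r e0.
move=> /esym/eqP; rewrite scaler_eq0 fmorph_eq0 mulf_eq0 pnatr_eq0 /=.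
have : 0 < m - n%:R by rewrite subr_gt0; apply: lt_le_trans nm; rewrite ltr_nat.
by move=> /gt_eqF -> /= /eqP.
Qed.

(** Let u be the last nonzero e^p v, of weight m + 2p, and f^q u the last nonzero one. Applying e to
    f^(q+1) u = 0 gives (q+1)(m + 2p - q) = 0. *)
Lemma sl2_int m v : sl2_wt m v -> v != 0 ->
  (forall m u, sl2_wt m u -> exists p, iter p e u = 0) ->
  (forall m u, sl2_wt m u -> exists p, iter p f u = 0) -> m \is a Num.int.
Proof.
move=> hv v0 enil fnil.
have nil_last (x : W -> W) u : (exists p, iter p x u = 0) -> u != 0 ->
    exists2 p, iter p x u != 0 & iter p.+1 x u = 0.
  move=> [p xp] u0; elim: p xp => [/= u00|p IH xp]; first by rewrite u00 eqxx in u0.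
  by have [/IH//|xp0] := eqVneq (iter p x u) 0; exists p.
have [p ep0 ep] := nil_last e v (enil _ _ hv) v0.
have hp := sl2_wt_itere p hv; set u := iter p e v in ep0 hp.
have [q fq0 fq] := nil_last f u (fnil _ _ hp) ep0.
have := sl2_e_iterf q hp; rewrite fq -[e u]/(iter p.+1 e v) ep iter_f0 add0r e0.
move=> /esym/eqP; rewrite scaler_eq0 (negPf fq0) orbF fmorph_eq0 mulf_eq0 pnatr_eq0 /=.
rewrite subr_eq0 => /eqP mq.
have -> : m = q%:R - 2 * p%:R by rewrite -mq; ring.
by rewrite rpredB ?rpredM ?natr_int // (natr_int 2).
Qed.

End Sl2.

(** * The complexification as a finite-dimensional complex space, needed for the adjoint
    representation *)

Section ComplexVectType.
Variables (R : realType) (V : vectType R).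
Local Notation VC := (cplxification V).
Local Notation C := R[i].
Import VectorInternalTheory.

Let v2c (u : VC) : 'rV[C]_(dim V) :=
  \row_j (v2r u.1 0 j +i* v2r u.2 0 j).

Let v2c_linear : linear v2c.
Proof.
have lin a b x y z : v2r (a *: x + b *: y + z : V) = a *: v2r x + b *: v2r y + v2r z.
  by rewrite !linearD /= !linearZ.
move=> [a b] [x y] [x' y']; apply/rowP => j; rewrite !mxE /= -scaleNr !lin !mxE.
by apply/eqP; rewrite eq_complex /=; apply/andP; split; apply/eqP; ring.
Qed.

Let v2c_bij : bijective v2c.
Proof.
exists (fun r : 'rV[C]_(dim V) =>
  (r2v (\row_j complex.Re (r 0 j)), r2v (\row_j complex.Im (r 0 j))) : VC).
- move=> [x y]; congr pair; rewrite -[RHS]v2rK; congr r2v;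
    by apply/rowP => j; rewrite !mxE.
- by move=> r; apply/rowP => j; rewrite !mxE /= !r2vK !mxE; case: (r 0 j).
Qed.

Fact cplx_vector_axiom : Vector.axiom (dim V) VC.
Proof. by exists v2c. Qed.

HB.instance Definition _ := Lmodule_hasFinDim.Build C VC cplx_vector_axiom.

End ComplexVectType.

Section LieComplex.
Variables (R : realType) (K : simpleCompactLie R).
Local Notation C := R[i].
Local Notation g := (cplxification K).
Implicit Types (x y z : K) (u v w : g).

Lemma innerDl x y z : inner (x + y) z = inner x z + inner y z.
Proof. by rewrite -[x in LHS]scale1r inner_linearl mul1r. Qed.

Lemma inner0l z : inner (0 : K) z = 0.
Proof. by apply: (addIr (inner 0 z)); rewrite -innerDl !add0r. Qed.

Lemma innerZl a x z : inner (a *: x) z = a * inner x z.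
Proof. by rewrite -[_ *: _]addr0 inner_linearl inner0l addr0. Qed.

Lemma innerNl x z : inner (- x) z = - inner x z.
Proof. by rewrite -scaleN1r innerZl mulN1r. Qed.

Lemma innerDr x y z : inner z (x + y) = inner z x + inner z y.
Proof. by rewrite !(inner_sym z) innerDl. Qed.

Lemma innerZr a x z : inner z (a *: x) = a * inner z x.
Proof. by rewrite !(inner_sym z) innerZl. Qed.

Lemma innerNr x z : inner z (- x) = - inner z x.
Proof. by rewrite !(inner_sym z) innerNl. Qed.

Lemma inner0r z : inner z (0 : K) = 0.
Proof. by rewrite inner_sym inner0l. Qed.

Definition innerE := (innerDl, innerDr, innerNl, innerNr, innerZl, innerZr, inner0l, inner0r).

(** Reduces identities between vectors to identities in the field, which [ring] can decide. *)
Lemma inner_ext x y : (forall z, inner x z = inner y z) -> x = y.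
Proof.
move=> h; apply/eqP; rewrite -subr_eq0; apply/negPn/negP => /inner_posdef.
by rewrite innerDl innerNl h subrr ltxx.
Qed.

Lemma bracketDl x y z : bracket (x + y) z = bracket x z + bracket y z.
Proof. by rewrite -[x in LHS]scale1r bracket_linearl scale1r. Qed.

Lemma bracketDr x y z : bracket z (x + y) = bracket z x + bracket z y.
Proof. by rewrite -[x in LHS]scale1r bracket_linearr scale1r. Qed.

Lemma bracket0l z : bracket (0 : K) z = 0.
Proof. by apply: (addIr (bracket 0 z)); rewrite -bracketDl !add0r. Qed.

Lemma bracketZl a x z : bracket (a *: x) z = a *: bracket x z.
Proof. by rewrite -[_ *: x]addr0 bracket_linearl bracket0l addr0. Qed.

Lemma bracketNl x z : bracket (- x) z = - bracket x z.
Proof. by rewrite -scaleN1r bracketZl scaleN1r. Qed.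

Lemma bracketC x y : bracket x y = - bracket y x.
Proof.
have := bracket_alt (x + y); rewrite bracketDl !bracketDr !bracket_alt addr0 add0r.
by move=> /eqP; rewrite addr_eq0 => /eqP.
Qed.

Lemma bracketZr a x z : bracket z (a *: x) = a *: bracket z x.
Proof. by rewrite !(bracketC z) bracketZl scalerN. Qed.

Lemma bracketNr x z : bracket z (- x) = - bracket z x.
Proof. by rewrite !(bracketC z) bracketNl. Qed.

Lemma bracket0r z : bracket z (0 : K) = 0.
Proof. by rewrite bracketC bracket0l oppr0. Qed.

Definition bracketE := (bracketDl, bracketDr, bracketNl, bracketNr, bracketZl,
  bracketZr, bracket0l, bracket0r).

Lemma jacobi x y z : bracket (bracket x y) z =
  bracket x (bracket y z) - bracket y (bracket x z).
Proof.
have := bracket_jacobi x y z; rewrite (bracketC z (bracket x y)) (bracketC z x) bracketNr.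
by move/eqP; rewrite subr_eq0 => /eqP.
Qed.

Local Notation brk := (@cplx_bracket R K).

Lemma cplx_bracket_linearr w (a : C) u v : brk w (a *: u + v) = a *: brk w u + brk w v.
Proof.
case: a w u v => [a b] [w1 w2] [u1 u2] [v1 v2]; rewrite /cplx_bracket /=.
by congr pair => /=; apply: inner_ext => z; rewrite !(bracketE, innerE); ring.
Qed.

Lemma cplx_bracketC u v : brk u v = - brk v u.
Proof.
case: u v => [u1 u2] [v1 v2]; rewrite /cplx_bracket /=.
rewrite (bracketC v1 u1) (bracketC v2 u2) (bracketC v1 u2) (bracketC v2 u1).
by congr pair => /=; apply: inner_ext => z; rewrite !(bracketE, innerE); ring.
Qed.

Lemma cplx_bracket_linearl w (a : C) u v : brk (a *: u + v) w = a *: brk u w + brk v w.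
Proof.
by rewrite !(cplx_bracketC _ w) cplx_bracket_linearr opprD scalerN.
Qed.

Lemma cplx_jacobi u v w : brk (brk u v) w = brk u (brk v w) - brk v (brk u w).
Proof.
case: u v w => [u1 u2] [v1 v2] [w1 w2]; rewrite /cplx_bracket /=.
by congr pair => /=; apply: inner_ext => z; rewrite !(bracketE, innerE) !jacobi !innerE; ring.
Qed.

HB.instance Definition _ u :=
  GRing.isLinear.Build C g g *:%R (brk u) (cplx_bracket_linearr u).

Definition ad_fun u : 'End(g) := linfun (brk u).

Fact ad_fun_linear : linear ad_fun.
Proof.
move=> a u v; apply/lfunP => w.
by rewrite add_lfunE scale_lfunE !lfunE /= cplx_bracket_linearl.
Qed.
HB.instance Definition _ := GRing.isLinear.Build C g 'End(g) *:%R ad_fun ad_fun_linear.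

Fact ad_fun_bracket u v : ad_fun (brk u v) =
  (ad_fun u \o ad_fun v)%VF - (ad_fun v \o ad_fun u)%VF.
Proof.
apply/lfunP => w; rewrite add_lfunE opp_lfunE !comp_lfunE !lfunE /=.
exact: cplx_jacobi.
Qed.

Definition ad_rep : lieRep K := LieRep ad_fun_bracket.

Lemma ad_repE u v : rep_act ad_rep u v = brk u v.
Proof. exact: lfunE. Qed.

(* Bilinear; the Hermitian form is [cform u (cconj v)]. *)
Definition cform u v : C :=
  (inner u.1 v.1 - inner u.2 v.2) +i* (inner u.1 v.2 + inner u.2 v.1).

Definition cconj u : g := (u.1, - u.2).

Lemma cform_linearl (a : C) u v w : cform (a *: u + v) w = a * cform u w + cform v w.
Proof.
case: a u v w => [a b] [u1 u2] [v1 v2] [w1 w2]; rewrite /cform /=; simpc.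
by congr (_ +i* _); rewrite !innerE; ring.
Qed.

Lemma cformC u v : cform u v = cform v u.
Proof.
rewrite /cform (inner_sym u.1) (inner_sym u.2) (inner_sym u.1 v.2) (inner_sym u.2 v.1).
by rewrite [X in _ +i* X]addrC.
Qed.

Lemma cformDl u v w : cform (u + v) w = cform u w + cform v w.
Proof. by rewrite -[u in LHS]scale1r cform_linearl mul1r. Qed.

Lemma cform0l w : cform 0 w = 0.
Proof. by apply: (addIr (cform 0 w)); rewrite -cformDl !add0r. Qed.

Lemma cformZl (a : C) u w : cform (a *: u) w = a * cform u w.
Proof. by rewrite -[_ *: u]addr0 cform_linearl cform0l addr0. Qed.

Lemma cformZr (a : C) u w : cform w (a *: u) = a * cform w u.
Proof. by rewrite !(cformC w) cformZl. Qed.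

Lemma cformNl u w : cform (- u) w = - cform u w.
Proof. by rewrite -scaleN1r cformZl mulN1r. Qed.

Lemma cformNr u w : cform w (- u) = - cform w u.
Proof. by rewrite !(cformC w) cformNl. Qed.

Lemma cform_invariant u v w : cform (brk u v) w = - cform v (brk u w).
Proof.
case: u v w => [u1 u2] [v1 v2] [w1 w2]; rewrite /cform /cplx_bracket.
by apply/eqP; rewrite eq_complex /=; apply/andP; split; apply/eqP;
  rewrite !innerE !inner_invariant; ring.
Qed.

Lemma cconj_bracket u v : cconj (brk u v) = brk (cconj u) (cconj v).
Proof.
case: u v => [u1 u2] [v1 v2]; rewrite /cconj /cplx_bracket /=.
by congr pair; apply: inner_ext => z; rewrite !(bracketE, innerE); ring.
Qed.

Lemma cconjZ (a : C) u : cconj (a *: u) = conjc a *: cconj u.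
Proof.
case: a u => [a b] [u1 u2]; rewrite /cconj /=.
by congr pair => /=; apply: inner_ext => z; rewrite !innerE; ring.
Qed.

Lemma cconjK u : cconj (cconj u) = u.
Proof. by case: u => [u1 u2]; rewrite /cconj /= opprK. Qed.

Lemma cform_cconj_gt0 u : u != 0 ->
  exists2 r : R, 0 < r & cform u (cconj u) = r%:C.
Proof.
case: u => [x y] xy0; exists (inner x x + inner y y).
  have ge0 z : 0 <= inner z z.
    by have [->|/inner_posdef/ltW//] := eqVneq z (0 : K); rewrite inner0l.
  have [x0|x0] := eqVneq x 0; last by rewrite ltr_pwDl // inner_posdef.
  rewrite ltr_wpDl // inner_posdef //; apply: contraNneq xy0 => ->.
  by rewrite x0.
rewrite /cform /cconj /=; congr (_ +i* _); rewrite !innerE; first ring.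
by rewrite (inner_sym y); ring.
Qed.

End LieComplex.

(** * Torus weights and sl2-triples *)

Section Torus.
Variables (R : realType) (K : simpleCompactLie R) (t : {vspace K}).
Hypothesis tP : max_torus t.
Local Notation C := R[i].
Local Notation g := (cplxification K).
Local Notation T := (subvs_of t).
Local Notation dual := (tdual t).
Local Notation roots := (@Defs.roots R K t).
Local Notation brk := (@cplx_bracket R K).
Implicit Types (H : T) (V : lieRep K) (X Y Z u : g) (a b mu : dual).

Definition tinj H : g := cplx_inj (vsval H).

Definition wtv V mu (v : rep_space V) : Prop :=
  forall H, rep_act V (tinj H) v = ('i * (mu H)%:C) *: v.

Lemma wtvP V mu v : v \in weight_space V mu <-> wtv mu v.
Proof. exact: memv_weight_space. Qed.

#[local] Opaque weight_space.

Lemma root_vectorE a X : root_vector a X <-> wtv (V := ad_rep K) a X.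
Proof. by split=> h H; have := h H; rewrite ad_repE. Qed.

Lemma tinjP (c : R) H H' : tinj (c *: H + H') = c%:C *: tinj H + tinj H'.
Proof. by congr pair => /=; rewrite ?linearP ?scale0r ?scaler0 ?subr0 ?addr0. Qed.

Lemma tinj0 : tinj 0 = 0.
Proof. by congr pair; rewrite linear0. Qed.

Lemma tinjD H H' : tinj (H + H') = tinj H + tinj H'.
Proof. by have := tinjP 1 H H'; rewrite !scale1r. Qed.

Lemma tinjZ (c : R) H : tinj (c *: H) = c%:C *: tinj H.
Proof. by have := tinjP c H 0; rewrite tinj0 !addr0. Qed.

Lemma tinjN H : tinj (- H) = - tinj H.
Proof. by rewrite -scaleN1r tinjZ rmorphN rmorph1 scaleN1r. Qed.

Lemma imag_neq0 : 'i != 0 :> C.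
Proof. by rewrite eq_complex /= oner_eq0 andbF. Qed.

Lemma torus_abelian H H' : brk (tinj H) (tinj H') = 0.
Proof.
case: tP => ab _; rewrite /cplx_bracket /= !(bracket0l, bracket0r) (ab _ _ (subvsP H) (subvsP H')).
by rewrite subr0 addr0.
Qed.

Lemma cconj_tinj H : cconj (tinj H) = tinj H.
Proof. by rewrite /cconj /= oppr0. Qed.

Lemma rep_act_brk V u X v :
  rep_act V (brk u X) v = rep_act V u (rep_act V X v) - rep_act V X (rep_act V u v).
Proof. by rewrite rep_bracket add_lfunE opp_lfunE !comp_lfunE. Qed.

Lemma torus_act_comm V H H' v :
  rep_act V (tinj H) (rep_act V (tinj H') v) = rep_act V (tinj H') (rep_act V (tinj H) v).
Proof.
by apply/eqP; rewrite -subr_eq0 -rep_act_brk torus_abelian linear0 zero_lfunE.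
Qed.

Lemma root_act V a X mu v : root_vector a X -> wtv (V := V) mu v ->
  wtv (V := V) (mu + a) (rep_act V X v).
Proof.
move=> ra wv H; have /eqP := rep_act_brk (tinj H) X v.
rewrite wv linearZ /= eq_sym subr_eq => /eqP ->.
rewrite -[cplx_bracket _ _]/(brk (cplx_inj (vsval H)) X) ra linearZ scale_lfunE /=.
by rewrite -scalerDl -mulrDr -rmorphD /= add_lfunE [in RHS]addrC.
Qed.

(** Elements of the torus are real, so ad H is skew for a positive definite Hermitian form. Through
    this, compactness makes ad H diagonalizable with imaginary eigenvalues. *)
Lemma ad_torus_skew H u v : cform (brk (tinj H) u) (cconj v) = - cform u (cconj (brk (tinj H) v)).
Proof. by rewrite cform_invariant cconj_bracket cconj_tinj. Qed.

Lemma cform_cconj_eq0 u : cform u (cconj u) = 0 -> u = 0.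
Proof.
move=> h; apply/eqP/negPn/negP => /cform_cconj_gt0[r r0]; rewrite h => /eqP.
by rewrite eq_sym fmorph_eq0 gt_eqF.
Qed.

Lemma ad_torus_eigen H (c : C) u : u != 0 -> brk (tinj H) u = c *: u -> conjc c = - c.
Proof.
move=> u0 Hu; have := ad_torus_skew H u u; rewrite Hu cconjZ cformZl cformZr -mulNr.
have [r r0 ->] := cform_cconj_gt0 u0.
have rn : r%:C != 0 :> C by rewrite fmorph_eq0 gt_eqF.
by move=> /(mulIf rn) e; rewrite [in RHS]e opprK.
Qed.

Lemma imaginaryE (c : C) : conjc c = - c -> c = 'i * (complex.Im c)%:C.
Proof.
case: c => a b /eqP; rewrite eq_complex /= => /andP[/eqP h _]; simpc.
by congr (_ +i* _); lra.
Qed.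

(** For x = (ad H - c)u with ad H x = c x, skewness moves ad H - c from u onto x, where it vanishes;
    hence (x|x) = 0. *)
Lemma ad_torus_semisimple H (c : C) u :
  brk (tinj H) (brk (tinj H) u - c *: u) = c *: (brk (tinj H) u - c *: u) ->
  brk (tinj H) u = c *: u.
Proof.
set x := brk (tinj H) u - c *: u => Hx; apply/eqP; rewrite -subr_eq0 -/x.
apply/negPn/negP => x0; have cc := ad_torus_eigen x0 Hx.
move/negP: x0; apply; apply/eqP/cform_cconj_eq0.
rewrite {1}/x cformDl cformNl cformZl ad_torus_skew Hx cconjZ cformZr cc.
by rewrite mulNr opprK subrr.
Qed.

Definition sum_of (W : zmodType) (P : W -> Prop) (u : W) : Prop :=
  exists2 s : seq W, u = \sum_(x <- s) x & forall x, x \in s -> P x.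

Lemma sum_of_bind (W : zmodType) (P Q : W -> Prop) (u : W) :
  sum_of P u -> (forall x, P x -> sum_of Q x) -> sum_of Q u.
Proof.
move=> [s -> sP] h; elim: s sP => [|x s IH] sP; first by exists [::]; rewrite ?big_nil.
have [|r rE rP] := IH; first by move=> y ys; apply: sP; rewrite in_cons ys orbT.
have [q qE qP] := h x (sP x (mem_head _ _)).
exists (q ++ r); first by rewrite big_cons big_cat /= qE rE.
by move=> y; rewrite mem_cat => /orP[/qP|/rP].
Qed.

Lemma ad_joint_eigen (l : seq T) u : sum_of (fun v => forall H, H \in l ->
  exists c : C, brk (tinj H) v = c *: v) u.
Proof.
elim: l u => [|H l IH] u; first by exists [:: u]; rewrite ?big_seq1.
apply: sum_of_bind (IH u) _ => v vP.
(* The joint eigenspace of v for the operators already treated; ad H preserves it because the torus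
   is abelian. *)
pose Q w := forall H' c, H' \in l -> brk (tinj H') v = c *: v -> brk (tinj H') w = c *: w.
have [|||//|s vE sP] := @eigen_decomposition _ _ (rep_act (ad_rep K) (tinj H)) Q _ _ _ v.
- by move=> c w; rewrite !ad_repE; apply: ad_torus_semisimple.
- move=> c x y Qx Qy H' d H'l vd.
  by rewrite linearP /= (Qx _ _ H'l vd) (Qy _ _ H'l vd) scalerDr !scalerA mulrC.
- move=> x Qx H' d H'l vd; have := torus_act_comm (V := ad_rep K) H' H x.
  by rewrite !ad_repE => ->; rewrite (Qx _ _ H'l vd) linearZ.
exists [seq p.2 | p <- s]; first by rewrite big_map.
move=> x /mapP[p ps ->] H'; have [Qp Ap] := sP p ps.
rewrite in_cons => /predU1P[->|H'l]; first by exists p.1; rewrite -ad_repE.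
by have [c vc] := vP H' H'l; exists c; apply: Qp.
Qed.

Lemma lin_on_basis (f : T -> C) : (forall c H H', f (c *: H + H') = c%:C * f H + f H') ->
  (forall H, f H = 'i * (complex.Im (f H))%:C) ->
  exists mu : dual, forall H, f H = 'i * (mu H)%:C.
Proof.
move=> fl fi; pose m (H : T) : R^o := complex.Im (f H).
have ml : linear m.
  move=> c H H'; rewrite /m fl; case: (f H) => a b; case: (f H') => a' b' /=.
  by rewrite mul0r addr0.
pose M := GRing.isLinear.Build R T R^o *:%R m ml.
pose ML : {linear T -> R^o} := HB.pack m M.
by exists (linfun ML) => H; rewrite lfunE /= fi.
Qed.

Lemma joint_eigen_weight V (v : rep_space V) : v != 0 ->
  (forall H, exists2 c : C, conjc c = - c & rep_act V (tinj H) v = c *: v) ->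
  exists mu, wtv mu v.
Proof.
move=> v0 h; have {}h H : {c : C | conjc c = - c /\ rep_act V (tinj H) v = c *: v}.
  by apply: cid; have [c] := h H; exists c.
pose f H := sval (h H).
have fE H : rep_act V (tinj H) v = f H *: v by have [] := svalP (h H).
have [||mu muE] := @lin_on_basis f.
- move=> c H H'; apply/eqP; rewrite -subr_eq0.
  suff : (f (c *: H + H') - (c%:C * f H + f H')) *: v == 0.
    by rewrite scaler_eq0 (negPf v0) orbF.
  rewrite scalerBl -fE tinjP linearP add_lfunE scale_lfunE !fE.
  by rewrite scalerDl scalerA subrr.
- by move=> H; apply: imaginaryE; have [] := svalP (h H).
by exists mu => H; rewrite fE muE.
Qed.

Lemma ad_weight_sum u : sum_of (fun X => exists a, root_vector a X) u.
Proof.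
pose e := vbasis {: T}.
apply: sum_of_bind (ad_joint_eigen e u) _ => v vP.
have [->|v0] := eqVneq v 0; first by exists [::]; rewrite ?big_nil.
exists [:: v]; rewrite ?big_seq1 // => _ /[!inE] /eqP->.
have [|a /root_vectorE ra] := joint_eigen_weight (V := ad_rep K) v0; last by exists a.
move=> H; rewrite ad_repE.
suff [c vc] : exists c : C, brk (tinj H) v = c *: v.
  by exists c => //; apply: ad_torus_eigen vc.
rewrite [H](coord_vbasis (memvf H)); apply: (big_ind (fun H => exists c : C, brk (tinj H) v = c *: v)).
- by exists 0; rewrite tinj0 cplx_bracketC linear0 oppr0 scale0r.
- move=> H1 H2 [c1 h1] [c2 h2]; exists (c1 + c2).
  rewrite tinjD -[tinj H1]scale1r cplx_bracket_linearl scale1r h1 h2.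
  by rewrite scalerDl.
- move=> j _; have [|c vc] := vP e`_j; first by apply: mem_nth; rewrite size_tuple.
  exists ((coord e j H)%:C * c); rewrite tinjZ -[_ *: tinj _]addr0.
  rewrite cplx_bracket_linearl vc scalerA cplx_bracketC linear0 oppr0 addr0 //.
Qed.

(** If x commutes with t, then t + Rx is abelian and maximality puts x in t. So the zero weight
    space of g is the complexified torus. *)
Lemma centralizer_torus X : root_vector (0 : dual) X -> X.1 \in t /\ X.2 \in t.
Proof.
case: tP => ab mx h.
suff cen x : (forall H, bracket (vsval H) x = 0) -> x \in t.
  split; apply: cen => H; have := h H; rewrite zero_lfunE mulr0 scale0r;
    by rewrite /cplx_bracket /= !bracket0l subr0 addr0 => -[].
move=> hx; have <- : (t + <[x]>)%VS = t.
  apply: mx; last exact: addvSl.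
  have hx' y : y \in t -> bracket y x = 0.
    by move=> yt; have := hx (vsproj t y); rewrite vsprojK.
  move=> y z /memv_addP[y1 y1t [_ /vlineP[c ->] ->]] /memv_addP[z1 z1t [_ /vlineP[d ->] ->]].
  rewrite !bracketE (ab _ _ y1t z1t) (bracketC x z1) (hx' _ y1t) (hx' _ z1t) bracket_alt.
  by rewrite !(oppr0, scaler0, addr0).
by apply: (subvP (addvSr _ _)); apply: memv_line.
Qed.

Lemma inner_nu_inv a H : inner (vsval (nu_inv a)) (vsval H) = a H.
Proof. by rewrite -nuE nu_invK. Qed.

Lemma dual_neq0 a : a != 0 -> exists H, a H != 0.
Proof.
move=> a0; apply: contrapT => h; move/negP: a0; apply; apply/eqP/lfunP => H.
by rewrite zero_lfunE; apply/eqP/negPn/negP => aH; apply: h; exists H.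
Qed.

Lemma root_cform0 a b X Y : root_vector a X -> root_vector b Y -> a + b != 0 ->
  cform X Y = 0.
Proof.
move=> ra rb /dual_neq0[H]; rewrite add_lfunE => abH.
have := cform_invariant (tinj H) X Y.
rewrite -[brk _ X]/(cplx_bracket (cplx_inj (vsval H)) X) ra.
rewrite -[brk _ Y]/(cplx_bracket (cplx_inj (vsval H)) Y) rb cformZl cformZr.
move/eqP; rewrite -addr_eq0 -mulrDl -mulrDr -rmorphD /= mulf_eq0 => /orP[|/eqP//].
by rewrite mulf_eq0 (negPf imag_neq0) fmorph_eq0 (negPf abH).
Qed.

Lemma root_cconj a X : root_vector a X -> root_vector (- a) (cconj X).
Proof.
move=> ra H; have := ra H => /(congr1 (@cconj _ _)).
rewrite cconj_bracket cconj_tinj cconjZ => ->; congr (_ *: _).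
by rewrite opp_lfunE; simpc.
Qed.

Lemma root_bracket a b X Y : root_vector a X -> root_vector b Y ->
  root_vector (a + b) (brk X Y).
Proof.
move=> ra /root_vectorE rb; apply/root_vectorE; rewrite addrC -ad_repE.
exact: root_act.
Qed.

Lemma root_vectorZ a (c : C) X Y : root_vector a X -> root_vector a Y ->
  root_vector a (c *: X + Y).
Proof.
move=> rX rY H; rewrite cplx_bracket_linearr rX rY scalerDr !scalerA.
by rewrite (mulrC c).
Qed.

Lemma root_vector0 a : root_vector a (0 : g).
Proof. by move=> H; rewrite linear0 scaler0. Qed.

Lemma root_zero_eq0 Z : root_vector (0 : dual) Z ->
  (forall H, cform Z (tinj H) = 0) -> Z = 0.
Proof.
move=> /centralizer_torus[]; case: Z => [x y] /= xt yt h.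
have z0 z : z \in t -> (forall H, inner z (vsval H) = 0) -> z = 0.
  move=> zt h'; apply/eqP/negPn/negP => /inner_posdef.
  by have := h' (vsproj t z); rewrite vsprojK // => ->; rewrite ltxx.
congr pair; apply: z0 => // H; have := h H;
  by rewrite /cform /= !inner0r subr0 add0r => -[].
Qed.

(** The difference of the two sides has weight 0, so it lies in the complexified torus, and
    invariance of the form makes it orthogonal to the torus. *)
Lemma root_bracket_neg a X Y : root_vector a X -> root_vector (- a) Y ->
  brk X Y = ('i * cform X Y) *: tinj (nu_inv a).
Proof.
move=> ra rb; apply/eqP; rewrite -subr_eq0; apply/eqP/root_zero_eq0.
  rewrite -scaleNr addrC; apply: root_vectorZ.
    by move=> H; rewrite [LHS]torus_abelian zero_lfunE mulr0 scale0r.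
  by rewrite -(subrr a); apply: root_bracket.
move=> H; rewrite cformDl cformNl cformZl cform_invariant.
rewrite cplx_bracketC cformNr opprK -[brk _ X]/(cplx_bracket (cplx_inj (vsval H)) X) ra.
rewrite cformZr [cform (tinj _) _]/cform /= !inner0r !inner0l inner_nu_inv (cformC Y).
by rewrite subr0 addr0 mulrAC subrr.
Qed.

Lemma inner_nu_gt0 a : a != 0 -> 0 < a (nu_inv a) :> R.
Proof.
move=> a0; rewrite -inner_nu_inv; apply: inner_posdef.
apply: contra_neq a0 => h; apply/lfunP => H.
by rewrite -inner_nu_inv h inner0l zero_lfunE.
Qed.

Lemma coroot_nu a : coroot a = (2 / a (nu_inv a)) *: nu_inv a.
Proof. by rewrite /coroot inner_nu_inv. Qed.

Lemma nu_invZ (c : R) a : nu_inv (c *: a) = c *: nu_inv a.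
Proof. exact: linearZ. Qed.

Lemma nu_invN a : nu_inv (- a) = - nu_inv a.
Proof. by rewrite -scaleN1r nu_invZ scaleN1r. Qed.

Lemma corootN a : coroot (- a) = - coroot a.
Proof.
have e : (- a) (- nu_inv a) = a (nu_inv a) by rewrite opp_lfunE linearN opprK.
by rewrite !coroot_nu nu_invN e scalerN.
Qed.

Lemma coroot_id a : a != 0 -> a (coroot a) = 2.
Proof.
move=> /inner_nu_gt0 h; rewrite coroot_nu linearZ /= -[_ *: _]/(_ * _).
by rewrite mulfVK // gt_eqF.
Qed.

(** Roots being real, the coroot acts on [e] by 2i; the usual h is therefore -i times the coroot. *)
Definition sl2_triple a (e f : g) : Prop :=
  [/\ root_vector a e, root_vector (- a) f & brk e f = - 'i *: tinj (coroot a)].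

Lemma sl2_triple_ex a : roots a -> exists e f, e != 0 /\ sl2_triple a e f.
Proof.
move=> [a0 [X X0 ra]]; have [r r0 rE] := cform_cconj_gt0 X0.
have rc := root_cconj ra; have aa := inner_nu_gt0 a0.
(* The bracket of X and its conjugate is i r nu^-1(a), and the coroot is 2/(a|a) nu^-1(a); s
   rescales one to -i times the other. *)
pose s : C := - (2 / (a (nu_inv a) * r))%:C.
exists X, (s *: cconj X); split=> //; split=> //.
  by rewrite -[_ *: _]addr0; apply: root_vectorZ => //; apply: root_vector0.
rewrite linearZ /= (root_bracket_neg ra rc) rE scalerA coroot_nu tinjZ scalerA.
congr (_ *: _); rewrite /s !mulNr mulrCA -rmorphM /=; congr (- ('i * _%:C)).
by field; rewrite (gt_eqF r0) (gt_eqF aa).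
Qed.

Lemma sl2_tripleN a e f : sl2_triple a e f -> sl2_triple (- a) f e.
Proof.
case=> re rf ef; split=> //; first by rewrite opprK.
by rewrite cplx_bracketC ef corootN tinjN scalerN.
Qed.

Section Sl2Rep.
Variables (V : lieRep K) (a : dual) (e f : g).
Hypothesis a0 : a != 0.
Hypothesis tr : sl2_triple a e f.
Let ee := rep_act V e.
Let ff := rep_act V f.
Let hh : 'End(rep_space V) := - 'i *: rep_act V (tinj (coroot a)).

Let ef v : ee (ff v) = ff (ee v) + hh v.
Proof.
case: tr => _ _ h; have := rep_act_brk e f v; rewrite h linearZ /= => /eqP.
by rewrite eq_sym subr_eq addrC => /eqP.
Qed.

Let h_shift b X m v : root_vector b X -> sl2_wt hh m v ->
  sl2_wt hh (m + b (coroot a)) (rep_act V X v).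
Proof.
move=> rb; rewrite /sl2_wt /hh !scale_lfunE => hv.
have := rep_act_brk (tinj (coroot a)) X v.
rewrite -[brk _ X]/(cplx_bracket (cplx_inj (vsval (coroot a))) X) rb => /eqP.
rewrite eq_sym subr_eq => /eqP ->; rewrite scalerDr addrC rmorphD scalerDl.
congr (_ + _); first by rewrite -linearZ /= hv linearZ.
by rewrite linearZ scale_lfunE /= scalerA mulrA mulNr -expr2 sqr_i opprK mul1r.
Qed.

Let he m v : sl2_wt hh m v -> sl2_wt hh (m + 2) (ee v).
Proof. by case: tr => re _ _ /(h_shift re); rewrite coroot_id. Qed.

Let hf m v : sl2_wt hh m v -> sl2_wt hh (m - 2) (ff v).
Proof. by case: tr => _ rf _ /(h_shift rf); rewrite opp_lfunE coroot_id. Qed.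

Lemma sl2_wtv mu v : wtv (V := V) mu v -> sl2_wt hh (mu (coroot a)) v.
Proof.
move=> wv; rewrite /sl2_wt /hh scale_lfunE wv scalerA mulrA mulNr -expr2 sqr_i.
by rewrite opprK mul1r.
Qed.

(** Nonzero iterates would be eigenvectors of [hh] for infinitely many distinct eigenvalues. *)
Lemma sl2_nil (x : rep_space V -> rep_space V) (d : R) : d != 0 ->
  (forall m v, sl2_wt hh m v -> sl2_wt hh (m + d) (x v)) ->
  forall m v, sl2_wt hh m v -> exists p, iter p x v = 0.
Proof.
move=> d0 hx m v hv; apply: contrapT => h; have [cs csE] := shifts_eq0 hh.
have hp p : sl2_wt hh (m + p%:R * d) (iter p x v).
  elim: p => [|p IH]; first by rewrite mul0r addr0.
  have -> : m + p.+1%:R * d = m + p%:R * d + d by rewrite -natr1; ring.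
  exact: hx.
pose s := [seq (m + p%:R * d)%:C | p <- iota 0 (size cs).+1].
have : (size s <= size cs)%N.
  apply: uniq_leq_size.
    rewrite map_inj_uniq ?iota_uniq // => p q /(fmorph_inj (real_complex R)).
    by move=> /addrI /(mulIf d0) /eqP; rewrite eqr_nat => /eqP.
  move=> _ /mapP[p _ ->]; apply: (eigenvalue_in csE (hp p)).
  by apply/eqP => z; apply: h; exists p.
by rewrite size_map size_iota ltnn.
Qed.

Lemma sl2_weight_int mu v : wtv (V := V) mu v -> v != 0 -> mu (coroot a) \is a @Num.int R.
Proof.
move=> /sl2_wtv hv v0.
apply: (sl2_int (e := ee) (f := ff) (h := hh) _ _ _ _ ef he hf hv v0).
- exact: linear0.
- exact: linear0.
- by move=> c u; rewrite linearZ.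
- exact: linearD.
- by apply: (@sl2_nil ee 2) => //; rewrite pnatr_eq0.
- by apply: (@sl2_nil ff (-2)) => //; rewrite oppr_eq0 pnatr_eq0.
Qed.

Lemma sl2_iter_inj mu v n : wtv (V := V) mu v -> mu (coroot a) = n%:R ->
  iter n ff v = 0 -> v = 0.
Proof.
move=> /sl2_wtv hv muE fn; have [p ep] : exists p, iter p ee v = 0.
  by apply: (@sl2_nil ee 2 _ he _ _ hv); rewrite pnatr_eq0.
apply: (sl2_f_inj (e := ee) (f := ff) (h := hh) _ _ _ _ ef he hf hv ep fn).
- exact: linear0.
- exact: linear0.
- by move=> c u; rewrite linearZ.
- exact: linearD.
- by rewrite muE.
Qed.

Lemma wtv_iter mu v n : wtv (V := V) mu v -> wtv (V := V) (mu - n%:R *: a) (iter n ff v).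
Proof.
case: tr => _ rf _ wv; elim: n => [|n IH]; first by rewrite scale0r subr0.
have -> : mu - n.+1%:R *: a = mu - n%:R *: a + - a.
  by rewrite -natr1 scalerDl scale1r opprD addrA.
exact: root_act.
Qed.

Lemma weight_dim_le mu n : mu (coroot a) = n%:R ->
  (\dim (weight_space V mu) <= \dim (weight_space V (mu - n%:R *: a)))%N.
Proof.
move=> muE; pose F := iter n (fun x => (ff \o x)%VF) \1%VF.
have FE v : F v = iter n ff v.
  rewrite /F; move: (n) => m; elim: m => [|m IH] /=; first exact: id_lfunE.
  by rewrite comp_lfunE IH.
have FV : \dim (F @: weight_space V mu) = \dim (weight_space V mu).
  apply: limg_dim_eq; apply/eqP; rewrite -subv0; apply/subvP => v.
  rewrite memv_cap memv_ker FE => /andP[/wtvP wv /eqP fv].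
  by rewrite (sl2_iter_inj wv muE fv) mem0v.
have : (\dim (F @: weight_space V mu) <= \dim (weight_space V (mu - n%:R *: a)))%N.
  apply: dimvS; apply/subvP => _ /memv_imgP[v /wtvP wv ->].
  by apply/wtvP; rewrite FE; apply: wtv_iter.
by rewrite FV.
Qed.

End Sl2Rep.

Lemma weight_int V mu v a : roots a -> wtv (V := V) mu v -> v != 0 ->
  mu (coroot a) \is a @Num.int R.
Proof.
move=> ra; have [e [f [_ tr]]] := sl2_triple_ex ra; case: ra => a0 _.
exact: (sl2_weight_int a0 tr).
Qed.

Lemma roots_opp a : roots a -> roots (- a).
Proof.
move=> [a0 [X X0 ra]]; split; first by rewrite oppr_eq0.
exists (cconj X); last exact: root_cconj.
by apply: contra_neq X0 => h; rewrite -[X]cconjK h /cconj oppr0.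
Qed.

Lemma weight_refl_dim V mu a : roots a ->
  \dim (weight_space V (reflection a mu)) = \dim (weight_space V mu).
Proof.
suff le nu : roots a ->
    (\dim (weight_space V nu) <= \dim (weight_space V (reflection a nu)))%N.
  move=> ra; apply/eqP; rewrite eqn_leq; apply/andP; split; last exact: le.
  suff e : mu = reflection a (reflection a mu) by rewrite [X in (_ <= \dim (weight_space V X))%N]e; apply: le.
  have a0 : a != 0 by case: ra.
  rewrite /reflection add_lfunE opp_lfunE scale_lfunE coroot_id //.
  rewrite -[_ *: 2]/(_ * 2) mulr_natr mulr2n opprD addrA subrr sub0r scaleNr opprK.
  by rewrite subrK.
move=> ra; have [v0|v0] := posnP (\dim (weight_space V nu)).
  exact: leq_trans (eq_leq v0) (leq0n _).
have [v vV v0'] : exists2 v, v \in weight_space V nu & v != 0.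
  exists (vpick (weight_space V nu)); first exact: memv_pick.
  by rewrite vpick0 -dimv_eq0 -lt0n.
move/wtvP: vV => wv; have := weight_int ra wv v0'.
have [e [f [_ tr]]] := sl2_triple_ex ra; have a0 : a != 0 by case: ra.
move=> /intrP[[n|n] nE]; rewrite /reflection nE.
  rewrite -!pmulrn in nE *.
  exact: (weight_dim_le V a0 tr nE).
have -> : nu - (Negz n)%:~R *: a = nu - n.+1%:R *: (- a).
  by rewrite NegzE mulrNz scaleNr scalerN.
apply: (weight_dim_le V _ (sl2_tripleN tr)); first by rewrite oppr_eq0.
by rewrite corootN linearN /= nE NegzE mulrNz opprK.
Qed.

Lemma sl2_cform_neq0 a e f : a != 0 -> sl2_triple a e f -> cform e f = - (2 / a (nu_inv a))%:C.
Proof.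
move=> a0 [re rf ef]; have aa := inner_nu_gt0 a0.
have := root_bracket_neg re rf; rewrite ef coroot_nu tinjZ scalerA => /eqP.
rewrite -subr_eq0 -scalerBl scaler_eq0 => /orP[|]; last first.
  move=> /eqP h; have : tinj (nu_inv a) = 0 by [].
  move=> -[] h1; have : a (nu_inv a) = 0 by rewrite -inner_nu_inv h1 inner0l.
  by move=> z; rewrite z ltxx in aa.
rewrite mulNr -opprD oppr_eq0 -mulrDr mulf_eq0 => /orP[|].
  by rewrite eq_complex /= oner_eq0 andbF.
by rewrite addrC addr_eq0 => /eqP.
Qed.

(** Subtract from Y the multiple of e having the same form against f. By [root_bracket_neg] the
    difference commutes with f, but ad f is injective on weight a, where the coroot takes the value
    2. *)
Lemma root_space_dim1 a e f Y : a != 0 -> sl2_triple a e f -> root_vector a Y ->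
  exists c : C, Y = c *: e.
Proof.
move=> a0 tr rY; have [re rf ef] := tr; have cE := sl2_cform_neq0 a0 tr.
have aa := inner_nu_gt0 a0.
have c0 : cform e f != 0.
  by rewrite cE oppr_eq0 fmorph_eq0 mulf_neq0 ?invr_eq0 ?pnatr_eq0 // gt_eqF.
exists (cform Y f / cform e f); apply/eqP; rewrite -subr_eq0; apply/eqP.
set Y' := Y - _; have rY' : root_vector a Y'.
  by rewrite /Y' addrC -scaleNr; apply: root_vectorZ.
have B0 : cform Y' f = 0 by rewrite /Y' cformDl cformNl cformZl mulfVK // subrr.
have br0 : brk Y' f = 0 by rewrite (root_bracket_neg rY' rf) B0 mulr0 scale0r.
move/root_vectorE: rY' => wY.
have sub2 : wtv (V := ad_rep K) a Y' -> iter 1 (rep_act (ad_rep K) f) Y' = 0 -> Y' = 0.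
  move=> wY' fY; have hfY : iter 2 (rep_act (ad_rep K) f) Y' = 0.
    by rewrite iterS fY linear0.
  by apply: (sl2_iter_inj a0 tr wY' _ hfY); rewrite coroot_id.
by apply: sub2 => //=; rewrite ad_repE cplx_bracketC br0 oppr0.
Qed.

Lemma cplx_bracket_id u : brk u u = 0.
Proof.
case: u => x y; rewrite /cplx_bracket /= !bracket_alt subrr (bracketC y x).
by rewrite subrr.
Qed.

(** Let Y have weight 2a. Then [e, Y] = 0, as 3a is not a root: a would pair with its coroot to 2/3.
    Also [f, Y] has weight a, so it is a multiple of e and commutes with e. Jacobi gives [[e, f], Y]
    = 0, whereas [e, f] acts on Y by 4. *)
Lemma root_mul2 a : roots a -> ~ roots (a *+ 2).
Proof.
move=> ra [_ [Y Y0 rY]]; have [e [f [e0 tr]]] := sl2_triple_ex ra.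
have a0 : a != 0 by case: ra.
have [re rf ef] := tr.
have eY0 : brk e Y = 0.
  apply/eqP/negPn/negP => eY; have r3 : root_vector (a *+ 3) (brk e Y).
    by rewrite mulrS; apply: root_bracket.
  have a3 : a *+ 3 != 0 by rewrite -scaler_nat scaler_eq0 pnatr_eq0.
  have ra3 : roots (a *+ 3) by split=> //; exists (brk e Y).
  have [X X0 rX] : exists2 X, X != 0 & root_vector a X by case: ra.
  have /root_vectorE wX := rX.
  have := weight_int ra3 wX X0; have aa := inner_nu_gt0 a0.
  have e3 : a *+ 3 = 3%:R *: a by rewrite scaler_nat.
  rewrite coroot_nu e3 nu_invZ scale_lfunE !linearZ /= -![_ *: _]/(_ * _).
  have -> : 2 / (3 * (3 * a (nu_inv a))) * (3 * a (nu_inv a)) = 2 / 3 :> R.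
    by field; rewrite (gt_eqF aa).
  move=> /intrP[n nE]; have : (n * 3 = 2)%R.
    by apply: (@intr_inj R); rewrite intrM -nE; field.
  lia.
have [c cE] : exists c : C, brk f Y = c *: e.
  apply: (root_space_dim1 a0 tr); rewrite (_ : a = - a + a *+ 2).
    exact: root_bracket.
  by rewrite mulr2n addKr.
have := cplx_jacobi e f Y; rewrite cE eY0 linear0 subr0 linearZ /= cplx_bracket_id.
rewrite scaler0 ef -[_ *: tinj _]addr0 cplx_bracket_linearl (cplx_bracketC 0) linear0.
rewrite oppr0 addr0 -[brk _ Y]/(cplx_bracket (cplx_inj (vsval (coroot a))) Y) rY.
have -> : (a *+ 2) (coroot a) = 4 :> R.
  have e2 : a *+ 2 = 2%:R *: a by rewrite scaler_nat.
  by rewrite e2 scale_lfunE coroot_id // -[_ *: _]/(_ * _) -natrM.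
move=> /eqP; rewrite scalerA scaler_eq0 (negPf Y0) orbF !mulf_eq0 oppr_eq0.
by rewrite (negPf imag_neq0) fmorph_eq0 pnatr_eq0.
Qed.

Lemma max_free (F : fieldType) (W : vectType F) (P : W -> Prop) :
  exists b : seq W, [/\ free b, forall v, v \in b -> P v & forall v, P v -> v \in <<b>>%VS].
Proof.
pose Q n := `[< exists b : seq W, [/\ free b, forall v, v \in b -> P v & size b = n] >].
have Q0 : exists n, Q n.
  by exists 0%N; apply/asboolP; exists [::]; split=> //; rewrite nil_free.
have Qle n : Q n -> (n <= \dim (fullv : {vspace W}))%N.
  by move=> /asboolP[b [/eqP <- _ <-]]; apply: dimvS; apply: subvf.
case: (ex_maxnP Q0 Qle) => n /asboolP[b [fb Pb sb]] nmax; exists b; split=> // v Pv.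
apply/negPn/negP => vb; suff : Q n.+1 by move=> /nmax; rewrite ltnn.
apply/asboolP; exists (v :: b); split; first by rewrite free_cons vb.
  by move=> w; rewrite in_cons => /predU1P[->|/Pb].
by rewrite /= sb.
Qed.

Lemma sum_of_span (F : fieldType) (W : vectType F) (P : W -> Prop) (b : seq W) (v : W) :
  (forall w, P w -> w \in <<b>>%VS) -> sum_of P v -> v \in <<b>>%VS.
Proof.
by move=> h [s -> sP]; rewrite big_seq; apply: memv_suml => w /sP/h.
Qed.

Lemma weight_basis V (P : dual -> rep_space V -> Prop) :
  (forall v : rep_space V, sum_of (fun v => exists nu, P nu v) v) ->
  exists (b : seq (rep_space V)) (mu : rep_space V -> dual),
    basis_of fullv b /\ forall v, v \in b -> P (mu v) v.
Proof.
move=> h; have [b [fb bP bS]] := max_free (fun v => exists nu, P nu v).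
exists b, (fun v => xget (0 : dual) [set nu | P nu v]); split.
  rewrite /basis_of fb andbT eqEsubv subvf /=; apply/subvP => v _.
  exact: sum_of_span bS (h v).
by move=> v /bP[nu wv]; case: xgetP => [x _ //|/(_ nu)].
Qed.

(** * Weight bases and traces on weight spaces *)

Section WeightBasis.
Variables (V : lieRep K) (b : seq (rep_space V)) (mu : rep_space V -> dual).
Hypothesis bB : basis_of fullv b.
Hypothesis bw : forall v, v \in b -> wtv (V := V) (mu v) v.
Local Notation n := (size b).
Local Notation co := (coord (in_tuple b)).
Implicit Types (A : 'End(rep_space V)) (i j : 'I_(size b)) (nu : dual).

Lemma wb_expand v : v = \sum_i co i v *: b`_i.
Proof. exact: (coord_basis (X := in_tuple b) bB (memvf v)). Qed.

Lemma wb_mem i : b`_i \in b. Proof. exact: mem_nth. Qed.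

Lemma wb_co i j : co i b`_j = (i == j)%:R.
Proof. by rewrite (coord_free (X := in_tuple b)) ?(basis_free bB) // eq_sym. Qed.

Lemma wb_co_act i H v : co i (rep_act V (tinj H) v) = 'i * (mu b`_i H)%:C * co i v.
Proof.
rewrite {1}(wb_expand v) !linear_sum /= (bigD1 i) //= big1 ?addr0 => [|j ji].
  by rewrite !linearZ /= bw ?wb_mem // linearZ /= wb_co eqxx mulr1 mulrC.
rewrite !linearZ /= bw ?wb_mem // linearZ /= wb_co eq_sym (negPf ji).
by rewrite !mulr0.
Qed.

Lemma wb_co_wt nu v i : wtv (V := V) nu v -> co i v != 0 -> mu b`_i = nu.
Proof.
move=> wv ci; apply/eqP; rewrite -subr_eq0; apply/negPn/negP => /dual_neq0[H].
rewrite add_lfunE opp_lfunE subr_eq0; move/negP; apply.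
have := wb_co_act i H v; rewrite wv linearZ /= => /(mulIf ci).
by move=> /(mulfI imag_neq0) /(fmorph_inj (real_complex R)) ->.
Qed.

Lemma wb_eq0 nu v : wtv (V := V) nu v ->
  (forall i, mu b`_i = nu -> co i v = 0) -> v = 0.
Proof.
move=> wv h; rewrite [v]wb_expand big1 // => i _.
have [->|/[dup] ci /(wb_co_wt wv)/h c0] := eqVneq (co i v) 0; first exact: scale0r.
by rewrite c0 eqxx in ci.
Qed.

Lemma wb_dim nu : \dim (weight_space V nu) = count (fun v => mu v == nu) b.
Proof.
rewrite -size_filter; set bf := [seq v <- b | _].
have fbf : free bf by apply: filter_free; apply: (basis_free bB).
rewrite -(eqP fbf); apply/eqP; rewrite eqn_leq; apply/andP; split; apply: dimvS; last first.
  apply/span_subvP => v; rewrite mem_filter => /andP[/eqP <- vb].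
  by apply/wtvP; apply: bw.
apply/subvP => v /wtvP wv; rewrite [v]wb_expand; apply: memv_suml => i _.
have [->|/(wb_co_wt wv) e] := eqVneq (co i v) 0; first by rewrite scale0r mem0v.
by apply/memvZ/memv_span; rewrite mem_filter e eqxx wb_mem.
Qed.

Definition ment A i j : C := co i (A b`_j).

Lemma ment_comp A A' i j : ment (A \o A')%VF i j = \sum_k ment A i k * ment A' k j.
Proof.
rewrite /ment comp_lfunE {1}(wb_expand (A' b`_j)) !linear_sum /=.
by apply: eq_bigr => k _; rewrite !linearZ /= mulrC.
Qed.

Definition shifts_wt (a : dual) A : Prop :=
  forall nu v, wtv (V := V) nu v -> wtv (V := V) (nu + a) (A v).

Lemma ment_shift a A i j : shifts_wt a A -> ment A i j != 0 -> mu b`_i = mu b`_j + a.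
Proof. by move=> sA; apply: wb_co_wt; apply/sA/bw/wb_mem. Qed.

Definition wtr nu A : C := \sum_(i < size b | mu b`_i == nu) ment A i i.

Lemma wtrD nu A A' : wtr nu (A + A') = wtr nu A + wtr nu A'.
Proof.
by rewrite -big_split; apply: eq_bigr => i _; rewrite /ment add_lfunE linearD.
Qed.

Lemma wtrZ nu (c : C) A : wtr nu (c *: A) = c * wtr nu A.
Proof.
by rewrite mulr_sumr; apply: eq_bigr => i _; rewrite /ment scale_lfunE linearZ.
Qed.

Lemma wtr_sum nu (I : Type) (r : seq I) (F : I -> 'End(rep_space V)) :
  wtr nu (\sum_(p <- r) F p) = \sum_(p <- r) wtr nu (F p).
Proof.
apply: (big_morph (wtr nu)) => [A A'|]; first exact: wtrD.
by rewrite /wtr big1 // => i _; rewrite /ment zero_lfunE linear0.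
Qed.

Lemma wtr_scalar nu A (c : C) : (forall v, wtv (V := V) nu v -> A v = c *: v) ->
  wtr nu A = c * (\dim (weight_space V nu))%:R.
Proof.
move=> Ac; rewrite wb_dim -sum1_count natr_sum mulr_sumr [RHS](big_nth 0) big_mkord.
apply: eq_bigr => i /eqP iE; rewrite /ment Ac; last by rewrite -iE; apply/bw/wb_mem.
by rewrite linearZ /= wb_co eqxx.
Qed.

(** The identity tr(AA') = tr(A'A) for [A'] from weight nu to nu - a and [A] back; it links the
    traces of e f and f e on neighbouring weight spaces. *)
Lemma wtr_comm nu a A A' : shifts_wt a A -> shifts_wt (- a) A' ->
  wtr nu (A \o A')%VF = wtr (nu - a) (A' \o A)%VF.
Proof.
move=> sA sA'; rewrite /wtr.
transitivity (\sum_(i < size b | mu b`_i == nu) \sum_(k < size b | mu b`_k == nu - a)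
    ment A i k * ment A' k i).
  apply: eq_bigr => i /eqP iE; rewrite ment_comp [RHS]big_mkcond /=.
  apply: eq_bigr => k _; case: eqP => // kE.
  have [->|/(ment_shift sA) e] := eqVneq (ment A i k) 0; first by rewrite mul0r.
  by case: kE; rewrite -iE e addrK.
rewrite exchange_big /=; apply: eq_bigr => k /eqP kE; rewrite ment_comp [LHS]big_mkcond /=.
apply: eq_bigr => i _; case: eqP => [_|iE]; first exact: mulrC.
have [->|/(ment_shift sA') e] := eqVneq (ment A' k i) 0; first by rewrite mul0r.
by case: iE; rewrite -(subrK a (mu b`_i)) -e kE subrK.
Qed.

End WeightBasis.

Lemma root_vector_roots a X : root_vector a X -> X != 0 -> a = 0 \/ roots a.
Proof.
move=> ra X0; have [->|a0] := eqVneq a 0; [by left|right; split=> //].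
by exists X.
Qed.

Lemma zero_root_vectorE X : root_vector (0 : dual) X ->
  exists H1 H2, X = tinj H1 + 'i *: tinj H2.
Proof.
move=> /centralizer_torus[xt yt]; exists (vsproj t X.1), (vsproj t X.2).
rewrite /tinj /cplx_inj !vsprojK //; case: X {xt yt} => x y.
by congr pair; rewrite /= ?scale0r ?scale1r ?subr0 ?addr0 ?add0r ?scaler0 ?oppr0 ?addr0.
Qed.

Lemma roots_finite : exists2 s : seq dual, uniq s & forall a, a \in s <-> roots a.
Proof.
have [|b [mu [bB bw]]] := @weight_basis (ad_rep K) (fun nu v => wtv (V := ad_rep K) nu v).
  move=> u; have [s uE sP] := ad_weight_sum u; exists s => // x /sP[a ra].
  by exists a; apply/root_vectorE.
have bv v : v \in b -> root_vector (mu v) v by move=> /bw/root_vectorE.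
exists (undup [seq mu v | v <- b & mu v != 0]); first exact: undup_uniq.
move=> a; rewrite mem_undup; split=> [/mapP[v]|[a0 [X X0 ra]]].
  rewrite mem_filter => /andP[m0 vb] ->; split=> //; exists v; last exact: bv.
  exact: (free_not0 (basis_free bB) vb).
have /root_vectorE wX := ra.
have [i ci] : exists i, coord (in_tuple b) i X != 0.
  apply: contrapT => h; move/negP: X0; apply; apply/eqP.
  apply: (wb_eq0 bB bw wX) => i _; apply/eqP/negPn/negP => ci; apply: h.
  by exists i.
have e := wb_co_wt bB bw wX ci.
by apply/mapP; exists b`_i; rewrite // mem_filter e a0 wb_mem.
Qed.

End Torus.

(** * The root system of a compact Lie algebra *)

Section Setting.
Variables (R : realType) (K : simpleCompactLie R) (D : rootSetting K).
Local Notation g := (cplxification K).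
Local Notation t := (torus D).
Local Notation T := (subvs_of t).
Local Notation dual := (tdual t).
Local Notation roots := (@Defs.roots R K t).
Local Notation tP := (torusP D).
Local Notation pos_roots := (@Defs.pos_roots R K D).
Local Notation weight_lattice := (@Defs.weight_lattice R K D).
Local Notation chamber := (@Defs.chamber R K D).
Local Notation level_weights := (@Defs.level_weights R K D).
Implicit Types (H : T) (V : lieRep K) (X Y Z u : g) (a b mu nu x : dual).

Definition dual_ip a b : R := a (nu_inv b).

Fact dual_ip_linearl (c : R) x y z :
  dual_ip (c *: x + y) z = c * dual_ip x z + dual_ip y z.
Proof. by rewrite /dual_ip add_lfunE scale_lfunE. Qed.

Fact dual_ipC x y : dual_ip x y = dual_ip y x.
Proof. by rewrite /dual_ip -!inner_nu_inv inner_sym. Qed.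

Fact dual_ip_gt0 x : x != 0 -> 0 < dual_ip x x.
Proof. exact: inner_nu_gt0. Qed.

Lemma corootE x a : x (coroot a) = 2 * dual_ip x a / dual_ip a a.
Proof. by rewrite coroot_nu linearZ /= -[_ *: _]/(_ * _) mulrAC. Qed.

Let root_cid := cid2 (roots_finite tP).
Definition root_seq : seq dual := s2val root_cid.

Fact root_seq_uniq : uniq root_seq. Proof. exact: (s2valP root_cid). Qed.

Lemma root_seqP a : a \in root_seq <-> roots a.
Proof. exact: (s2valP' root_cid a). Qed.

Fact root_seq_neq0 : 0 \notin root_seq.
Proof. by apply/negP => /root_seqP[]; rewrite eqxx. Qed.

Fact root_seq_int a b : a \in root_seq -> b \in root_seq ->
  2 * dual_ip b a / dual_ip a a \is a Num.int.
Proof.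
move=> /root_seqP ra /root_seqP[b0 [X X0 /root_vectorE wX]]; rewrite -corootE.
exact: (weight_int tP ra wX X0).
Qed.

Lemma reflectionK a : a != 0 -> involutive (reflection a).
Proof.
move=> a0 x; rewrite /reflection add_lfunE opp_lfunE scale_lfunE coroot_id //.
rewrite -[_ *: 2]/(_ * 2) mulr_natr mulr2n opprD addrA subrr sub0r scaleNr opprK.
by rewrite subrK.
Qed.

Fact root_seq_refl a b : a \in root_seq -> b \in root_seq ->
  b - (2 * dual_ip b a / dual_ip a a) *: a \in root_seq.
Proof.
move=> /root_seqP ra /root_seqP[b0 [X X0 /root_vectorE/wtvP wX]].
rewrite -corootE -/(reflection a b); apply/root_seqP.
have a0 : a != 0 by case: ra.
split.
  apply: contra_neq b0 => h; rewrite -(reflectionK a0 b) h /reflection zero_lfunE.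
  by rewrite scale0r subr0.
set ws := weight_space (ad_rep K) (reflection a b).
exists (vpick ws); last by apply/root_vectorE/wtvP; apply: memv_pick.
rewrite vpick0 -dimv_eq0 (weight_refl_dim tP (ad_rep K) b ra) dimv_eq0 -vpick0.
apply: contraNneq X0 => h; move/eqP: h; rewrite vpick0 => /eqP h.
by move: wX; rewrite h memv0.
Qed.

Fact root_seq_red a : a \in root_seq -> a *+ 2 \notin root_seq.
Proof. by move=> /root_seqP ra; apply/negP => /root_seqP; apply: (root_mul2 tP). Qed.

Fact simple_basis : basis_of fullv (simple_roots D).
Proof. by case: (simple_rootsP D). Qed.

Fact simple_root_seq a : a \in simple_roots D -> a \in root_seq.
Proof. by case: (simple_rootsP D) => _ h _ /h/root_seqP. Qed.

Fact simple_sign a : a \in root_seq ->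
  (exists c : dual -> nat, a = \sum_(s <- simple_roots D) s *+ c s) \/
  (exists c : dual -> nat, - a = \sum_(s <- simple_roots D) s *+ c s).
Proof. by case: (simple_rootsP D) => _ _ h /root_seqP/h. Qed.

Definition setting_base : rootBase dual :=
  RootBase dual_ip_linearl dual_ipC dual_ip_gt0 root_seq_uniq root_seq_neq0
    root_seq_int root_seq_refl root_seq_red simple_basis simple_root_seq simple_sign.

Local Notation B := setting_base.

Lemma pairing_coroot x a : pairing B x a = x (coroot a).
Proof. by rewrite corootE. Qed.

Lemma srefl_reflection a x : srefl B a x = reflection a x.
Proof. by rewrite /srefl pairing_coroot. Qed.

Lemma posroots_pos a : a \in posroots B <-> pos_roots a.
Proof.
by split=> [/posrootsP[/root_seqP ra ca]|[/root_seqP ra ca]]; [split|apply/posrootsP].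
Qed.

Lemma weyl_vector_rho : weyl_vector B = rho D.
Proof.
rewrite /weyl_vector /rho; congr (_ *: _).
have -> : pos_roots = [set` posroots B] by apply/seteqP; split=> a /posroots_pos.
exact: (fsbig_seq _ _ (posroots_uniq B)).
Qed.

Lemma intweight_lattice x : intweight B x <-> weight_lattice x.
Proof.
split=> h a; first by move=> /root_seqP /h; rewrite pairing_coroot.
by move=> /root_seqP/h; rewrite pairing_coroot.
Qed.

Lemma dominant_chamber x : dominant B x <-> chamber x.
Proof.
by split=> h a ab; have := h a ab; rewrite -pairing_coroot.
Qed.

Local Notation theta := (theta D).

Lemma theta_root : theta \in Phi B.
Proof. by case: (thetaP D) => /root_seqP. Qed.

Lemma theta_high a : a \in Phi B -> cone B (theta - a).
Proof. by case: (thetaP D) => _ h /root_seqP /h. Qed.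

(** The squared norm of the coroot is 4/(theta|theta), so 2 is its own counterpart. *)
Lemma theta_norm : ip B theta theta = 2.
Proof.
have th0 : theta != 0 by apply: (root_neq0 theta_root).
have h : 0 < dual_ip theta theta by apply: inner_nu_gt0.
have := inner_normalized D; rewrite coroot_nu !linearZ /=.
have -> : inner ((2 / theta (nu_inv theta)) *: vsval (nu_inv theta))
   ((2 / theta (nu_inv theta)) *: vsval (nu_inv theta)) =
   (2 / dual_ip theta theta) ^+ 2 * dual_ip theta theta.
  rewrite !innerE inner_nu_inv -[theta (nu_inv theta)]/(dual_ip theta theta).
  by rewrite expr2 !mulrA.
move=> e; have : 4 / dual_ip theta theta = 2 by rewrite -[RHS]e; field; rewrite gt_eqF.
move=> /(congr1 ( *%R^~ (dual_ip theta theta))); rewrite divfK ?gt_eqF // => e2.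
by change (dual_ip theta theta = 2); lra.
Qed.

Lemma coroot_theta x : x (coroot theta) = ip B x theta.
Proof. by rewrite corootE -[dual_ip theta theta]/(ip B theta theta) theta_norm mulrAC divff ?mul1r ?pnatr_eq0. Qed.

Lemma dual_coxeterE : dual_coxeter D = 1 + ip B (weyl_vector B) theta.
Proof. by rewrite /dual_coxeter coroot_theta weyl_vector_rho. Qed.

Lemma level_weightsE k : level_weights k = level_wt B theta k.
Proof.
apply/seteqP; split=> x /=.
  by move=> [[/intweight_lattice ix /dominant_chamber dx]]; rewrite coroot_theta.
by move=> [/intweight_lattice ix /dominant_chamber dx h]; split; last by rewrite coroot_theta.
Qed.
End Setting.

(** * Highest weight modules and the Casimir operator *)

Lemma sum_of1 (W : zmodType) (P : W -> Prop) (u : W) : P u -> sum_of P u.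
Proof. by move=> Pu; exists [:: u]; rewrite ?big_seq1 // => x /[!inE] /eqP->. Qed.

Lemma sum_of0 (W : zmodType) (P : W -> Prop) : sum_of P 0.
Proof. by exists [::]; rewrite ?big_nil. Qed.

Lemma sum_ofD (W : zmodType) (P : W -> Prop) (u w : W) :
  sum_of P u -> sum_of P w -> sum_of P (u + w).
Proof.
move=> [s -> sP] [r -> rP]; exists (s ++ r); first by rewrite big_cat.
by move=> x; rewrite mem_cat => /orP[/sP|/rP].
Qed.

Lemma sum_of_lin (W W' : zmodType) (P : W -> Prop) (Q : W' -> Prop) (f : {additive W -> W'}) (u : W) :
  sum_of P u -> (forall x, P x -> sum_of Q (f x)) -> sum_of Q (f u).
Proof.
move=> [s -> sP] h; rewrite raddf_sum big_seq; apply: big_ind => //.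
- exact: sum_of0.
- exact: sum_ofD.
- by move=> x /sP/h.
Qed.

Section HighestWeight.
Variables (R : realType) (K : simpleCompactLie R) (D : rootSetting K).
Local Notation C := R[i].
Local Notation g := (cplxification K).
Local Notation t := (torus D).
Local Notation T := (subvs_of t).
Local Notation dual := (tdual t).
Local Notation roots := (@Defs.roots R K t).
Local Notation brk := (@cplx_bracket R K).
Local Notation tP := (torusP D).
Local Notation B := (setting_base D).
Local Notation wtv := (@wtv R K t _).
Implicit Types (H : T) (X Y Z u : g) (a b mu nu x : dual).
#[local] Opaque weight_space.

Variables (V : lieRep K) (l : dual) (v : rep_space V).
Hypothesis irrV : rep_irreducible V.
Hypothesis v0 : v != 0.
Hypothesis wv : wtv l v.
Hypothesis vhi : forall a X, a \in posroots B -> root_vector a X -> rep_act V X v = 0.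

(** These words replace ordered monomials of the enveloping algebra. Each is a weight vector by
    construction, so once they span, V has a weight basis; [lieRep] itself says nothing about how
    the torus acts. *)
Inductive word : nat -> rep_space V -> Prop :=
| word0 (c : C) : word 0 (c *: v)
| wordS m b Y w : b \in posroots B -> root_vector (- b) Y -> word m w ->
    word m.+1 (rep_act V Y w).

Let words m := sum_of (fun w => exists2 j, (j <= m)%N & word j w).

Lemma words_leq m n w : (m <= n)%N -> words m w -> words n w.
Proof.
move=> mn h; apply: sum_of_bind h _ => x [j jm wx]; apply: sum_of1.
by exists j; rewrite ?(leq_trans jm).
Qed.

Lemma words_lower m b Y w : b \in posroots B -> root_vector (- b) Y ->
  words m w -> words m.+1 (rep_act V Y w).
Proof.
move=> bp rY h; apply: sum_of_lin h _ => x [j jm wx]; apply: sum_of1.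
by exists j.+1 => //; apply: wordS rY wx.
Qed.

Lemma roots_sign a : roots a -> a \in posroots B \/ - a \in posroots B.
Proof. by move=> /root_seqP/(root_sign (B := B)). Qed.

(* Commuting [X] to the right, past the lowering operators, until it meets [v]. *)
Lemma word_raise m w : word m w -> forall a X, root_vector a X ->
  a = 0 \/ a \in posroots B -> words m (rep_act V X w).
Proof.
elim=> [c|{}m b Y {}w bp rY ww IH] a X rX aP.
  rewrite linearZ /=; case: aP => [a0|/vhi ->//]; last by rewrite scaler0; apply: sum_of0.
  rewrite a0 in rX; have [H1 [H2 ->]] := zero_root_vectorE tP rX.
  rewrite linearD linearZ add_lfunE scale_lfunE /= !wv !scalerA -scalerDl scalerA.
  by apply: sum_of1; exists 0%N => //; apply: word0.
have -> : rep_act V X (rep_act V Y w) =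
    rep_act V Y (rep_act V X w) + rep_act V (brk X Y) w.
  by rewrite rep_act_brk addrC subrK.
apply: sum_ofD; first exact: words_lower bp rY (IH _ _ rX aP).
have rZ := root_bracket rX rY; have [->|Z0] := eqVneq (brk X Y) 0.
  by rewrite linear0 zero_lfunE; apply: sum_of0.
have [ab0|/roots_sign[abp|abn]] := root_vector_roots rZ Z0.
- by apply: words_leq (IH _ _ rZ _) => //; left.
- by apply: words_leq (IH _ _ rZ _) => //; right.
- apply: words_lower abn _ _; first by rewrite opprK.
  by apply: sum_of1; exists m.
Qed.

Lemma word_act m w X a : word m w -> root_vector a X -> words m.+1 (rep_act V X w).
Proof.
move=> ww rX; have [->|X0] := eqVneq X 0.
  by rewrite linear0 zero_lfunE; apply: sum_of0.
have [a0|/roots_sign[ap|an]] := root_vector_roots rX X0.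
- by apply: words_leq (word_raise ww rX _) => //; left.
- by apply: words_leq (word_raise ww rX _) => //; right.
- apply: words_lower an _ _; first by rewrite opprK.
  by apply: sum_of1; exists m.
Qed.

Lemma wordZ m w (c : C) : word m w -> word m (c *: w).
Proof.
elim=> [d|{}m b Y {}w bp rY _ IH]; first by rewrite scalerA; apply: word0.
by rewrite -linearZ; apply: wordS rY IH.
Qed.

(** The span of the words contains v and is stable under root vectors and the torus, hence under g;
    irreducibility concludes. *)
Lemma words_full (u : rep_space V) : sum_of (fun w => exists m, word m w) u.
Proof.
have [b [fb bP bS]] := max_free (fun w : rep_space V => exists m, word m w).
have bE : <<b>>%VS = fullv.
  have [_ irr] := irrV; have [| |//] := irr <<b>>%VS; last first.
    move=> b0; have : v \in <<b>>%VS by apply: bS; exists 0%N; rewrite -[v]scale1r; apply: word0.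
    by rewrite b0 memv0 (negPf v0).
  move=> X; rewrite limg_span; apply/span_subvP => _ /mapP[w /bP[m ww] ->].
  apply: (@sum_of_span _ _ (fun w => exists m, word m w)) => //.
  have hw : words m.+1 (rep_act V X w).
    have [s -> sP] := ad_weight_sum tP X; rewrite linear_sum sum_lfunE big_seq.
    apply: big_ind; [exact: sum_of0|exact: sum_ofD|] => Y /sP[a rY].
    exact: word_act ww rY.
  by apply: sum_of_bind hw _ => x [j _ wx]; apply: sum_of1; exists j.
have : u \in <<b>>%VS by rewrite bE memvf.
move=> /(coord_span (X := in_tuple b)) ->; apply: big_ind; [exact: sum_of0|exact: sum_ofD|].
move=> i _; apply: sum_of1; have [|m wm] := bP b`_i; first exact: mem_nth.
by exists m; apply: wordZ.
Qed.

(** The last clause records that lowering leaves the weight l for good; it yields multiplicity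
    one. *)
Definition hw_vec nu w : Prop :=
  [/\ wtv nu w, cone B (l - nu) & nu = l -> w \in <[v]>%VS].

Lemma word_hw m w : word m w -> exists nu, hw_vec nu w.
Proof.
elim=> [c|{}m b Y {}w bp rY _ [nu [ww cw lw]]].
  exists l; split; last by move=> _; rewrite memvZ ?memv_line.
    by move=> H; rewrite linearZ /= wv !scalerA mulrC.
  by rewrite subrr; apply: cone0.
have cb : cone B b by case/posrootsP: bp.
exists (nu - b); split; first exact: root_act.
  by rewrite opprB addrCA; apply: coneD.
move=> /eqP; rewrite subr_eq => /eqP nuE.
have /(cone_opp cb) b0 : cone B (- b) by move: cw; rewrite nuE opprD addNKr.
by have := posroots_neq0 bp; rewrite b0 eqxx.
Qed.

Lemma hw_basis : exists (b : seq (rep_space V)) (mu : rep_space V -> dual),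
  basis_of fullv b /\ forall w, w \in b -> hw_vec (mu w) w.
Proof.
apply: weight_basis => u; apply: sum_of_bind (words_full u) _ => w [m /word_hw hw].
exact: sum_of1.
Qed.

Lemma weight_cone nu : \dim (weight_space V nu) != 0%N -> cone B (l - nu).
Proof.
have [b [mu [bB bw]]] := hw_basis.
have bw' w : w \in b -> wtv (mu w) w by move=> /bw[].
by rewrite (wb_dim bB bw') -lt0n -has_count => /hasP[w /bw[_ cw _] /eqP <-].
Qed.

Lemma weight_hw_dim : \dim (weight_space V l) = 1%N.
Proof.
have [b [mu [bB bw]]] := hw_basis.
have bw' w : w \in b -> wtv (mu w) w by move=> /bw[].
suff -> : weight_space V l = <[v]>%VS by rewrite dim_vline v0.
apply/eqP; rewrite eqEsubv; apply/andP; split; last first.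
  by rewrite -memvE; apply/wtvP.
apply/subvP => w /wtvP ww; rewrite (wb_expand bB w); apply: memv_suml => i _.
have [->|ci] := eqVneq (coord (in_tuple b) i w) 0; first by rewrite scale0r mem0v.
by have [_ _ h] := bw _ (wb_mem i); apply/memvZ/h/(wb_co_wt bB bw' ww ci).
Qed.

(** Schur's lemma with the eigenvalue read at v: the kernel of A - c is a submodule containing v. *)
Lemma scalar_of_comm (A : 'End(rep_space V)) (c : C) :
  (forall u w, A (rep_act V u w) = rep_act V u (A w)) -> A v = c *: v ->
  forall w, A w = c *: w.
Proof.
move=> Ac Av w; set U := lker (A - c *: \1)%VF.
have UP (x : rep_space V) : x \in U = (A x == c *: x).
  by rewrite memv_ker add_lfunE opp_lfunE scale_lfunE id_lfunE subr_eq0.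
have [_ irr] := irrV; have [| |Uf] := irr U.
- move=> u; apply/subvP => _ /memv_imgP[x /[!UP] /eqP Ax ->].
  by rewrite Ac Ax linearZ.
- by move=> U0; have := UP v; rewrite U0 memv0 Av eqxx (negPf v0).
- by apply/eqP; rewrite -UP Uf memvf.
Qed.

End HighestWeight.

(** * The Casimir operator and Freudenthal's formula *)

Section Casimir.
Variables (R : realType) (K : simpleCompactLie R) (D : rootSetting K).
Local Notation C := R[i].
Local Notation g := (cplxification K).
Local Notation t := (torus D).
Local Notation T := (subvs_of t).
Local Notation dual := (tdual t).
Local Notation roots := (@Defs.roots R K t).
Local Notation brk := (@cplx_bracket R K).
Local Notation tP := (torusP D).
Local Notation B := (setting_base D).
Local Notation wtv := (@wtv R K t _).
Implicit Types (H : T) (X Y Z u : g) (a b mu nu x : dual).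
#[local] Opaque weight_space.

Definition root_pair a : g * g :=
  xget (0, 0) [set p | p.1 != 0 /\ sl2_triple a p.1 p.2].

Local Notation E a := (root_pair a).1.
Local Notation F a := (root_pair a).2.

Lemma root_pairP a : a \in posroots B ->
  [/\ root_vector a (E a), root_vector (- a) (F a) & sl2_triple a (E a) (F a)].
Proof.
move=> /posrootsP[/root_seqP ra _]; have [e [f [e0 tr]]] := sl2_triple_ex tP ra.
rewrite /root_pair; case: xgetP => [p -> /= [_ tr']|/(_ (e, f)) []//].
by case: (tr').
Qed.

Definition root_scale a : C := (cform (E a) (F a))^-1.

Lemma root_scaleE a : a \in posroots B -> root_scale a = - (ip B a a / 2)%:C.
Proof.
move=> ap; have [_ _ tr] := root_pairP ap; have a0 := posroots_neq0 ap.
rewrite /root_scale (sl2_cform_neq0 tP a0 tr) -rmorphN -fmorphV /= -rmorphN /=.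
by congr (_%:C); rewrite invrN invf_div.
Qed.

Lemma root_scaleK a : a \in posroots B -> cform (E a) (F a) * root_scale a = 1.
Proof.
move=> ap; rewrite divff // -invr_eq0 -/(root_scale a) root_scaleE // oppr_eq0.
rewrite fmorph_eq0 mulf_neq0 ?invr_eq0 ?pnatr_eq0 // gt_eqF // ip_gt0 //.
exact: (posroots_neq0 ap).
Qed.

Definition coord_dual (j : 'I_(\dim {: T})) : dual := linfun (coord (vbasis {: T}) j : T -> R^o).

Definition torus_pair (j : 'I_(\dim {: T})) : g * g :=
  (tinj (vbasis {: T})`_j, tinj (nu_inv (coord_dual j))).

(* Dual bases of the complexification for [cform]. *)
Definition casimir_pairs : seq (g * g) :=
  map torus_pair (enum 'I_(\dim {: T}))
  ++ [seq (E a, root_scale a *: F a) | a <- posroots B]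
  ++ [seq (root_scale a *: F a, E a) | a <- posroots B].

Lemma casimir_pairs_sum (W : zmodType) (G : g * g -> W) :
  \sum_(p <- casimir_pairs) G p =
  \sum_j G (torus_pair j)
  + (\sum_(a <- posroots B) G (E a, root_scale a *: F a)
     + \sum_(a <- posroots B) G (root_scale a *: F a, E a)).
Proof.
rewrite /casimir_pairs !big_cat !big_map /=.
by rewrite -enumT big_enum.
Qed.

Definition casimir_sum u : g := \sum_(p <- casimir_pairs) cform u p.2 *: p.1.

Lemma casimir_sum_linear c u X : casimir_sum (c *: u + X) = c *: casimir_sum u + casimir_sum X.
Proof.
rewrite /casimir_sum scaler_sumr -big_split; apply: eq_bigr => p _ /=.
by rewrite cformDl cformZl scalerDl scalerA.
Qed.

Lemma root_vector_tinj H : root_vector (0 : dual) (tinj H).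
Proof. by move=> H'; rewrite [LHS](torus_abelian tP) zero_lfunE mulr0 scale0r. Qed.

Lemma cform_tinj H H' : cform (tinj H) (tinj H') = (inner (vsval H) (vsval H'))%:C.
Proof. by rewrite /cform /= !inner0r inner0l subr0 addr0. Qed.

Lemma casimir_sum_tinj H : casimir_sum (tinj H) = tinj H.
Proof.
rewrite /casimir_sum casimir_pairs_sum /= [X in _ + (X + _)]big1_seq => [|a /andP[_ ap]]; last first.
  have [_ rF _] := root_pairP ap; rewrite cformZr.
  rewrite (root_cform0 (root_vector_tinj H) rF) ?mulr0 ?scale0r //.
  by rewrite add0r oppr_eq0 (posroots_neq0 ap).
rewrite add0r [X in _ + X]big1_seq => [|a /andP[_ ap]]; last first.
  have [rE _ _] := root_pairP ap.
  rewrite (root_cform0 (root_vector_tinj H) rE) ?scale0r //.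
  by rewrite add0r (posroots_neq0 ap).
rewrite addr0 [in RHS](coord_vbasis (memvf H)).
rewrite (big_morph _ (@tinjD R K t) (@tinj0 R K t)).
apply: eq_bigr => j _; rewrite tinjZ; congr (_ *: _).
by rewrite cform_tinj inner_sym inner_nu_inv lfunE.
Qed.

Lemma posrootsD_neq0 a b : a \in posroots B -> b \in posroots B -> a + b != 0.
Proof.
move=> ap /posrootsP[_ cb]; apply/negP => /eqP ab; have := posroots_neq0 ap.
have /posrootsP[_ ca] := ap; have aE : a = - b by apply/eqP; rewrite -addr_eq0 ab.
by rewrite (cone_opp ca) ?eqxx // aE opprK.
Qed.

Lemma casimir_sum_E a : a \in posroots B -> casimir_sum (E a) = E a.
Proof.
move=> ap; have [rE rF _] := root_pairP ap; have a0 := posroots_neq0 ap.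
rewrite /casimir_sum casimir_pairs_sum /= big1 => [|j _]; last first.
  by rewrite (root_cform0 rE (root_vector_tinj _)) ?scale0r // addr0.
rewrite add0r [X in _ + X]big1_seq => [|b /andP[_ bp]]; last first.
  have [rE' _ _] := root_pairP bp.
  by rewrite (root_cform0 rE rE') ?scale0r // posrootsD_neq0.
rewrite addr0 (bigD1_seq a) ?posroots_uniq //= cformZr mulrC root_scaleK // scale1r.
rewrite big_seq_cond big1 ?addr0 // => b /andP[bp ba]; have [_ rF' _] := root_pairP bp.
by rewrite cformZr (root_cform0 rE rF') ?mulr0 ?scale0r // subr_eq0 eq_sym.
Qed.

Lemma casimir_sum_F a : a \in posroots B -> casimir_sum (F a) = F a.
Proof.
move=> ap; have [rE rF _] := root_pairP ap; have a0 := posroots_neq0 ap.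
rewrite /casimir_sum casimir_pairs_sum /= big1 => [|j _]; last first.
  by rewrite (root_cform0 rF (root_vector_tinj _)) ?scale0r // addr0 oppr_eq0.
rewrite add0r [X in X + _]big1_seq => [|b /andP[_ bp]]; last first.
  have [_ rF' _] := root_pairP bp.
  by rewrite cformZr (root_cform0 rF rF') ?mulr0 ?scale0r // -opprD oppr_eq0 posrootsD_neq0.
rewrite add0r (bigD1_seq a) ?posroots_uniq //= scalerA (cformC (F a)) root_scaleK // scale1r.
rewrite big_seq_cond big1 ?addr0 // => b /andP[bp ba]; have [rE' _ _] := root_pairP bp.
by rewrite (root_cform0 rF rE') ?scale0r // addrC subr_eq0.
Qed.

Lemma cform_suml (I : Type) (r : seq I) (G : I -> g) X :
  cform (\sum_(i <- r) G i) X = \sum_(i <- r) cform (G i) X.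
Proof.
by elim: r => [|i r IH]; rewrite ?big_nil ?cform0l // !big_cons cformDl IH.
Qed.

Lemma casimir_expand u : u = \sum_(p <- casimir_pairs) cform u p.2 *: p.1.
Proof.
rewrite -/(casimir_sum u); have e0 : casimir_sum 0 = 0.
  by rewrite /casimir_sum big1 // => p _; rewrite cform0l scale0r.
have eZ c X : casimir_sum X = X -> casimir_sum (c *: X) = c *: X.
  by move=> h; rewrite -[c *: X]addr0 casimir_sum_linear h e0 addr0.
have eD X Y : casimir_sum X = X -> casimir_sum Y = Y -> casimir_sum (X + Y) = X + Y.
  by move=> hX hY; rewrite -[X]scale1r casimir_sum_linear hX hY.
have [s -> sP] := ad_weight_sum tP u; rewrite big_seq.
apply: (big_ind (fun X => X = casimir_sum X)) => // [X Y hX hY|X /sP[a rX]].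
  by rewrite eD.
apply: esym; have [->//|X0] := eqVneq X 0.
have [a0|/root_seqP/(root_sign (B := B))[ap|an]] := root_vector_roots rX X0.
- rewrite a0 in rX; have [H1 [H2 ->]] := zero_root_vectorE tP rX.
  by apply: eD; [|apply: eZ]; apply: casimir_sum_tinj.
- have [_ _ tr] := root_pairP ap.
  have [c ->] := root_space_dim1 tP (posroots_neq0 ap) tr rX.
  exact/eZ/casimir_sum_E.
- have [_ _ /sl2_tripleN tr] := root_pairP an; rewrite opprK in tr.
  have a0 : a != 0 by rewrite -oppr_eq0 (posroots_neq0 an).
  have [c ->] := root_space_dim1 tP a0 tr rX.
  exact/eZ/casimir_sum_F.
Qed.

(** Test the difference against its own conjugate w: expanding w by [casimir_expand] and using the
    symmetry of the form exchanges the two dual bases. *)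
Lemma casimir_expand_sym u : u = \sum_(p <- casimir_pairs) cform u p.1 *: p.2.
Proof.
apply/eqP; rewrite -subr_eq0; apply/eqP/cform_cconj_eq0.
set w := cconj _; rewrite cformDl cformNl; apply/eqP; rewrite subr_eq0; apply/eqP.
rewrite {1}(casimir_expand w) cformC.
rewrite !cform_suml.
by apply: eq_bigr => p _; rewrite !cformZl mulrC (cformC p.1) (cformC p.2).
Qed.

Section Rep.
Variable V : lieRep K.

Definition casimir : 'End(rep_space V) :=
  \sum_(p <- casimir_pairs) (rep_act V p.1 \o rep_act V p.2)%VF.

(** The commutator with u is the sum of [u, p.1] p.2 and p.1 [u, p.2]. Expanding the brackets in the
    dual bases gives the same double sum twice, with opposite signs by invariance of the form. *)
Lemma casimir_comm u w : casimir (rep_act V u w) = rep_act V u (casimir w).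
Proof.
have act_sum (s : seq (g * g)) (G : g * g -> g) (x : rep_space V) :
    rep_act V (\sum_(p <- s) G p) x = \sum_(p <- s) rep_act V (G p) x.
  by rewrite linear_sum sum_lfunE.
rewrite /casimir !sum_lfunE linear_sum; apply/eqP; rewrite eq_sym -subr_eq0 -sumrB.
have step p : rep_act V u ((rep_act V p.1 \o rep_act V p.2)%VF w)
    - (rep_act V p.1 \o rep_act V p.2)%VF (rep_act V u w)
  = rep_act V (brk u p.1) (rep_act V p.2 w) + rep_act V p.1 (rep_act V (brk u p.2) w).
  by rewrite !comp_lfunE !rep_act_brk linearB /= addrA subrK.
rewrite (eq_bigr _ (fun p _ => step p)) big_split /= addr_eq0 -sumrN.
under eq_bigr => p _ do rewrite (casimir_expand (brk u p.1)) act_sum.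
under [eqbRHS]eq_bigr => p _ do rewrite (casimir_expand_sym (brk u p.2)) act_sum linear_sum -sumrN.
rewrite [eqbRHS]exchange_big /=; apply/eqP; apply: eq_bigr => p _; apply: eq_bigr => q _.
rewrite !linearZ /= !scale_lfunE linearZ /= -scaleNr; congr (_ *: _).
by rewrite (cform_invariant u q.2) opprK (cformC q.2).
Qed.

Lemma wtv_coroot_act x a w : a \in posroots B -> wtv x w ->
  rep_act V (E a) (rep_act V (F a) w) - rep_act V (F a) (rep_act V (E a) w) =
  (x (coroot a))%:C *: w.
Proof.
move=> ap ww; have [_ _ [_ _ ef]] := root_pairP ap.
rewrite -rep_act_brk ef linearZ scale_lfunE ww scalerA mulNr mulrA -expr2 sqr_i.
by rewrite mulN1r opprK.
Qed.

Lemma casimir_wtv x w : wtv x w -> casimir w = - (ip B x x)%:C *: w +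
  \sum_(a <- posroots B) root_scale a *: (rep_act V (E a) (rep_act V (F a) w)
                                         + rep_act V (F a) (rep_act V (E a) w)).
Proof.
move=> ww; rewrite /casimir sum_lfunE casimir_pairs_sum -big_split /=; congr (_ + _).
  under eq_bigr => j _ do rewrite comp_lfunE ww linearZ /= ww scalerA.
  rewrite -scaler_suml; congr (_ *: _).
  have -> : dual_ip x x = \sum_j x (nu_inv (coord_dual j)) * x (vbasis {: T})`_j.
    rewrite /dual_ip [in LHS](coord_vbasis (memvf (nu_inv x))) linear_sum.
    apply: eq_bigr => j _; rewrite linearZ /=; congr (_ * _).
    by rewrite -[RHS]inner_nu_inv inner_sym inner_nu_inv lfunE.
  rewrite rmorph_sum -sumrN; apply: eq_bigr => j _; rewrite rmorphM /=.
  by rewrite mulrACA -expr2 sqr_i mulN1r.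
apply: eq_bigr => a _; rewrite !comp_lfunE !linearZ /= !scale_lfunE linearZ /=.
by rewrite scalerDr.
Qed.

Variables (l : dual) (v : rep_space V).
Hypothesis irrV : rep_irreducible V.
Hypothesis v0 : v != 0.
Hypothesis wv : wtv l v.
Hypothesis vhi : forall a X, a \in posroots B -> root_vector a X -> rep_act V X v = 0.
Local Notation rho := (weyl_vector B).
Local Notation mult x := ((\dim (weight_space V x))%:R : R).

(** The scalar is read on the highest weight vector. The sign comes from the real roots: the torus
    part acts by i^2 (l|l), and each positive root adds -(l|a), for a total of -(l|2 rho). *)
Lemma casimir_scalar w :
  casimir w = - (ip B (l + rho) (l + rho) - ip B rho rho)%:C *: w.
Proof.
apply: (scalar_of_comm irrV v0 casimir_comm); rewrite (casimir_wtv wv).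
have -> : ip B (l + rho) (l + rho) - ip B rho rho = ip B l l + \sum_(a <- posroots B) ip B l a.
  rewrite -ip_sumr; have -> : \sum_(a <- posroots B) a = 2 *: rho.
    by rewrite /weyl_vector scalerA divff ?scale1r ?pnatr_eq0.
  by rewrite ipDl !ipDr ipZr [ip _ rho l]ipC; ring.
rewrite rmorphD opprD scalerDl; congr (_ + _).
rewrite rmorph_sum -sumrN scaler_suml !big_seq; apply: eq_bigr => a ap.
have [rE _ _] := root_pairP ap; have := wtv_coroot_act ap wv.
rewrite (vhi ap rE) linear0 subr0 addr0 => ->; rewrite scalerA root_scaleE //.
rewrite mulNr -rmorphM /= -pairing_coroot /pairing; congr (- _%:C *: _).
change (ip B a a / 2 * (2 * ip B l a / ip B a a) = ip B l a).
by field; rewrite gt_eqF // ip_gt0 // (posroots_neq0 ap).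
Qed.

Lemma irr_weight_mult : irr_mult B l (fun x => mult x).
Proof.
have [b [mu [bB bw]]] := hw_basis irrV v0 wv vhi.
have bw' w : w \in b -> wtv (mu w) w by move=> /bw[].
split.
- exists [seq mu w | w <- b] => x; rewrite pnatr_eq0 (wb_dim bB bw') -lt0n -has_count.
  by move=> /hasP[w wb /eqP <-]; apply: map_f.
- move=> a x aB; have ra : roots a by apply/root_seqP/simple_root_seq.
  have e := weight_refl_dim tP V x ra.
  rewrite srefl_reflection.
  exact: (congr1 (fun n => n%:R : R) e).
- by move=> x; rewrite pnatr_eq0; apply: (weight_cone irrV v0 wv vhi).
- by rewrite (weight_hw_dim irrV v0 wv vhi).
pose ef a : 'End(rep_space V) := (rep_act V (E a) \o rep_act V (F a))%VF.
pose fe a : 'End(rep_space V) := (rep_act V (F a) \o rep_act V (E a))%VF.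
pose c a := ip B a a / 2.
(* The shift by a/2 makes [dlt a] the trace of e f on x minus that on x + a; the latter is the trace
   of f e on x, and the commutator acts there by x(coroot). Real parts bring the traces from [R[i]]
   into [R]. *)
exists (fun a x => c a * complex.Re (wtr b mu (x + 2^-1 *: a) (ef a))).
have half x a : x + 2^-1 *: a + 2^-1 *: a = x + a.
  by rewrite -addrA -scalerDl (_ : 2^-1 + 2^-1 = 1 :> R) ?scale1r //; field.
have shift x a : a \in posroots B -> wtr b mu (x + a) (ef a) = wtr b mu x (fe a).
  move=> ap; have [rE rF _] := root_pairP ap.
  have sE : shifts_wt a (rep_act V (E a)) by move=> y w; apply: root_act.
  have sF : shifts_wt (- a) (rep_act V (F a)) by move=> y w; apply: root_act.
  by rewrite (wtr_comm bB bw' (x + a) sE sF) addrK.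
split=> [a x ap|x].
  rewrite /dlt subrK half shift // -mulrBr.
  have : wtr b mu x (ef a - fe a) = (x (coroot a))%:C * (mult x)%:C.
    rewrite rmorph_nat; apply: (wtr_scalar bB bw') => w ww.
    by rewrite add_lfunE opp_lfunE !comp_lfunE (wtv_coroot_act ap ww).
  rewrite -scaleN1r wtrD wtrZ mulN1r -rmorphM /= => /(congr1 (@complex.Re R)).
  rewrite raddfB /= => ->; rewrite -pairing_coroot.
  change (ip B a a / 2 * (2 * ip B x a / ip B a a * mult x) = ip B a x * mult x).
  rewrite (ipC B a x).
  by field; rewrite gt_eqF // ip_gt0 // (posroots_neq0 ap).
have : wtr b mu x casimir =
    - (ip B (l + rho) (l + rho) - ip B rho rho)%:C * (mult x)%:C.
  by rewrite rmorph_nat; apply: (wtr_scalar bB bw') => w _; apply: casimir_scalar.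
(* The torus part of the Casimir operator, a scalar on each weight space. *)
pose A := casimir - \sum_(a <- posroots B) root_scale a *: (ef a + fe a).
have -> : casimir = A + \sum_(a <- posroots B) root_scale a *: (ef a + fe a) by rewrite subrK.
rewrite wtrD wtr_sum (wtr_scalar (c := - (ip B x x)%:C) bB bw'); last first.
  move=> w ww; rewrite /A add_lfunE opp_lfunE (casimir_wtv ww) sum_lfunE.
  rewrite -addrA [X in _ + X]addrC [X in _ + X](_ : _ = 0) ?addr0 //.
  apply/eqP; rewrite addrC subr_eq0; apply/eqP; apply: eq_bigr => a _.
  by rewrite scale_lfunE add_lfunE !comp_lfunE.
have -> : \sum_(a <- posroots B) wtr b mu x (root_scale a *: (ef a + fe a)) =
    - \sum_(a <- posroots B) (c a)%:C * (wtr b mu x (ef a) + wtr b mu x (fe a)).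
  rewrite -sumrN !big_seq; apply: eq_bigr => a ap.
  by rewrite wtrZ wtrD root_scaleE // mulNr.
rewrite !mulNr -opprD => /oppr_inj; rewrite -(rmorph_nat (real_complex R)) -!rmorphM /=.
move=> /(congr1 (@complex.Re R)) /= => <-; rewrite raddfD /= raddf_sum /=.
congr (_ + _); rewrite !big_seq; apply: eq_bigr => a ap.
rewrite /sgm subrK half shift // -mulrDr -raddfD /=.
by case: (_ + _) => p q /=; rewrite mul0r subr0.
Qed.

End Rep.
End Casimir.

(** * The Dirichlet problem on the alcove *)

Section Dirichlet.
Variables (R : realType) (K : simpleCompactLie R) (D : rootSetting K).
Variable V : tdual (torus D) -> lieRep K.
Hypothesis HV : is_irr_family V.
Local Notation C := R[i].
Local Notation t := (torus D).
Local Notation dual := (tdual t).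
Local Notation roots := (@Defs.roots R K t).
Local Notation tP := (torusP D).
Local Notation B := (setting_base D).
Local Notation theta := (theta D).
Local Notation wtv := (@wtv R K t _).
Local Notation weight_lattice := (@Defs.weight_lattice R K D).
Local Notation dom_weights := (@Defs.dom_weights R K D).
Local Notation level_weights := (@Defs.level_weights R K D).
Implicit Types (a b l mu nu x y s : dual).
#[local] Opaque weight_space.

Definition real_mult l x : R := (weight_mult V l x)%:R.

Lemma real_multP l : intweight B l -> dominant B l -> irr_mult B l (real_mult l).
Proof.
move=> /intweight_lattice il /dominant_chamber dl.
have [irr [v [v0 /wtvP wv vhi]]] := HV (conj il dl).
apply: (irr_weight_mult irr v0 wv) => a X /posroots_pos ap; exact: vhi.
Qed.

Lemma weight_mult_lattice l x : dom_weights l -> weight_mult V l x != 0%N -> weight_lattice x.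
Proof.
move=> dl; have [irr [v [v0 /wtvP wv vhi]]] := HV dl; have [il _] := dl.
move=> x0; have : cone B (l - x).
  by apply: (weight_cone irr v0 wv _ x0) => a X /posroots_pos ap; apply: vhi.
move=> /intweight_cone ix; apply/intweight_lattice.
by rewrite -(subKr l x); apply: intweightB => //; apply/intweight_lattice.
Qed.

Lemma rep_dim_neq0 l : dom_weights l -> (rep_dim (V l))%:R != 0 :> C.
Proof. by move=> /HV[[d0 _] _]; rewrite pnatr_eq0 -lt0n. Qed.

Lemma weyl_ip w x : weyl w -> ip B (w x) (w x) = ip B x x.
Proof.
move=> ww; elim: ww => //= a {}w /root_seqP ra _ <-.
rewrite -srefl_reflection; apply: (@srefl_ip _ _ B).
by apply: (@root_neq0 _ _ B).
Qed.

(** All weights have the norm of c, being in its orbit. If nu paired with a coroot to 2 or more, f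
    would not kill its weight vectors and nu - a would be a weight; equality of norms then forces
    the pairing to be 1. *)
Lemma minuscule_pairing c nu : minuscule V c -> weight_mult V c nu != 0%N ->
  forall a, roots a -> `|nu (coroot a)| <= 1.
Proof.
move=> [dc cw] nuw.
have norm x : weight_mult V c x != 0%N -> ip B x x = ip B c c.
  move=> x0; have : [set b | weight_mult V c b != 0%N] x by [].
  by rewrite cw => -[w ww ->]; apply: weyl_ip.
have [v vV v0] : exists2 v, v \in weight_space (V c) nu & v != 0.
  exists (vpick (weight_space (V c) nu)); first exact: memv_pick.
  by rewrite vpick0 -dimv_eq0.
move/wtvP: vV => wv.
have le1 a : roots a -> nu (coroot a) <= 1.
  move=> ra; have a0 : a != 0 by case: ra.
  have [e [f [_ tr]]] := sl2_triple_ex tP ra.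
  have := weight_int tP ra wv v0; rewrite leNgt => /intrP[m mE]; apply/negP.
  rewrite mE (ltr_int _ 1) => m1.
  have [n nE] : exists n, m = n.+2%:Z by exists (`|m|%N - 2)%N; lia.
  have fv0 : rep_act (V c) f v != 0.
    apply: contra_neq v0 => fv; apply: (sl2_iter_inj a0 tr (n := n.+2) wv).
      by rewrite mE nE.
    by rewrite iterSr fv; elim: {nE} n.+1 => //= j ->; rewrite linear0.
  have : weight_mult V c (nu - a) != 0%N.
    rewrite /weight_mult dimv_eq0; apply: contraNneq fv0 => w0.
    rewrite -memv0 -w0; apply/wtvP; case: tr => _ rf _; exact: root_act rf wv.
  move=> /norm; rewrite -(norm _ nuw) ipBl !ipBr => h.
  have : pairing B nu a = 1.
    rewrite /pairing; apply: (canLR (mulfK _)); first by rewrite gt_eqF // ip_gt0.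
    by rewrite mul1r; move: h; rewrite (ipC B a nu); lra.
  by rewrite pairing_coroot mE => /eqP; rewrite (eqr_int _ _ 1) => /eqP; lia.
move=> a ra; have := le1 _ (roots_opp ra); rewrite corootN linearN /= lerNl => lea.
by rewrite ler_norml lea le1.
Qed.

Section AtLevel.
Variable k : nat.
Local Notation chi := (chi V k).
Local Notation fchar := (fchar B theta k real_mult).

Lemma level_dom l : level_weights k l -> dom_weights l.
Proof. by case. Qed.

Lemma level_lattice l : level_weights k l -> weight_lattice l.
Proof. by case=> -[]. Qed.

Lemma chi_fchar l s : dom_weights l -> chi l s = fchar l s.
Proof.
move=> dl; rewrite /Defs.chi /ch /fchar /ev.
rewrite -(@fsbig_widen _ _ _ _ weight_lattice [set: dual]) //; last first.
  move=> x [_ nx]; apply/eqP; rewrite /= /real_mult.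
  have [->|/(weight_mult_lattice dl)//] := eqVneq (weight_mult V l x) 0%N.
  by rewrite mul0r.
apply: eq_fsbigr => x _; rewrite /real_mult rmorph_nat /wave linearN /= nu_invZ linearZ /=.
rewrite -[_ *: _]/(_ * _) -[x (nu_inv _)]/(ip B x _) -weyl_vector_rho.
by rewrite /level_M dual_coxeterE addrA.
Qed.

Lemma chi_gt0 l : level_weights k l -> 0 < chi l 0.
Proof.
move=> ll; rewrite chi_fchar; last exact: level_dom.
apply: (fchar_gt0 (theta_root D) (@theta_high _ _ D) real_multP).
by rewrite -level_weightsE.
Qed.

Lemma chi_trivial s : level_weights k s -> chi 0 s = 1.
Proof.
rewrite level_weightsE => ls; rewrite chi_fchar.
  exact: (fchar0 (theta_root D) (@theta_high _ _ D) real_multP ls).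
by apply: level_dom; rewrite level_weightsE; apply: level0.
Qed.

Lemma level_weights_seq : exists2 r : seq dual, uniq r & level_weights k = [set` r].
Proof.
have /finite_seqP[r rE] := level_finite k (@theta_high _ _ D).
exists (undup r); first exact: undup_uniq.
by rewrite level_weightsE rE; apply/seteqP; split=> x /=; rewrite mem_undup.
Qed.

Lemma chi_minuscule l c s : minuscule V c -> level_weights k l -> level_weights k c ->
  level_weights k s ->
  chi c s * chi l s = \sum_(b \in level_weights k) (weight_mult V c (b - l))%:R * chi b s.
Proof.
move=> mc ll lc ls; have dl := level_dom.
rewrite !chi_fchar; [|exact: dl..].
rewrite (fchar_minuscule (theta_root D) (@theta_high _ _ D) (theta_norm D) real_multP)
  -?level_weightsE //.
  apply: eq_fsbigr => b; rewrite inE => lb; rewrite chi_fchar; last exact: dl.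
  by rewrite /real_mult rmorph_nat.
move=> nu; rewrite pnatr_eq0 => nu0; split.
  by apply/intweight_lattice; apply: weight_mult_lattice nu0; apply: dl.
by move=> a /root_seqP ra; rewrite pairing_coroot; apply: (minuscule_pairing mc nu0).
Qed.

Lemma fusion_minuscule N l c b : is_fusion V k N -> minuscule V c ->
  level_weights k l -> level_weights k c -> level_weights k b ->
  N l c b = weight_mult V c (b - l).
Proof.
move=> HN mc ll lc lb.
suff : (N l c b)%:R - (weight_mult V c (b - l))%:R = 0 :> C.
  by move/eqP; rewrite subr_eq0 eqr_nat => /eqP.
rewrite level_weightsE in lb.
apply: (fchar_independent (theta_root D) (@theta_high _ _ D) (theta_norm D) real_multP
  (c := fun b => (N l c b)%:R - (weight_mult V c (b - l))%:R) _ lb) => s.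
rewrite -level_weightsE => ls.
have [r ur rE] := level_weights_seq.
have := HN _ _ _ ll lc ls; rewrite mulrC (chi_minuscule mc ll lc ls) rE -!fsbig_seq // => e.
rewrite (eq_big_seq (fun a => (N l c a)%:R * chi a s - (weight_mult V c (a - l))%:R * chi a s)).
  by rewrite sumrB e subrr.
by move=> a ar; rewrite mulrBl chi_fchar //; apply: level_dom; rewrite rE.
Qed.

Lemma eigenfunE s x : level_weights k x -> eigenfun V k s x = chi x s.
Proof. by move=> lx; rewrite /eigenfun patchT ?inE. Qed.

Lemma eigenfun_out s x : ~ level_weights k x -> eigenfun V k s x = 0.
Proof. by move=> nx; rewrite /eigenfun patchC // inE. Qed.

Lemma p_kernel_chi c s x : minuscule V c -> level_weights k c ->
  level_weights k s -> level_weights k x ->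
  \sum_(y \in level_weights k) (p_kernel V c x y)%:C * chi y s =
  (rep_dim (V c))%:R^-1 * chi c s * chi x s.
Proof.
move=> mc lc ls lx; rewrite -mulrA (chi_minuscule mc lx lc ls).
rewrite mulr_fsumr; apply: eq_fsbigr => y _.
by rewrite /p_kernel rmorphM fmorphV !rmorph_nat mulrCA mulrA.
Qed.

Lemma dirichlet_level x : level_weights k x -> dirichlet_domain k x.
Proof.
move=> [[xP xC] xk]; split=> //; split=> [a aS|].
  rewrite add_lfunE addr_ge0 ?xC // -weyl_vector_rho -pairing_coroot.
  by rewrite pairing_rho ?ler01.
by rewrite add_lfunE /dual_coxeter addrA lerD // ler_wpDr ?ler01.
Qed.

Lemma eigenfun_dirichlet c s : minuscule V c -> level_weights k c -> level_weights k s ->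
  dirichlet_eigen V k c (1 - (rep_dim (V c))%:R^-1 * chi c s) (eigenfun V k s).
Proof.
move=> mc lc ls; have l0 : level_weights k 0 by rewrite level_weightsE; apply: level0.
split.
- exists 0; first exact: dirichlet_level.
  by rewrite eigenfunE // chi_trivial // oner_eq0.
- move=> x lx; rewrite /laplacian /p_apply.
  rewrite -(@fsbig_widen _ _ _ _ (level_weights k)); last 2 first.
  + exact: level_lattice.
  + by move=> y [_ ny] /=; rewrite patchC ?mulr0 // inE.
  have -> : \sum_(y \in level_weights k) (p_kernel V c x y)%:C *
      patch (fun=> 0) (level_weights k) (eigenfun V k s) y =
    \sum_(y \in level_weights k) (p_kernel V c x y)%:C * chi y s.
    by apply: eq_fsbigr => y; rewrite inE => ly; rewrite patchT ?inE // eigenfunE.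
  by rewrite p_kernel_chi // eigenfunE //; ring.
- by move=> x _; apply: eigenfun_out.
Qed.

(* An eigenvector attains the bound at a point maximizing [|f| / f_0], where [f_0]
   is the positive eigenfunction. *)
Lemma restr_eigenvalue_le c (mu : C) : minuscule V c -> level_weights k c ->
  restr_eigenvalue V k c mu -> `|mu| <= (rep_dim (V c))%:R^-1 * chi c 0.
Proof.
move=> mc lc [f [x0 lx0 fx0] fE].
have l0 : level_weights k 0 by rewrite level_weightsE; apply: level0.
have [r ur rE] := level_weights_seq.
have rP x : level_weights k x <-> x \in r by rewrite rE.
(* Modulus and character are real elements of [R[i]]; their real parts are taken because
   [seq_argmax] maximizes over [R]. *)
pose h x : R := complex.Re `|f x| / complex.Re (chi x 0).
have cE x : level_weights k x -> (complex.Re (chi x 0))%:C = chi x 0.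
  by move=> /chi_gt0/ltW/ger0_real/RRe_real.
have c0 x : level_weights k x -> complex.Re (chi x 0) != 0.
  by move=> lx; have := chi_gt0 lx; rewrite -cE // ltcR => /gt_eqF->.
have hE x : level_weights k x -> `|f x| = (h x)%:C * chi x 0.
  move=> lx; rewrite -(cE _ lx) -rmorphM /h divfK ?c0 //.
have [x1 x1r hmax] := seq_argmax h (proj1 (rP x0) lx0).
have lx1 := proj2 (rP x1) x1r.
have h1 : 0 < h x1.
  apply: lt_le_trans (hmax x0 (proj1 (rP x0) lx0)).
  have := normr_gt0 (f x0); rewrite fx0 hE // pmulr_lgt0 ?chi_gt0 //.
  by rewrite ltcR => ->.
have : `|mu| * `|f x1| <= (rep_dim (V c))%:R^-1 * chi c 0 * `|f x1|.
  rewrite -normrM -fE // rE -fsbig_seq // (le_trans (ler_norm_sum _ _ _)) //.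
  rewrite (hE x1) // mulrCA -(p_kernel_chi mc lc l0 lx1) rE -fsbig_seq // mulr_sumr.
  rewrite !big_seq; apply: ler_sum => y yr; have ly := proj2 (rP y) yr.
  have p0 : 0 <= (p_kernel V c x1 y)%:C by rewrite lecR divr_ge0 ?ler0n.
  rewrite normrM (ger0_norm p0) mulrCA ler_wpM2l // hE // ler_wpM2r ?(ltW (chi_gt0 ly)) //.
  by rewrite lecR hmax.
by rewrite ler_pM2r // hE // mulr_gt0 ?chi_gt0 // ltcR.
Qed.

Lemma eigenfun_perron c : minuscule V c -> level_weights k c ->
  perron_frobenius V k c (eigenfun V k 0).
Proof.
move=> mc lc; have l0 : level_weights k 0 by rewrite level_weightsE; apply: level0.
exists (1 - (rep_dim (V c))%:R^-1 * chi c 0); split.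
- exact: eigenfun_dirichlet.
- by move=> x lx; rewrite eigenfunE // chi_gt0.
rewrite subKr; split=> [|mu]; last exact: restr_eigenvalue_le.
exists ((rep_dim (V c))%:R^-1 * chi c 0).
  exists (chi^~ 0); first by exists 0; rewrite // chi_trivial // oner_eq0.
  by move=> x lx; apply: p_kernel_chi.
by rewrite ger0_norm // mulr_ge0 ?invr_ge0 ?ler0n // ltW // chi_gt0.
Qed.

Lemma fusion_doob N c x y : is_fusion V k N -> minuscule V c -> level_weights k c ->
  level_weights k x -> level_weights k y ->
  fusion_kernel V k N c x y =
    eigenfun V k 0 y / (chi c 0 / (rep_dim (V c))%:R * eigenfun V k 0 x)
    * (p_kernel V c x y)%:C.
Proof.
move=> HN mc lc lx ly; rewrite !eigenfunE // /fusion_kernel (fusion_minuscule HN) //.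
rewrite /p_kernel rmorphM fmorphV !rmorph_nat.
have dn := rep_dim_neq0 (level_dom lc).
by field; rewrite dn !gt_eqF ?chi_gt0.
Qed.

End AtLevel.
End Dirichlet.

Theorem corollary5p3 (R : realType) (K : simpleCompactLie R)
    (D : rootSetting K) (V : tdual (torus D) -> lieRep K)
    (HV : is_irr_family V) (k : nat) (hk : (1 <= k)%N)
    (N : tdual (torus D) -> tdual (torus D) -> tdual (torus D) -> nat)
    (HN : is_fusion V k N)
    (gamma : tdual (torus D)) (Hgamma : level_weights k gamma)
    (Hmin : minuscule V gamma) :
  (forall sigma, level_weights k sigma ->
     dirichlet_eigen V k gamma
       (1 - (rep_dim (V gamma))%:R^-1 * chi V k gamma sigma)
       (eigenfun V k sigma)) /\
  perron_frobenius V k gamma (eigenfun V k 0) /\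
  (forall x y, level_weights k x -> level_weights k y ->
     fusion_kernel V k N gamma x y =
       eigenfun V k 0 y
         / (chi V k gamma 0 / (rep_dim (V gamma))%:R * eigenfun V k 0 x)
       * (p_kernel V gamma x y)%:C).
Proof.
split; last split.
- by move=> sigma ls; apply: eigenfun_dirichlet.
- exact: eigenfun_perron.
- by move=> x y; apply: fusion_doob.
Qed.
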